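(* Let $k$ be an even non-negative integer, let $\chi$ be an odd primitive Dirichlet character modulo $q$, and let $a,x>0$. Then for every complex $\nu$ with $\Re(\nu)>0$, \begin{align*} \sum_{n=1}^\infty\sigma_{k,\chi}(n)n^{\frac{\nu}{2}}K_\nu(a\sqrt{nx})=& \ \delta_{k} \frac{2^{\nu+1}}{a^{\nu+2}} \Gamma(1+\nu)L(1,\chi)x^{-\frac{\nu}{2}-1}+\frac{(-1)^{\frac{k}{2}}i q^k }{a^\nu 2^{k+2-\nu} \pi^{k+1}} \Gamma(\nu)\tau(\chi) \Gamma(k+1)L(k+1,\bar{\chi})\, x^{-\frac{\nu}{2}}\\ &-\frac{(-1)^{\frac{k}{2}}i a^{\nu}q^{\nu+k} x^{\frac{\nu}{2}} }{2^{3\nu+k+2} \pi^{2\nu+k+1}}\Gamma(\nu+k+1)\tau(\chi) \sum_{n=1}^\infty \frac{ \bar{\sigma}_{k,\bar{\chi}}(n)}{\left( n+\frac{a^2qx}{16\pi^2} \right)^{\nu+k+1} }, \end{align*} where $\delta_k=1$ if $k=0$ and $\delta_k=0$ if $k>0$.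
   Context: For a Dirichlet character $\chi$ and $z\in\mathbb{C}$: $\sigma_{z,\chi}(n)=\sum_{d\mid n}d^z\chi(d)$ and $\bar{\sigma}_{z,\chi}(n)=\sum_{d\mid n}d^z\chi(n/d)$. $\tau(\chi)=\sum_{h=1}^q\chi(h)e^{2\pi i h/q}$ is the Gauss sum, $L(s,\chi)$ the Dirichlet $L$-function, $\bar\chi$ the complex conjugate character, and $K_\nu$ the modified Bessel function of the second kind of order $\nu$. *)

(* Defs.v *)
From Stdlib Require Import Reals List Arith ClassicalEpsilon.
From Coquelicot Require Import Coquelicot.
Open Scope R_scope.

Definition Cexp (z : C) : C :=
  (exp (Re z) * cos (Im z), exp (Re z) * sin (Im z)).

Definition Rcpow (x : R) (z : C) : C := Cexp (z * RtoC (ln x))%C.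

Definition Ccosh (z : C) : C := ((Cexp z + Cexp (- z)) / RtoC 2)%C.

(* Gamma(nu) for Re nu > 0, via Euler's integral *)
Definition CGamma (nu : C) : C :=
  @RInt_gen C_R_CompleteNormedModule (fun t : R => (Rcpow t (nu - RtoC 1) * RtoC (exp (- t)))%C)
    (at_right 0) (Rbar_locally p_infty).

Definition BesselK (nu : C) (y : R) : C :=
  @RInt_gen C_R_CompleteNormedModule (fun t : R => (RtoC (exp (- y * cosh t)) * Ccosh (nu * RtoC t))%C)
    (at_point 0) (Rbar_locally p_infty).

Definition CSeries (a : nat -> C) : C :=
  epsilon (inhabits (RtoC 0)) (fun l => is_series a l).

(* Dirichlet characters modulo q, as functions on nat (chi(-1) = chi(q-1)) *)
Definition dirichlet_char (q : nat) (chi : nat -> C) : Prop :=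
  (0 < q)%nat /\
  chi 1%nat = RtoC 1 /\
  (forall m n, chi (m * n)%nat = (chi m * chi n)%C) /\
  (forall n, chi (n + q)%nat = chi n) /\
  (forall n, chi n = RtoC 0 <-> Nat.gcd n q <> 1%nat).

Definition primitive_char (q : nat) (chi : nat -> C) : Prop :=
  forall d, Nat.divide d q -> (d < q)%nat ->
    ~ (forall n, Nat.gcd n q = 1%nat -> n mod d = 1 mod d -> chi n = RtoC 1).

Definition odd_char (q : nat) (chi : nat -> C) : Prop :=
  chi (q - 1)%nat = RtoC (-1).

Definition conj_char (chi : nat -> C) : nat -> C := fun n => Cconj (chi n).

Definition divsum (n : nat) (f : nat -> C) : C :=
  fold_right Cplus (RtoC 0)
    (map f (filter (fun d => Nat.eqb (n mod d) 0) (seq 1 n))).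

Definition sigma_char (k : nat) (chi : nat -> C) (n : nat) : C :=
  divsum n (fun d => (RtoC (INR d ^ k) * chi d)%C).

Definition sigmabar_char (k : nat) (chi : nat -> C) (n : nat) : C :=
  divsum n (fun d => (RtoC (INR d ^ k) * chi (n / d)%nat)%C).

Definition gauss_sum (q : nat) (chi : nat -> C) : C :=
  fold_right Cplus (RtoC 0)
    (map (fun h => (chi h * Cexp (0%R, (2 * PI * INR h / INR q)%R))%C) (seq 1 q)).

Definition Lfun (s : nat) (chi : nat -> C) : C :=
  CSeries (fun n => (chi (S n) / RtoC (INR (S n) ^ s))%C).

(* Main.v *)
Require Import Defs.
From Stdlib Require Import Reals List Arith Classical ClassicalEpsilon Lra Lia Permutation.
From Coquelicot Require Import Coquelicot.
Open Scope R_scope.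

(** Writing [K_nu] as a Mellin integral, the left-hand side becomes the integral of
    [exp (- t) * t ^ (nu - 1) * F (b / t)] with [b = a ^ 2 * x / 4], where [F] is the Lambert series
    [F u = sum sigma_(k,chi)(n) * exp (- n u)].  The theorem is then the termwise integral of the
    transformation formula expressing [F u] through [sum sigmabar_(k,chibar)(n) * exp (- 4 pi^2 n / (q u))].
    That formula comes from two applications of Poisson summation on the half-line: one to
    [t ^ k * exp (- y t) * sin (2 pi h t / q)], after expanding [chi] in sines by means of its Gauss sum,
    and one to [t ^ k * G t] with [G t = sum chibar(n) * exp (- c n t)], which extends smoothly to [t = 0]
    as a rational function of [exp (- c t)].  Keeping [G] summed avoids the conditionally convergent
    double series that would arise for [k = 0], and its value at [0] is what produces [L(1, chi)]. *)

(** Evenness of [k] is what lets the two Poisson summations meet: for even [k] the sine transform of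
    [t ^ k * exp (- y t)] at frequency [w] equals, up to sign, the cosine transform of
    [t ^ k * exp (- w t)] at frequency [y]. With [y = m u] and [w = 2 pi n / q], rescaling by
    [2 pi / u] turns the first Poisson sum, for a fixed cofactor [m], into the cosine transform of
    [t ^ k * G t] at frequency [2 pi m], where [c = 4 pi ^ 2 / (q u)]. Summing over [m] thus gives
    the nonzero frequencies of the second Poisson formula, and the missing zero frequency produces
    [L(k + 1, chibar)]. A half-line has a boundary at 0, so Poisson summation is derived there in
    the manner of Euler and Maclaurin: the second-order Bernoulli remainder tends to 0 uniformly,
    and two exponentially decaying derivatives of the summed function then suffice. Only the
    convergence of the partial sums over the frequencies, taken in order, is asserted. *)

Fixpoint rsum (f : nat -> R) (n : nat) : R :=
  match n with O => 0 | S m => rsum f m + f m end.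

Lemma rsum_ext f g n : (forall i, (i < n)%nat -> f i = g i) -> rsum f n = rsum g n.
Proof.
  induction n as [|n IH]; intros H; simpl; auto.
  rewrite IH by (intros; apply H; lia). rewrite H by lia. reflexivity.
Qed.

Lemma rsum_plus f g n : rsum (fun i => f i + g i) n = rsum f n + rsum g n.
Proof. induction n; simpl; [ring|rewrite IHn; ring]. Qed.

Lemma rsum_scal c f n : rsum (fun i => c * f i) n = c * rsum f n.
Proof. induction n; simpl; [ring|rewrite IHn; ring]. Qed.

Lemma rsum_le f g n : (forall i, (i < n)%nat -> f i <= g i) -> rsum f n <= rsum g n.
Proof.
  induction n as [|n IH]; intros H; simpl; [lra|].
  apply Rplus_le_compat; [apply IH; intros; apply H; lia | apply H; lia].
Qed.

Lemma sum_n_rsum (f : nat -> R) n : sum_n f n = rsum f (S n).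
Proof.
  induction n.
  - rewrite sum_O; simpl; ring.
  - rewrite sum_Sn, IHn; reflexivity.
Qed.

Lemma is_series_rsum (f : nat -> R) (l : R) :
  is_series f l <-> is_lim_seq (rsum f) l.
Proof.
  split; intros H.
  - apply is_lim_seq_incr_1. eapply is_lim_seq_ext; [|exact H].
    intros; apply sum_n_rsum.
  - apply is_lim_seq_incr_1 in H.
    change (is_lim_seq (sum_n f) l).
    eapply is_lim_seq_ext; [|exact H]. intros; symmetry; apply sum_n_rsum.
Qed.

(** * The second Bernoulli polynomial and its Fourier series *)

(* Up to an additive constant, [B_2(t) / 2] minus the [J]-th partial sum of its Fourier series. *)
Definition bern2_rem (J : nat) (t : R) : R :=
  t ^ 2 / 2 - t / 2 - rsum (fun j => cos (2 * PI * INR (S j) * t) / (2 * PI ^ 2 * INR (S j) ^ 2)) J.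

(** The sawtooth [t - 1 / 2] minus the partial sum of its Fourier series. The sines vanish at 0 and
    1, so the end values are [- 1 / 2] and [1 / 2] for every [J]; these become the trapezoidal
    weights in Poisson summation. *)
Definition bern1_rem (J : nat) (t : R) : R :=
  t - 1 / 2 + rsum (fun j => sin (2 * PI * INR (S j) * t) / (PI * INR (S j))) J.

Definition dirichlet_kernel (J : nat) (t : R) : R :=
  1 + 2 * rsum (fun j => cos (2 * PI * INR (S j) * t)) J.

Lemma is_derive_rsum (f df : nat -> R -> R) n t :
  (forall i, (i < n)%nat -> is_derive (f i) t (df i t)) ->
  is_derive (fun t => rsum (fun i => f i t) n) t (rsum (fun i => df i t) n).
Proof.
  induction n as [|n IH]; intros H; simpl.
  - apply @is_derive_const.
  - eapply @is_derive_plus; [apply IH; intros; apply H; lia|apply H; lia].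
Qed.

Lemma INR_S_pos j : 0 < INR (S j).
Proof. apply lt_0_INR; lia. Qed.

Lemma is_derive_bern2_rem J t : is_derive (bern2_rem J) t (bern1_rem J t).
Proof.
  pose proof PI_RGT_0.
  assert (H1 : is_derive (fun t : R => t ^ 2 / 2 - t / 2) t (t - 1 / 2)).
  { auto_derive; [trivial|]. field. }
  assert (H2 := is_derive_rsum
    (fun j t => cos (2 * PI * INR (S j) * t) / (2 * PI ^ 2 * INR (S j) ^ 2))
    (fun j t => - 1 * (sin (2 * PI * INR (S j) * t) / (PI * INR (S j)))) J t).
  evar_last.
  - apply (is_derive_minus _ _ t _ _ H1 (H2 ltac:(
      intros j _; pose proof (INR_S_pos j);
      set (x := INR (S j)) in *; cbv beta; fold x; auto_derive; [trivial|field; lra]))).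
  - rewrite rsum_scal. unfold bern1_rem, minus, plus, opp; simpl. ring.
Qed.

Lemma is_derive_bern1_rem J t : is_derive (bern1_rem J) t (dirichlet_kernel J t).
Proof.
  pose proof PI_RGT_0.
  assert (H1 : is_derive (fun t : R => t - 1 / 2) t 1).
  { auto_derive; [trivial|]. ring. }
  assert (H2 := is_derive_rsum
    (fun j t => sin (2 * PI * INR (S j) * t) / (PI * INR (S j)))
    (fun j t => 2 * cos (2 * PI * INR (S j) * t)) J t).
  evar_last.
  - apply (is_derive_plus _ _ t _ _ H1 (H2 ltac:(
      intros j _; pose proof (INR_S_pos j);
      set (x := INR (S j)) in *; cbv beta; fold x; auto_derive; [trivial|field; lra]))).
  - rewrite rsum_scal. unfold dirichlet_kernel, plus; simpl. ring.
Qed.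

Lemma sin_mul_dirichlet_kernel J t :
  sin (PI * t) * dirichlet_kernel J t = sin ((2 * INR J + 1) * PI * t).
Proof.
  unfold dirichlet_kernel. induction J as [|J IH].
  - simpl. replace ((2 * 0 + 1) * PI * t) with (PI * t) by ring. ring.
  - cbn [rsum].
    replace (sin (PI * t) * (1 + 2 * (rsum (fun j : nat => cos (2 * PI * INR (S j) * t)) J + cos (2 * PI * INR (S J) * t))))
      with (sin (PI * t) * (1 + 2 * rsum (fun j : nat => cos (2 * PI * INR (S j) * t)) J) + 2 * sin (PI * t) * cos (2 * PI * INR (S J) * t)) by ring.
    rewrite IH, S_INR.
    replace ((2 * INR J + 1) * PI * t) with (2 * PI * (INR J + 1) * t - PI * t) by ring.
    replace ((2 * (INR J + 1) + 1) * PI * t) with (2 * PI * (INR J + 1) * t + PI * t) by ring.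
    rewrite sin_minus, sin_plus. ring.
Qed.

Lemma sin_INR_PI n : sin (INR n * PI) = 0.
Proof.
  induction n; [simpl; rewrite Rmult_0_l; apply sin_0|].
  rewrite S_INR. replace ((INR n + 1) * PI) with (INR n * PI + PI) by ring.
  rewrite neg_sin, IHn; ring.
Qed.

Lemma bern1_rem_half J : bern1_rem J (1 / 2) = 0.
Proof.
  unfold bern1_rem. rewrite (rsum_ext _ (fun _ => 0 * 0)).
  - rewrite rsum_scal. lra.
  - intros j _. replace (2 * PI * INR (S j) * (1 / 2)) with (INR (S j) * PI) by field.
    rewrite sin_INR_PI. unfold Rdiv. ring.
Qed.

Lemma bern1_rem_0 J : bern1_rem J 0 = - 1 / 2.
Proof.
  unfold bern1_rem. rewrite (rsum_ext _ (fun _ => 0 * 0)).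
  - rewrite rsum_scal. lra.
  - intros j _. rewrite Rmult_0_r, sin_0. unfold Rdiv. ring.
Qed.

Lemma bern1_rem_1 J : bern1_rem J 1 = 1 / 2.
Proof.
  unfold bern1_rem. rewrite (rsum_ext _ (fun _ => 0 * 0)).
  - rewrite rsum_scal. lra.
  - intros j _. replace (2 * PI * INR (S j) * 1) with (INR (2 * S j) * PI)
      by (rewrite mult_INR; simpl (INR 2); ring).
    rewrite sin_INR_PI. unfold Rdiv. ring.
Qed.

Lemma bern2_rem_sym J t : bern2_rem J (1 - t) = bern2_rem J t.
Proof.
  unfold bern2_rem. f_equal; [field|].
  apply rsum_ext. intros j _. f_equal.
  replace (2 * PI * INR (S j) * (1 - t)) with (- (2 * PI * INR (S j) * t) + 2 * INR (S j) * PI) by ring.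
  rewrite cos_period, cos_neg. reflexivity.
Qed.

Lemma cos_half_odd J : cos ((2 * INR J + 1) * PI * (1 / 2)) = 0.
Proof.
  replace ((2 * INR J + 1) * PI * (1 / 2)) with (INR J * PI + PI / 2) by field.
  rewrite cos_plus, sin_INR_PI, cos_PI2. ring.
Qed.

Lemma sin_PI_pos t : 0 < t < 1 -> 0 < sin (PI * t).
Proof. pose proof PI_RGT_0. intros; apply sin_gt_0; nra. Qed.

Lemma sin_PI_ge eta t : 0 < eta <= 1 / 2 -> eta <= t <= 1 - eta -> sin (PI * eta) <= sin (PI * t).
Proof.
  pose proof PI_RGT_0. intros He Ht.
  destruct (Rle_dec t (1 / 2)).
  - apply sin_incr_1; nra.
  - replace (PI * t) with (PI - PI * (1 - t)) by ring. rewrite sin_PI_x.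
    apply sin_incr_1; nra.
Qed.

Lemma MVT_abs (f df : R -> R) a b M :
  (forall x, Rmin a b <= x <= Rmax a b -> is_derive f x (df x)) ->
  (forall x, Rmin a b <= x <= Rmax a b -> Rabs (df x) <= M) ->
  Rabs (f b - f a) <= M * Rabs (b - a).
Proof.
  intros Hd Hb.
  destruct (MVT_gen f a b df) as [c [Hc ->]].
  - intros x Hx; apply Hd; lra.
  - intros x Hx; apply continuity_pt_filterlim.
    apply @ex_derive_continuous. eexists; apply Hd; exact Hx.
  - rewrite Rabs_mult. apply Rmult_le_compat_r; [apply Rabs_pos|apply Hb; exact Hc].
Qed.

(* Integrate the Dirichlet kernel by parts from [1 / 2], where [bern1_rem] vanishes. *)
Lemma bern1_rem_bound J eta t : 0 < eta <= 1 / 2 -> eta <= t <= 1 - eta ->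
  Rabs (bern1_rem J t) <= 2 / ((2 * INR J + 1) * sin (PI * eta) ^ 2).
Proof.
  intros He Ht. pose proof PI_RGT_0 as HPI. pose proof PI2_3_2 as HPI2.
  pose proof (pos_INR J) as HJ.
  set (n := 2 * INR J + 1). assert (Hn : 1 <= n) by (unfold n; lra).
  assert (Hs : 0 < sin (PI * eta)) by (apply sin_PI_pos; lra).
  set (s := sin (PI * eta)) in *.
  assert (Hs1 : s <= 1) by apply SIN_bound.
  (* The added boundary term replaces [sin (n * PI * x) / sin (PI * x)] in the derivative by a
     quantity of size [1 / n]; [Y] vanishes at [1 / 2] because [n] is odd. *)
  set (Y := fun t => bern1_rem J t + cos (n * PI * t) / (n * PI * sin (PI * t))).
  assert (HY : forall x, eta <= x <= 1 - eta ->
    is_derive Y x (- (cos (n * PI * x) * cos (PI * x)) / (n * sin (PI * x) ^ 2))).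
  { intros x Hx. assert (Hsx : 0 < sin (PI * x)) by (apply sin_PI_pos; lra).
    assert (H1 : is_derive (fun x : R => cos (n * PI * x) / (n * PI * sin (PI * x))) x
      (- sin (n * PI * x) / sin (PI * x) - cos (n * PI * x) * cos (PI * x) / (n * sin (PI * x) ^ 2))).
    { auto_derive; [|field; lra].
      apply Rmult_integral_contrapositive_currified; [nra|lra]. }
    evar_last.
    - apply (is_derive_plus _ _ x _ _ (is_derive_bern1_rem J x) H1).
    - unfold plus; simpl. unfold n at 1.
      rewrite <- sin_mul_dirichlet_kernel. fold n. field. lra. }
  assert (HYb : Rabs (Y t - Y (1 / 2)) <= (1 / (n * s ^ 2)) * Rabs (t - 1 / 2)).
  { assert (Hin : forall x, Rmin (1 / 2) t <= x <= Rmax (1 / 2) t -> eta <= x <= 1 - eta).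
    { intros x. unfold Rmin, Rmax. destruct (Rle_dec (1/2) t); lra. }
    eapply MVT_abs.
    - intros x Hx; apply HY, Hin, Hx.
    - intros x Hx. apply Hin in Hx. pose proof (sin_PI_ge eta x He Hx) as Hsx. fold s in Hsx.
      unfold Rdiv at 1. rewrite Rabs_mult, Rabs_Ropp, Rabs_mult.
      rewrite (Rabs_pos_eq (/ _)).
      2:{ left; apply Rinv_0_lt_compat. apply Rmult_lt_0_compat; [lra|apply pow_lt; lra]. }
      assert (Rabs (cos (n * PI * x)) <= 1) by (apply Rabs_le; pose proof (COS_bound (n * PI * x)); lra).
      assert (Rabs (cos (PI * x)) <= 1) by (apply Rabs_le; pose proof (COS_bound (PI * x)); lra).
      unfold Rdiv. apply Rmult_le_compat.
      + apply Rmult_le_pos; apply Rabs_pos.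
      + left; apply Rinv_0_lt_compat. apply Rmult_lt_0_compat; [lra|apply pow_lt; lra].
      + pose proof (Rabs_pos (cos (n * PI * x))). pose proof (Rabs_pos (cos (PI * x))). nra.
      + apply Rinv_le_contravar; [apply Rmult_lt_0_compat; [lra|apply pow_lt; lra]|].
        apply Rmult_le_compat_l; [lra|apply pow_incr; lra]. }
  assert (HYh : Y (1 / 2) = 0).
  { unfold Y. rewrite bern1_rem_half. unfold n. rewrite cos_half_odd. unfold Rdiv; ring. }
  rewrite HYh, Rminus_0_r in HYb.
  replace (bern1_rem J t) with (Y t - cos (n * PI * t) / (n * PI * sin (PI * t))) by (unfold Y; ring).
  pose proof (sin_PI_ge eta t He Ht) as Hst. fold s in Hst.
  assert (Hc : Rabs (cos (n * PI * t) / (n * PI * sin (PI * t))) <= 1 / (n * s ^ 2)).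
  { unfold Rdiv. rewrite Rabs_mult. rewrite (Rabs_pos_eq (/ _)).
    2:{ left; apply Rinv_0_lt_compat. apply Rmult_lt_0_compat; [nra|lra]. }
    apply Rmult_le_compat.
    - apply Rabs_pos.
    - left; apply Rinv_0_lt_compat. apply Rmult_lt_0_compat; [nra|lra].
    - apply Rabs_le; pose proof (COS_bound (n * PI * t)); lra.
    - apply Rinv_le_contravar; [apply Rmult_lt_0_compat; [lra|apply pow_lt; lra]|].
      rewrite Rmult_assoc. apply Rmult_le_compat_l; [lra|]. simpl. nra. }
  assert (Hq : 0 < 1 / (n * s ^ 2)).
  { apply Rdiv_lt_0_compat; [lra|]. apply Rmult_lt_0_compat; [lra|apply pow_lt; lra]. }
  assert (Rabs (t - 1 / 2) <= 1) by (apply Rabs_le; lra).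
  eapply Rle_trans; [apply Rabs_triang|]. rewrite Rabs_Ropp.
  replace (2 / (n * s ^ 2)) with (1 / (n * s ^ 2) + 1 / (n * s ^ 2)).
  2:{ field. lra. }
  apply Rplus_le_compat; [|exact Hc].
  eapply Rle_trans; [exact HYb|]. pose proof (Rabs_pos (t - 1/2)). nra.
Qed.

Lemma is_lim_seq_inv_odd (K : R) : is_lim_seq (fun J => K / (2 * INR J + 1)) 0.
Proof.
  replace (Finite 0) with (Rbar_mult K (Finite 0)) by (simpl; f_equal; ring).
  apply (is_lim_seq_scal_l (fun J => / (2 * INR J + 1)) K 0).
  replace (Finite 0) with (Rbar_inv p_infty) by reflexivity.
  apply is_lim_seq_inv; [|discriminate].
  apply is_lim_seq_le_p_loc with INR.
  - exists O. intros n _. pose proof (pos_INR n); lra.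
  - apply is_lim_seq_INR.
Qed.

Lemma bern1_rem_lim t : 0 < t < 1 -> is_lim_seq (fun J => bern1_rem J t) 0.
Proof.
  intros Ht. set (eta := Rmin t (1 - t)).
  assert (He : 0 < eta <= 1 / 2 /\ eta <= t <= 1 - eta).
  { unfold eta, Rmin. destruct (Rle_dec t (1 - t)); lra. }
  destruct He as [He1 He2].
  apply is_lim_seq_abs_0.
  apply is_lim_seq_le_le with (u := fun _ => 0) (w := fun J => (2 / sin (PI * eta) ^ 2) / (2 * INR J + 1)).
  - intros J. split; [apply Rabs_pos|].
    eapply Rle_trans; [apply (bern1_rem_bound J eta t); lra|].
    right. assert (0 < sin (PI * eta)) by (apply sin_PI_pos; lra).
    pose proof (pos_INR J). field. lra.
  - apply is_lim_seq_const.
  - apply is_lim_seq_inv_odd.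
Qed.

Lemma one_minus_cos_le x : 0 <= 1 - cos x <= x ^ 2 / 2.
Proof.
  split; [pose proof (COS_bound x); lra|].
  replace x with (2 * (x / 2)) at 1 by field. rewrite cos_2a_sin.
  assert (Rabs (sin (x / 2)) <= Rabs (x / 2)).
  { destruct (Rle_dec 0 (x / 2)) as [H|H].
    - destruct (Rle_lt_or_eq_dec _ _ H) as [H'|H'].
      + rewrite (Rabs_pos_eq (x / 2)) by lra. apply Rabs_le.
        pose proof (sin_lt_x (x / 2) H'). split; [|lra].
        pose proof (SIN_bound (x / 2)). destruct (Rle_dec 1 (x / 2)); [lra|].
        pose proof PI2_3_2. assert (0 <= sin (x/2)) by (apply sin_ge_0; lra). lra.
      + rewrite <- H', sin_0, Rabs_R0. lra.
    - rewrite <- (Rabs_Ropp (sin (x/2))), <- sin_neg, <- (Rabs_Ropp (x / 2)).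
      set (y := - (x / 2)). assert (Hy : 0 < y) by (unfold y; lra).
      rewrite (Rabs_pos_eq y) by lra. apply Rabs_le.
      pose proof (sin_lt_x y Hy). split; [|lra].
      pose proof (SIN_bound y). destruct (Rle_dec 1 y); [lra|].
      pose proof PI2_3_2. assert (0 <= sin y) by (apply sin_ge_0; lra). lra. }
  pose proof (Rabs_pos (sin (x/2))).
  assert (Rabs (sin (x / 2)) ^ 2 <= Rabs (x / 2) ^ 2) by (apply pow_incr; lra).
  rewrite !pow2_abs in H1.
  nra.
Qed.

(** Near an end the estimate must be uniform in [J]. Each term of the difference is at most [t ^ 2]
    and at most [1 / j ^ 2]: the first bound serves for [j <= M] and totals [M * t ^ 2 <= 1 / M],
    the second has a telescoping tail of at most [1 / M]. *)
Lemma bern2_rem_small J M t : (1 <= M)%nat -> 0 <= t <= / INR M ->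
  Rabs (bern2_rem J t - bern2_rem J 0) <= 3 / INR M.
Proof.
  intros HM Ht. assert (HM' : 1 <= INR M) by (apply (le_INR 1); lia).
  pose proof PI_RGT_0. pose proof PI2_3_2.
  assert (Hm : 0 < / INR M <= 1) by (split; [apply Rinv_0_lt_compat; lra|rewrite <- Rinv_1; apply Rinv_le_contravar; lra]).
  set (m := / INR M) in *.
  set (c := fun j => (1 - cos (2 * PI * INR (S j) * t)) / (2 * PI ^ 2 * INR (S j) ^ 2)).
  assert (E : bern2_rem J t - bern2_rem J 0 = (t ^ 2 - t) / 2 + rsum c J).
  { unfold bern2_rem.
    assert (E : forall g h J, rsum g J - rsum h J = rsum (fun j => g j + (-1) * h j) J).
    { intros; rewrite rsum_plus, rsum_scal; ring. }
    rewrite (rsum_ext c (fun j => cos (2 * PI * INR (S j) * 0) / (2 * PI ^ 2 * INR (S j) ^ 2) + (-1) * (cos (2 * PI * INR (S j) * t) / (2 * PI ^ 2 * INR (S j) ^ 2)))).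
    - rewrite <- E. field.
    - intros j _. unfold c. rewrite Rmult_0_r, cos_0. unfold Rdiv; ring. }
  rewrite E.
  assert (Hc : forall j, 0 <= c j <= t ^ 2 /\ c j <= / INR (S j) ^ 2).
  { intros j. unfold c. pose proof (INR_S_pos j) as Hj. set (x := INR (S j)) in *.
    pose proof (one_minus_cos_le (2 * PI * x * t)) as [H1 H2].
    pose proof (COS_bound (2 * PI * x * t)).
    assert (Hd : 0 < 2 * PI ^ 2 * x ^ 2) by (apply Rmult_lt_0_compat; [apply Rmult_lt_0_compat; [lra|apply pow_lt; lra]|apply pow_lt; lra]).
    split; [split|].
    - apply Rdiv_le_0_compat; lra.
    - apply Rle_div_l; [lra|]. replace (t ^ 2 * (2 * PI ^ 2 * x ^ 2)) with ((2 * PI * x * t) ^ 2 / 2) by field. lra.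
    - apply Rle_div_l; [lra|]. replace (/ x ^ 2 * (2 * PI ^ 2 * x ^ 2)) with (2 * PI ^ 2) by (field; lra). nra. }
  assert (Hs : forall J, 0 <= rsum c J /\ ((J <= M)%nat -> rsum c J <= INR J * t ^ 2) /\ ((M <= J)%nat -> rsum c J <= INR M * t ^ 2 + (m - / INR J))).
  { clear E J. induction J as [|J [IH0 [IH1 IH2]]].
    - cbn [rsum]. repeat split; try lra.
      + intros _. simpl; lra.
      + intros; lia.
    - cbn [rsum]. destruct (Hc J) as [[Hc1 Hc2] Hc3].
      repeat split; [lra| |].
      + intros HJ. rewrite S_INR. specialize (IH1 ltac:(lia)). lra.
      + intros HJ. destruct (Nat.eq_dec M (S J)) as [e|ne].
        * rewrite <- e. unfold m. rewrite e, S_INR.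
          specialize (IH1 ltac:(lia)). lra.
        * specialize (IH2 ltac:(lia)). assert (0 < INR J) by (apply lt_0_INR; lia).
          assert (/ INR (S J) ^ 2 <= / INR J - / INR (S J)).
          { rewrite S_INR. replace (/ INR J - / (INR J + 1)) with (/ (INR J * (INR J + 1))) by (field; lra).
            apply Rinv_le_contravar; nra. }
          lra. }
  assert (Ht2 : INR M * t ^ 2 <= m).
  { assert (t ^ 2 <= m ^ 2) by (apply pow_incr; lra).
    assert (INR M * m ^ 2 = m) by (unfold m; field; lra). nra. }
  assert (HB : 0 <= rsum c J <= 2 * m).
  { destruct (Hs J) as [A [B C]]. split; [exact A|].
    destruct (le_lt_dec J M) as [h|h].
    - specialize (B h). apply le_INR in h. pose proof (pow2_ge_0 t). nra.
    - specialize (C ltac:(lia)). assert (0 < / INR J) by (apply Rinv_0_lt_compat, lt_0_INR; lia). lra. }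
  apply Rabs_le. unfold Rdiv. fold m. split; nra.
Qed.

(** Within [eta] of 0 the uniform end estimate applies, near 1 its reflection under [t -> 1 - t]; in
    between, the derivative [bern1_rem] is uniformly small and is integrated from [eta]. *)
Lemma bern2_rem_unif_lim (eps : R) : 0 < eps ->
  exists N, forall J, (N <= J)%nat -> forall t, 0 <= t <= 1 ->
    Rabs (bern2_rem J t - bern2_rem J 0) <= eps.
Proof.
  intros He.
  destruct (nfloor_ex (6 / eps)) as [M0 [_ HM0]]; [apply Rdiv_le_0_compat; lra|].
  (* [M > 6 / eps] brings the end estimate [3 / M] below [eps / 2]; the summand 2 keeps
     [eta = 1 / M] at most [1 / 2]. *)
  set (M := (2 + M0)%nat).
  assert (HM : 2 <= INR M /\ 6 / eps < INR M).
  { unfold M; rewrite plus_INR; simpl (INR 2). pose proof (pos_INR M0). lra. }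
  destruct HM as [HM1 HM2].
  assert (H3 : 3 / INR M <= eps / 2).
  { apply Rlt_div_l in HM2; [|lra]. apply Rle_div_l; lra. }
  set (eta := / INR M).
  assert (Heta : 0 < eta <= 1 / 2).
  { unfold eta; split; [apply Rinv_0_lt_compat; lra|].
    replace (1 / 2) with (/ 2) by field. apply Rinv_le_contravar; lra. }
  assert (Hs : 0 < sin (PI * eta)) by (apply sin_PI_pos; lra).
  destruct (proj2 (is_lim_seq_spec _ _) (is_lim_seq_inv_odd (2 / sin (PI * eta) ^ 2)) (mkposreal (eps / 2) ltac:(lra))) as [N HN].
  exists N. intros J HJ t Ht.
  specialize (HN J HJ). simpl in HN. rewrite Rminus_0_r in HN.
  destruct (Rle_dec t eta) as [h|h].
  { eapply Rle_trans; [apply (bern2_rem_small J M t); [unfold M; lia|unfold eta in *; lra]|lra]. }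
  destruct (Rle_dec (1 - eta) t) as [h'|h'].
  { rewrite <- (bern2_rem_sym J t).
    eapply Rle_trans; [apply (bern2_rem_small J M (1 - t)); [unfold M; lia|unfold eta in *; lra]|lra]. }
  replace (bern2_rem J t - bern2_rem J 0) with ((bern2_rem J t - bern2_rem J eta) + (bern2_rem J eta - bern2_rem J 0)) by ring.
  eapply Rle_trans; [apply Rabs_triang|].
  replace eps with (eps / 2 + eps / 2) by field.
  apply Rplus_le_compat.
  - eapply Rle_trans.
    + apply (MVT_abs (bern2_rem J) (bern1_rem J) eta t (eps / 2)).
      * intros; apply is_derive_bern2_rem.
      * intros x Hx. rewrite Rmin_left, Rmax_right in Hx by lra.
        eapply Rle_trans; [apply (bern1_rem_bound J eta x); lra|].
        left. eapply Rle_lt_trans; [|exact HN].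
        eapply Rle_trans; [|apply Rle_abs]. right.
        pose proof (pos_INR J). field. lra.
    + assert (Rabs (t - eta) <= 1) by (apply Rabs_le; lra). pose proof (Rabs_pos (t - eta)). nra.
  - eapply Rle_trans; [apply (bern2_rem_small J M eta); [unfold M; lia|unfold eta in *; lra]|lra].
Qed.

(** * Poisson summation on the half-line *)

(* The exponents [d] in [exp_C2] may be negative, so that polynomials are covered. *)
Definition exp_C2 (d : R) (f f1 f2 : R -> R) : Prop :=
  (forall t, is_derive f t (f1 t)) /\ (forall t, is_derive f1 t (f2 t)) /\
  (forall t, continuous f2 t) /\
  exists K, 0 <= K /\ forall t, 0 <= t ->
    Rabs (f t) <= K * exp (- d * t) /\ Rabs (f1 t) <= K * exp (- d * t) /\
    Rabs (f2 t) <= K * exp (- d * t).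

Lemma continuous_of_derive (f f1 : R -> R) t : is_derive f t (f1 t) -> continuous f t.
Proof. intros H. apply @ex_derive_continuous. eexists; exact H. Qed.

Lemma continuous_dirichlet_kernel J t : continuous (dirichlet_kernel J) t.
Proof.
  unfold dirichlet_kernel.
  apply (continuous_plus (fun _ => 1) (fun t => 2 * rsum (fun j => cos (2 * PI * INR (S j) * t)) J)).
  - apply continuous_const.
  - apply (continuous_mult (fun _ => 2)); [apply continuous_const|].
    apply @ex_derive_continuous. eexists.
    apply (is_derive_rsum (fun j t => cos (2 * PI * INR (S j) * t)) (fun j t => - sin (2 * PI * INR (S j) * t) * (2 * PI * INR (S j)))).
    intros j _. set (x := INR (S j)). auto_derive; [trivial|ring].
Qed.

(** Two integrations by parts: the end values of [bern1_rem] give the trapezoidal mean of [f], those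
    of [bern2_rem J t - bern2_rem J 0] vanish, and what remains is the integral of [f2] against a
    uniformly small function. *)
Lemma unit_poisson_remainder (f f1 f2 : R -> R) J eps K :
  (forall t, is_derive f t (f1 t)) -> (forall t, is_derive f1 t (f2 t)) ->
  (forall t, continuous f2 t) ->
  (forall t, 0 <= t <= 1 -> Rabs (bern2_rem J t - bern2_rem J 0) <= eps) ->
  (forall t, 0 <= t <= 1 -> Rabs (f2 t) <= K) ->
  exists I, is_RInt (fun t => f t * dirichlet_kernel J t) 0 1 I /\
    Rabs ((f 0 + f 1) / 2 - I) <= eps * K.
Proof.
  intros H1 H2 H3 Hb HK.
  set (b := fun t => bern2_rem J t - bern2_rem J 0).
  assert (Hbd : forall t, is_derive b t (bern1_rem J t)).
  { intros t. unfold b. evar_last.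
    - apply (is_derive_minus _ _ t _ _ (is_derive_bern2_rem J t) (@is_derive_const R_AbsRing R_NormedModule (bern2_rem J 0) t)).
    - unfold minus, plus, opp, zero; simpl. ring. }
  assert (Hbc : forall t, continuous b t) by (intros t; apply (continuous_of_derive b (bern1_rem J)), Hbd).
  set (V := fun t => f t * bern1_rem J t - f1 t * b t).
  assert (HV : is_RInt (fun t => f t * dirichlet_kernel J t - f2 t * b t) 0 1 (minus (V 1) (V 0))).
  { apply (is_RInt_derive V).
    - intros t _. unfold V. evar_last.
      + apply (is_derive_minus _ _ t _ _
          (is_derive_mult f (bern1_rem J) t _ _ (H1 t) (is_derive_bern1_rem J t) Rmult_comm)
          (is_derive_mult f1 b t _ _ (H2 t) (Hbd t) Rmult_comm)).
      + unfold minus, plus, opp, mult; simpl. ring.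
    - intros t _.
      apply (continuous_minus (fun t => f t * dirichlet_kernel J t) (fun t => f2 t * b t)).
      + apply (continuous_mult f); [apply (continuous_of_derive f f1), H1|apply continuous_dirichlet_kernel].
      + apply (continuous_mult f2); auto. }
  assert (HE : minus (V 1) (V 0) = (f 0 + f 1) / 2).
  { assert (Hb1 : b 1 = 0).
    { unfold b. rewrite <- (bern2_rem_sym J 1). replace (1 - 1) with 0 by ring. ring. }
    assert (Hb0 : b 0 = 0) by (unfold b; ring).
    unfold V. rewrite Hb1, Hb0, bern1_rem_1, bern1_rem_0. unfold minus, plus, opp; simpl. field. }
  rewrite HE in HV.
  assert (Hc2 : forall t, continuous (fun t => f2 t * b t) t) by (intros t; apply (continuous_mult f2); auto).
  destruct (ex_RInt_continuous (V := R_CompleteNormedModule) (fun t => f2 t * b t) 0 1) as [I2 HI2]; [intros; apply Hc2|].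
  exists ((f 0 + f 1) / 2 + I2). split.
  - eapply is_RInt_ext; [|apply (is_RInt_plus _ _ _ _ _ _ HV HI2)].
    intros t _. unfold plus; simpl. ring.
  - replace ((f 0 + f 1) / 2 - ((f 0 + f 1) / 2 + I2)) with (- I2) by ring.
    rewrite Rabs_Ropp.
    replace (eps * K) with ((1 - 0) * (eps * K)) by ring.
    apply (norm_RInt_le_const (V := R_NormedModule) (fun t => f2 t * b t) 0 1 I2 (eps * K)); [lra| |exact HI2].
    intros t Ht. change (Rabs (f2 t * b t) <= eps * K). rewrite Rabs_mult, Rmult_comm.
    apply Rmult_le_compat; try apply Rabs_pos; [apply Hb|apply HK]; lra.
Qed.

Lemma dirichlet_kernel_period J t n : dirichlet_kernel J (t + INR n) = dirichlet_kernel J t.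
Proof.
  unfold dirichlet_kernel. do 2 f_equal. apply rsum_ext. intros j _.
  replace (2 * PI * INR (S j) * (t + INR n)) with (2 * PI * INR (S j) * t + 2 * INR (S j * n) * PI)
    by (rewrite mult_INR; ring).
  apply cos_period.
Qed.

Lemma exp_mul_INR x n : exp (x * INR n) = exp x ^ n.
Proof.
  induction n; [simpl; rewrite Rmult_0_r; apply exp_0|].
  rewrite S_INR, Rmult_plus_distr_l, exp_plus, IHn, Rmult_1_r. simpl; ring.
Qed.

(** Unit intervals are chained by the periodicity of the kernel. On the [i]-th interval [f2] carries
    the weight [exp (- d) ^ i], and these weights sum to the geometric quotient in the bound, which
    stays bounded as [D] grows. *)
Lemma poisson_finite (f f1 f2 : R -> R) J eps K d :
  (forall t, is_derive f t (f1 t)) -> (forall t, is_derive f1 t (f2 t)) ->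
  (forall t, continuous f2 t) -> 0 < d ->
  (forall t, 0 <= t <= 1 -> Rabs (bern2_rem J t - bern2_rem J 0) <= eps) -> 0 <= eps -> 0 <= K ->
  (forall t, 0 <= t -> Rabs (f2 t) <= K * exp (- d * t)) ->
  forall D, exists I, is_RInt (fun t => f t * dirichlet_kernel J t) 0 (INR D) I /\
    Rabs (f 0 / 2 + rsum (fun i => f (INR (S i))) D - f (INR D) / 2 - I) <=
      eps * (K * ((1 - exp (- d) ^ D) / (1 - exp (- d)))).
Proof.
  intros H1 H2 H3 Hd Hb He HK0 HK D.
  assert (Hr : exp (- d) < 1) by (rewrite <- exp_0; apply exp_increasing; lra).
  induction D as [|D [I [HI HB]]].
  - exists 0. split; [apply @is_RInt_point|]. simpl.
    replace (f 0 / 2 + 0 - f 0 / 2 - 0) with 0 by ring. rewrite Rabs_R0.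
    right. field. lra.
  - destruct (unit_poisson_remainder (fun t => f (t + INR D)) (fun t => f1 (t + INR D)) (fun t => f2 (t + INR D)) J eps (K * exp (- d) ^ D)) as [I' [HI' HB']].
    + intros t. evar_last; [apply (is_derive_comp f (fun t => t + INR D)); [apply H1|]|].
      * evar_last; [apply (is_derive_plus (fun t => t) (fun _ => INR D)); [apply @is_derive_id|apply @is_derive_const]|]. reflexivity.
      * unfold scal, plus, one, zero; simpl; unfold mult; simpl; ring.
    + intros t. evar_last; [apply (is_derive_comp f1 (fun t => t + INR D)); [apply H2|]|].
      * evar_last; [apply (is_derive_plus (fun t => t) (fun _ => INR D)); [apply @is_derive_id|apply @is_derive_const]|]. reflexivity.
      * unfold scal, plus, one, zero; simpl; unfold mult; simpl; ring.
    + intros t. apply (continuous_comp (fun t => t + INR D) f2); [|apply H3].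
      apply (continuous_plus (fun t => t) (fun _ => INR D)); [apply continuous_id|apply continuous_const].
    + exact Hb.
    + intros t Ht. pose proof (pos_INR D). eapply Rle_trans; [apply HK; lra|].
      apply Rmult_le_compat_l; [lra|].
      rewrite <- exp_mul_INR. destruct (Req_dec t 0) as [->|].
      * right. f_equal. ring.
      * left. apply exp_increasing. nra.
    + exists (I + I'). split.
      * apply (is_RInt_Chasles _ 0 (INR D) (INR (S D)) I I' HI).
        assert (HH : is_RInt (fun t => scal 1 ((fun t => f (t + INR D) * dirichlet_kernel J t) (1 * t + - INR D))) (INR D) (INR (S D)) I').
        { apply (is_RInt_comp_lin (fun t => f (t + INR D) * dirichlet_kernel J t) 1 (- INR D) (INR D) (INR (S D)) I').
          rewrite S_INR. replace (1 * INR D + - INR D) with 0 by ring.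
          replace (1 * (INR D + 1) + - INR D) with 1 by ring. exact HI'. }
        eapply is_RInt_ext; [|exact HH].
        intros t _. cbv beta. unfold scal; simpl; unfold mult; simpl. rewrite Rmult_1_l.
        replace (1 * t + - INR D + INR D) with t by ring.
        rewrite <- (dirichlet_kernel_period J (1 * t + - INR D) D).
        replace (1 * t + - INR D + INR D) with t by ring. reflexivity.
      * cbn [rsum].
        replace (0 + INR D) with (INR D) in HB' by ring.
        replace (1 + INR D) with (INR (S D)) in HB' by (rewrite S_INR; ring).
        replace (f 0 / 2 + (rsum (fun i => f (INR (S i))) D + f (INR (S D))) - f (INR (S D)) / 2 - (I + I'))
          with ((f 0 / 2 + rsum (fun i => f (INR (S i))) D - f (INR D) / 2 - I) + ((f (INR D) + f (INR (S D))) / 2 - I')) by field.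
        eapply Rle_trans; [apply Rabs_triang|].
        eapply Rle_trans; [apply Rplus_le_compat; [exact HB|exact HB']|].
        right. simpl. field. lra.
Qed.

Lemma is_RInt_gen_lim_seq {V : CompleteNormedModule R_AbsRing} (f : R -> V) (l : V) (u : nat -> V) :
  is_RInt_gen f (at_point 0) (Rbar_locally p_infty) l ->
  (forall D, is_RInt f 0 (INR D) (u D)) -> filterlim u eventually (locally l).
Proof.
  intros H Hu P HP.
  assert (H0 : filterlim (fun _ : nat => 0) eventually (at_point 0)).
  { intros Q HQ. exists O. intros; exact HQ. }
  destruct (filterlimi_comp_2 (fun _ : nat => 0) INR (fun a b => is_RInt f a b)
    H0 is_lim_seq_INR H P HP) as [N HN].
  exists N. intros n Hn.
  destruct (HN n Hn) as [y [Hy1 Hy2]].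
  rewrite <- (is_RInt_unique _ _ _ _ (Hu n)), (is_RInt_unique _ _ _ _ Hy1). exact Hy2.
Qed.

Lemma is_RInt_gen_zero {V : NormedModule R_AbsRing} Fa Fb {FFa : Filter Fa} {FFb : Filter Fb} :
  is_RInt_gen (fun _ => @zero V) Fa Fb zero.
Proof.
  apply filterlimi_lim_ext with (f := fun _ => zero).
  - intros [x y]; simpl. evar_last; [apply (is_RInt_const (V := V))|exact (scal_zero_r (V := NormedModule.ModuleSpace R_AbsRing V) (y - x))].
  - apply filterlim_const.
Qed.

Lemma is_RInt_gen_rsum (f : nat -> R -> R) (I : nat -> R) Fa Fb {FFa : Filter Fa} {FFb : Filter Fb} n :
  (forall j, (j < n)%nat -> is_RInt_gen (f j) Fa Fb (I j)) ->
  is_RInt_gen (fun t => rsum (fun j => f j t) n) Fa Fb (rsum I n).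
Proof.
  induction n as [|n IH]; intros H; simpl.
  - exact (is_RInt_gen_zero (V := R_NormedModule) Fa Fb).
  - apply (is_RInt_gen_plus (V := R_NormedModule)); [apply IH; intros; apply H; lia|apply H; lia].
Qed.

Lemma exp_C2_vanish (f : R -> R) K d : 0 < d ->
  (forall t, 0 <= t -> Rabs (f t) <= K * exp (- d * t)) ->
  is_lim_seq (fun D => f (INR D)) 0.
Proof.
  intros Hd HK. apply is_lim_seq_abs_0.
  assert (Hr : 0 < exp (- d) < 1) by (split; [apply exp_pos|rewrite <- exp_0; apply exp_increasing; lra]).
  apply is_lim_seq_le_le with (u := fun _ => 0) (w := fun D => K * exp (- d) ^ D).
  - intros D. split; [apply Rabs_pos|]. rewrite <- exp_mul_INR. apply HK, pos_INR.
  - apply is_lim_seq_const.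
  - replace (Finite 0) with (Rbar_mult K (Finite 0)) by (simpl; f_equal; ring).
    apply (is_lim_seq_scal_l (fun D => exp (- d) ^ D) K 0).
    apply is_lim_seq_geom. rewrite Rabs_pos_eq; lra.
Qed.

(** The [J]-th partial sum of the transforms is the integral of [f] against the Dirichlet kernel, so
    its distance from the limit is at most the uniform size of the Bernoulli remainder times a
    constant independent of [J]. Convergence over the frequencies is thereby a conclusion. *)
Lemma half_line_poisson (f f1 f2 : R -> R) (d : R) (I : nat -> R) (S0 : R) :
  exp_C2 d f f1 f2 -> 0 < d ->
  (forall j, is_RInt_gen (fun t => f t * cos (2 * PI * INR j * t)) (at_point 0) (Rbar_locally p_infty) (I j)) ->
  is_series (fun i => f (INR (S i))) S0 ->
  is_lim_seq (fun J => I O + 2 * rsum (fun j => I (S j)) J) (f 0 / 2 + S0).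
Proof.
  intros [H1 [H2 [H3 [K [HK0 HK]]]]] Hd HI HS.
  assert (Hr : 0 < exp (- d) < 1) by (split; [apply exp_pos|rewrite <- exp_0; apply exp_increasing; lra]).
  apply is_series_rsum in HS.
  assert (Hcore : forall J eps, 0 <= eps ->
    (forall t, 0 <= t <= 1 -> Rabs (bern2_rem J t - bern2_rem J 0) <= eps) ->
    Rabs (f 0 / 2 + S0 - (I O + 2 * rsum (fun j => I (S j)) J)) <= eps * (K / (1 - exp (- d)))).
  { intros J eps He Hb.
    assert (HIJ : is_RInt_gen (fun t => f t * dirichlet_kernel J t) (at_point 0) (Rbar_locally p_infty)
       (I O + 2 * rsum (fun j => I (S j)) J)).
    { pose proof (is_RInt_gen_rsum (fun j t => f t * cos (2 * PI * INR (S j) * t)) (fun j => I (S j))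
        (at_point 0) (Rbar_locally p_infty) J (fun j _ => HI (S j))) as HA.
      pose proof (is_RInt_gen_plus _ _ _ _ (HI O) (is_RInt_gen_scal _ 2 _ HA)) as HB.
      eapply is_RInt_gen_ext; [|exact HB].
      apply filter_forall. intros ab x _.
      change (f x * cos (2 * PI * INR 0 * x) + 2 * rsum (fun j => f x * cos (2 * PI * INR (S j) * x)) J
        = f x * dirichlet_kernel J x).
      simpl (INR 0). rewrite Rmult_0_r, Rmult_0_l, cos_0, rsum_scal. unfold dirichlet_kernel. ring. }
    set (u := fun D => proj1_sig (constructive_indefinite_description _
      (poisson_finite f f1 f2 J eps K d H1 H2 H3 Hd Hb He HK0 (fun t Ht => proj2 (proj2 (HK t Ht))) D))).
    assert (Hu : forall D, is_RInt (fun t => f t * dirichlet_kernel J t) 0 (INR D) (u D) /\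
      Rabs (f 0 / 2 + rsum (fun i => f (INR (S i))) D - f (INR D) / 2 - u D) <=
      eps * (K * ((1 - exp (- d) ^ D) / (1 - exp (- d))))).
    { intros D. unfold u. apply proj2_sig. }
    assert (Hlim := is_RInt_gen_lim_seq _ _ u HIJ (fun D => proj1 (Hu D))).
    change (is_lim_seq u (I O + 2 * rsum (fun j => I (S j)) J)) in Hlim.
    assert (Hf : is_lim_seq (fun D => f (INR D) / 2) 0).
    { replace (Finite 0) with (Rbar_mult (Finite 0) (/ 2)) by (simpl; f_equal; ring).
      apply (is_lim_seq_scal_r (fun D => f (INR D))).
      apply (exp_C2_vanish f K d Hd). intros t Ht. apply HK, Ht. }
    assert (HL : is_lim_seq (fun D => Rabs (f 0 / 2 + rsum (fun i => f (INR (S i))) D - f (INR D) / 2 - u D))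
       (Rabs (f 0 / 2 + S0 - 0 - (I O + 2 * rsum (fun j => I (S j)) J)))).
    { apply (is_lim_seq_abs _ (Finite _)). apply is_lim_seq_minus'; [|exact Hlim].
      apply is_lim_seq_minus'; [|exact Hf].
      apply is_lim_seq_plus'; [apply is_lim_seq_const|exact HS]. }
    rewrite Rminus_0_r in HL.
    refine (is_lim_seq_le _ (fun _ => eps * (K / (1 - exp (- d)))) (Finite _) (Finite _) _ HL (is_lim_seq_const _)).
    intros D. eapply Rle_trans; [apply Hu|].
    apply Rmult_le_compat_l; [exact He|]. apply Rmult_le_compat_l; [exact HK0|].
    unfold Rdiv. rewrite <- (Rmult_1_l (/ (1 - exp (- d)))) at 2. apply Rmult_le_compat_r.
    - left; apply Rinv_0_lt_compat; lra.
    - pose proof (pow_le (exp (- d)) D ltac:(lra)); lra. }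
  apply is_lim_seq_spec. intros eps.
  (* The added 1 makes [B] positive even if [K = 0] and the final inequality strict. *)
  set (B := K / (1 - exp (- d)) + 1).
  assert (HB0 : 0 <= K / (1 - exp (- d))) by (apply Rdiv_le_0_compat; lra).
  assert (HB : 0 < B) by (unfold B; lra).
  assert (He : 0 < eps / B) by (apply Rdiv_lt_0_compat; [apply cond_pos|exact HB]).
  destruct (bern2_rem_unif_lim (eps / B) He) as [N HN].
  exists N. intros J HJ. rewrite Rabs_minus_sym.
  eapply Rle_lt_trans; [apply (Hcore J (eps / B)); [lra|apply HN; exact HJ]|].
  replace (pos eps) with (eps / B * B) at 2 by (field; lra).
  apply Rmult_lt_compat_l; [exact He|]. unfold B; lra.
Qed.

(** * Functions with exponentially controlled derivatives *)

Definition ex_exp_C2 (d : R) (f : R -> R) : Prop := exists f1 f2, exp_C2 d f f1 f2.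

Lemma ex_exp_C2_ext d f g : (forall t, f t = g t) -> ex_exp_C2 d f -> ex_exp_C2 d g.
Proof.
  intros E [f1 [f2 [H1 [H2 [H3 [K [HK0 HK]]]]]]]. exists f1, f2. split; [|split; [|split]]; auto.
  - intros t. eapply is_derive_ext; [exact E|apply H1].
  - exists K. split; [exact HK0|]. intros t Ht. rewrite <- E. apply HK, Ht.
Qed.

Lemma ex_exp_C2_weaken d d' f : d' <= d -> ex_exp_C2 d f -> ex_exp_C2 d' f.
Proof.
  intros Hd [f1 [f2 [H1 [H2 [H3 [K [HK0 HK]]]]]]]. exists f1, f2. split; [|split; [|split]]; auto.
  exists K. split; [exact HK0|]. intros t Ht.
  assert (E : K * exp (- d * t) <= K * exp (- d' * t)).
  { apply Rmult_le_compat_l; [exact HK0|].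
    destruct (Rle_lt_or_eq_dec (- d * t) (- d' * t)) as [h|h]; [nra|left; apply exp_increasing; exact h|rewrite h; lra]. }
  destruct (HK t Ht) as [A [B C]]. repeat split; lra.
Qed.

Lemma ex_exp_C2_const c : ex_exp_C2 0 (fun _ => c).
Proof.
  exists (fun _ => 0), (fun _ => 0). split; [|split; [|split]].
  - intros; apply @is_derive_const.
  - intros; apply @is_derive_const.
  - intros; apply continuous_const.
  - exists (Rabs c). split; [apply Rabs_pos|]. intros t _.
    replace (- 0 * t) with 0 by ring. rewrite exp_0, Rabs_R0.
    pose proof (Rabs_pos c). repeat split; lra.
Qed.

Lemma ex_exp_C2_exp a : ex_exp_C2 a (fun t => exp (- a * t)).
Proof.
  exists (fun t => - a * exp (- a * t)), (fun t => a ^ 2 * exp (- a * t)). split; [|split; [|split]].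
  - intros t; auto_derive; [trivial|ring].
  - intros t; auto_derive; [trivial|ring].
  - intros t. apply @ex_derive_continuous. auto_derive. trivial.
  - exists (1 + Rabs a + a ^ 2). pose proof (Rabs_pos a). pose proof (pow2_ge_0 a).
    split; [lra|]. intros t _.
    pose proof (exp_pos (- a * t)). rewrite !Rabs_mult, Rabs_Ropp, (Rabs_pos_eq (exp _)), (Rabs_pos_eq (a ^ 2)) by lra.
    repeat split; nra.
Qed.

Lemma Rabs_sin_le x : Rabs (sin x) <= 1.
Proof. apply Rabs_le; pose proof (SIN_bound x); lra. Qed.

Lemma Rabs_cos_le x : Rabs (cos x) <= 1.
Proof. apply Rabs_le; pose proof (COS_bound x); lra. Qed.

Lemma ex_exp_C2_sin w : ex_exp_C2 0 (fun t => sin (w * t)).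
Proof.
  exists (fun t => w * cos (w * t)), (fun t => - w ^ 2 * sin (w * t)). split; [|split; [|split]].
  - intros t; auto_derive; [trivial|ring].
  - intros t; auto_derive; [trivial|ring].
  - intros t. apply @ex_derive_continuous. auto_derive. trivial.
  - exists (1 + Rabs w + w ^ 2). pose proof (Rabs_pos w). pose proof (pow2_ge_0 w).
    split; [lra|]. intros t _. replace (- 0 * t) with 0 by ring. rewrite exp_0.
    rewrite !Rabs_mult, Rabs_Ropp, (Rabs_pos_eq (w ^ 2)) by lra.
    pose proof (Rabs_sin_le (w * t)). pose proof (Rabs_cos_le (w * t)).
    pose proof (Rabs_pos (sin (w * t))). pose proof (Rabs_pos (cos (w * t))).
    repeat split; nra.
Qed.

Lemma ex_exp_C2_cos w : ex_exp_C2 0 (fun t => cos (w * t)).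
Proof.
  exists (fun t => - w * sin (w * t)), (fun t => - w ^ 2 * cos (w * t)). split; [|split; [|split]].
  - intros t; auto_derive; [trivial|ring].
  - intros t; auto_derive; [trivial|ring].
  - intros t. apply @ex_derive_continuous. auto_derive. trivial.
  - exists (1 + Rabs w + w ^ 2). pose proof (Rabs_pos w). pose proof (pow2_ge_0 w).
    split; [lra|]. intros t _. replace (- 0 * t) with 0 by ring. rewrite exp_0.
    rewrite !Rabs_mult, !Rabs_Ropp, (Rabs_pos_eq (w ^ 2)) by lra.
    pose proof (Rabs_sin_le (w * t)). pose proof (Rabs_cos_le (w * t)).
    pose proof (Rabs_pos (sin (w * t))). pose proof (Rabs_pos (cos (w * t))).
    repeat split; nra.
Qed.

(** A factor [t] costs an arbitrarily small part of the exponential rate, since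
    [e * t <= exp (e * t)]. *)
Lemma ex_exp_C2_id e : 0 < e -> ex_exp_C2 (- e) (fun t => t).
Proof.
  intros He. exists (fun _ => 1), (fun _ => 0). split; [|split; [|split]].
  - intros; apply @is_derive_id.
  - intros; apply @is_derive_const.
  - intros; apply continuous_const.
  - assert (0 < / e) by (apply Rinv_0_lt_compat; lra).
    exists (/ e + 1). split; [lra|]. intros t Ht.
    replace (- - e * t) with (e * t) by ring.
    assert (1 + e * t <= exp (e * t)).
    { destruct (Req_dec (e * t) 0) as [E|E]; [rewrite E, exp_0; lra|left; apply exp_ineq1; exact E]. }
    assert (0 <= e * t) by (apply Rmult_le_pos; lra).
    rewrite Rabs_R0, Rabs_R1, (Rabs_pos_eq t) by lra. repeat split; try nra.
    replace t with (/ e * (e * t)) at 1 by (field; lra). nra.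
Qed.

Lemma ex_exp_C2_plus d f g : ex_exp_C2 d f -> ex_exp_C2 d g -> ex_exp_C2 d (fun t => f t + g t).
Proof.
  intros [f1 [f2 [H1 [H2 [H3 [K [HK0 HK]]]]]]] [g1 [g2 [G1 [G2 [G3 [L [HL0 HL]]]]]]].
  exists (fun t => f1 t + g1 t), (fun t => f2 t + g2 t). split; [|split; [|split]].
  - intros t. apply (is_derive_plus f g); auto.
  - intros t. apply (is_derive_plus f1 g1); auto.
  - intros t. apply (continuous_plus f2 g2); auto.
  - exists (K + L). split; [lra|]. intros t Ht.
    destruct (HK t Ht) as [A [B C]]. destruct (HL t Ht) as [A' [B' C']].
    rewrite Rmult_plus_distr_r.
    repeat split; (eapply Rle_trans; [apply Rabs_triang|lra]).
Qed.

Lemma ex_exp_C2_mult d e f g : ex_exp_C2 d f -> ex_exp_C2 e g -> ex_exp_C2 (d + e) (fun t => f t * g t).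
Proof.
  intros [f1 [f2 [H1 [H2 [H3 [K [HK0 HK]]]]]]] [g1 [g2 [G1 [G2 [G3 [L [HL0 HL]]]]]]].
  exists (fun t => f1 t * g t + f t * g1 t), (fun t => (f2 t * g t + f1 t * g1 t) + (f1 t * g1 t + f t * g2 t)).
  assert (Hm : forall (a a1 b b1 : R -> R) t, is_derive a t (a1 t) -> is_derive b t (b1 t) ->
     is_derive (fun t => a t * b t) t (a1 t * b t + a t * b1 t)).
  { intros a a1 b b1 t Ha Hb. apply (is_derive_mult a b t _ _ Ha Hb Rmult_comm). }
  split; [|split; [|split]].
  - intros t. apply Hm; auto.
  - intros t. apply (is_derive_plus (fun t => f1 t * g t) (fun t => f t * g1 t)); apply Hm; auto.
  - intros t.
    assert (continuous f t) by (apply (continuous_of_derive f f1), H1).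
    assert (continuous f1 t) by (apply (continuous_of_derive f1 f2), H2).
    assert (continuous g t) by (apply (continuous_of_derive g g1), G1).
    assert (continuous g1 t) by (apply (continuous_of_derive g1 g2), G2).
    apply (continuous_plus (fun t => f2 t * g t + f1 t * g1 t) (fun t => f1 t * g1 t + f t * g2 t)).
    + apply (continuous_plus (fun t => f2 t * g t) (fun t => f1 t * g1 t)); [apply (continuous_mult f2 g)|apply (continuous_mult f1 g1)]; auto.
    + apply (continuous_plus (fun t => f1 t * g1 t) (fun t => f t * g2 t)); [apply (continuous_mult f1 g1)|apply (continuous_mult f g2)]; auto.
  - exists (4 * (K * L)). split; [nra|]. intros t Ht.
    destruct (HK t Ht) as [A [B C]]. destruct (HL t Ht) as [A' [B' C']].
    replace (- (d + e) * t) with (- d * t + - e * t) by ring. rewrite exp_plus.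
    set (X := exp (- d * t)) in *. set (Y := exp (- e * t)) in *.
    assert (HX : 0 < X) by apply exp_pos. assert (HY : 0 < Y) by apply exp_pos.
    assert (Hp : forall a b, Rabs a <= K * X -> Rabs b <= L * Y -> Rabs (a * b) <= K * L * (X * Y)).
    { intros a b Ha Hb. rewrite Rabs_mult. replace (K * L * (X * Y)) with ((K * X) * (L * Y)) by ring.
      apply Rmult_le_compat; auto; apply Rabs_pos. }
    assert (0 <= K * L * (X * Y)) by (apply Rmult_le_pos; nra).
    pose proof (Hp _ _ A A'). pose proof (Hp _ _ A B'). pose proof (Hp _ _ A C').
    pose proof (Hp _ _ B A'). pose proof (Hp _ _ B B'). pose proof (Hp _ _ C A').
    repeat split.
    + lra.
    + eapply Rle_trans; [apply Rabs_triang|lra].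
    + eapply Rle_trans; [apply Rabs_triang|].
      eapply Rle_trans; [apply Rplus_le_compat; apply Rabs_triang|lra].
Qed.

Lemma ex_exp_C2_pow e k : 0 < e -> ex_exp_C2 (- e) (fun t => t ^ k).
Proof.
  revert e. induction k as [|k IH]; intros e He.
  - simpl. apply ex_exp_C2_weaken with 0; [lra|]. apply ex_exp_C2_const.
  (* Half of the allowance [e] pays for one factor [t], the other half for the remaining power. *)
  - simpl. replace (- e) with (- (e / 2) + - (e / 2)) by field.
    apply (ex_exp_C2_mult _ _ (fun t => t) (fun t => t ^ k)).
    + apply ex_exp_C2_id; lra.
    + apply IH; lra.
Qed.

(** Meant for the denominators [1 + z + ... + z ^ (q - 1)] of the geometric quotients, which never
    fall below 1. *)
Lemma ex_exp_C2_inv f : (forall t, 1 <= f t) -> ex_exp_C2 0 f -> ex_exp_C2 0 (fun t => / f t).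
Proof.
  intros Hf [f1 [f2 [H1 [H2 [H3 [K [HK0 HK]]]]]]].
  assert (Hi : forall t, 0 < / f t <= 1).
  { intros t. specialize (Hf t). split; [apply Rinv_0_lt_compat; lra|]. rewrite <- Rinv_1. apply Rinv_le_contravar; lra. }
  exists (fun t => - f1 t * (/ f t) ^ 2), (fun t => - f2 t * (/ f t) ^ 2 + 2 * f1 t ^ 2 * (/ f t) ^ 3).
  assert (Hd : forall t, is_derive (fun t => / f t) t (- f1 t * (/ f t) ^ 2)).
  { intros t. specialize (Hf t). evar_last; [apply (is_derive_inv f t (f1 t)); [apply H1|lra]|]. field. lra. }
  split; [|split; [|split]].
  - exact Hd.
  - intros t. specialize (Hf t).
    assert (E1 : Derive f1 t = f2 t) by (apply is_derive_unique, H2).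
    auto_derive.
    + split; [eexists; apply H2|]. split; [eexists; apply H1|split; [lra|trivial]].
      change (Derive (fun x : R => f1 x) t) with (Derive f1 t). change (Derive (fun x : R => f x) t) with (Derive f t).
      rewrite (is_derive_unique _ _ _ (H1 t)), E1. field. lra.
  - intros t.
    assert (continuous f1 t) by (apply (continuous_of_derive f1 f2), H2).
    assert (Hci : continuous (fun t => / f t) t) by (apply @ex_derive_continuous; eexists; apply Hd).
    apply (continuous_ext (fun t => (- f2 t) * (/ f t * / f t) + (2 * (f1 t * f1 t)) * (/ f t * (/ f t * / f t)))).
    { intros y. match goal with |- ?a = ?b => change (@eq R a b) end. ring. }
    apply (continuous_plus (fun t => (- f2 t) * (/ f t * / f t)) (fun t => (2 * (f1 t * f1 t)) * (/ f t * (/ f t * / f t)))).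
    + apply (continuous_mult (fun t => - f2 t)); [apply (continuous_opp f2); auto|].
      apply (continuous_mult (fun t => / f t)); auto.
    + apply (continuous_mult (fun t => 2 * (f1 t * f1 t))).
      * apply (continuous_mult (fun _ => 2)); [apply continuous_const|]. apply (continuous_mult f1); auto.
      * apply (continuous_mult (fun t => / f t)); auto. apply (continuous_mult (fun t => / f t)); auto.
  - exists (1 + K + 2 * K ^ 2). split; [nra|]. intros t Ht.
    destruct (HK t Ht) as [A [B C]]. specialize (Hi t).
    replace (- 0 * t) with 0 in * by ring. rewrite exp_0, Rmult_1_r in *.
    set (g := / f t) in *.
    assert (0 <= g ^ 2 <= 1) by nra. assert (0 <= g ^ 3 <= 1) by (simpl; nra).
    assert (Rabs (- f1 t * g ^ 2) <= K).
    { rewrite Rabs_mult, Rabs_Ropp, (Rabs_pos_eq (g ^ 2)) by lra. pose proof (Rabs_pos (f1 t)); nra. }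
    assert (Rabs (- f2 t * g ^ 2) <= K).
    { rewrite Rabs_mult, Rabs_Ropp, (Rabs_pos_eq (g ^ 2)) by lra. pose proof (Rabs_pos (f2 t)); nra. }
    assert (Rabs (2 * f1 t ^ 2 * g ^ 3) <= 2 * K ^ 2).
    { rewrite Rabs_mult, (Rabs_pos_eq (g ^ 3)) by lra.
      rewrite Rabs_mult, (Rabs_pos_eq 2), <- RPow_abs by lra.
      assert (Rabs (f1 t) ^ 2 <= K ^ 2) by (apply pow_incr; split; [apply Rabs_pos|exact B]).
      pose proof (pow2_ge_0 (Rabs (f1 t))). nra. }
    assert (0 <= K ^ 2) by nra.
    repeat split.
    + rewrite Rabs_pos_eq; lra.
    + lra.
    + eapply Rle_trans; [apply Rabs_triang|lra].
Qed.

Lemma ex_exp_C2_rsum d (f : nat -> R -> R) n :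
  (forall i, (i < n)%nat -> ex_exp_C2 d (f i)) -> ex_exp_C2 d (fun t => rsum (fun i => f i t) n).
Proof.
  intros H. induction n as [|n IH]; simpl.
  - exists (fun _ => 0), (fun _ => 0). split; [|split; [|split]].
    + intros; apply @is_derive_const.
    + intros; apply @is_derive_const.
    + intros; apply continuous_const.
    + exists 0. split; [lra|]. intros t _. rewrite Rabs_R0, Rmult_0_l. repeat split; lra.
  - apply ex_exp_C2_plus; [apply IH; intros; apply H; lia|apply H; lia].
Qed.

Lemma ex_exp_C2_continuous d f t : ex_exp_C2 d f -> continuous f t.
Proof. intros [f1 [f2 [H1 _]]]. apply (continuous_of_derive f f1), H1. Qed.

Lemma ex_exp_C2_bound d f : ex_exp_C2 d f -> exists K, 0 <= K /\ forall t, 0 <= t -> Rabs (f t) <= K * exp (- d * t).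
Proof.
  intros [f1 [f2 [H1 [H2 [H3 [K [HK0 HK]]]]]]]. exists K; split; [exact HK0|]. intros t Ht. apply HK, Ht.
Qed.

Lemma filterlim_exp_decay (f : R -> R) K d : 0 < d ->
  (forall t, 0 <= t -> Rabs (f t) <= K * exp (- d * t)) ->
  filterlim f (Rbar_locally p_infty) (locally 0).
Proof.
  intros Hd HK.
  assert (HE : filterlim (fun t => K * exp (- d * t)) (Rbar_locally p_infty) (locally 0)).
  { replace 0 with (K * 0) by ring. apply (is_lim_scal_l (fun t => exp (- d * t)) K p_infty 0).
    apply is_lim_comp with m_infty.
    - apply is_lim_exp_m.
    - evar_last; [apply (is_lim_scal_l (fun t => t) (- d) p_infty p_infty); apply is_lim_id|].
      simpl. destruct (Rle_dec 0 (- d)); [exfalso; lra|]. reflexivity.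
    - exists 0. intros; discriminate. }
  assert (H0 : forall e : posreal, Rbar_locally p_infty (fun t => Rabs (f t) < e)).
  { intros e. destruct (proj1 (filterlim_locally _ _) HE e) as [M HM].
    exists (Rmax M 0). intros t Ht. pose proof (Rmax_l M 0). pose proof (Rmax_r M 0).
    eapply Rle_lt_trans; [apply HK; lra|].
    specialize (HM t ltac:(lra)). unfold ball in HM; simpl in HM; unfold AbsRing_ball, abs, minus, plus, opp in HM; simpl in HM.
    eapply Rle_lt_trans; [apply Rle_abs|]. replace (K * exp (- d * t)) with (K * exp (- d * t) + - 0) by ring. exact HM. }
  apply filterlim_locally. intros e. destruct (H0 e) as [M HM]. exists M. intros t Ht.
  unfold ball; simpl; unfold AbsRing_ball, abs, minus, plus, opp; simpl.
  replace (f t + - 0) with (f t) by ring. apply HM, Ht.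
Qed.

(** * Improper integrals *)

Lemma norm_minus_cancel_mid {V : NormedModule R_AbsRing} (x y z : V) :
  norm (minus (plus x (plus y z)) y) <= norm x + norm z.
Proof.
  replace (minus (plus x (plus y z)) y) with (plus x z); [apply norm_triangle|].
  unfold minus. rewrite <- plus_assoc, (plus_comm y z), <- (plus_assoc z). f_equal.
  etransitivity; [symmetry; apply @plus_zero_r|]. f_equal. symmetry. apply @plus_opp_r.
Qed.

(** A Cauchy criterion with a potential: increments of [phi] dominate the integrals over bounded
    pieces, and [phi] has limits at both ends. Keeping the two filters abstract serves integrals
    starting at the point 0 as well as those starting to the right of 0. *)
Lemma ex_RInt_gen_cauchy {V : CompleteNormedModule R_AbsRing} (f : R -> V) (P : R -> Prop) (phi : R -> R)
  Fa Fb {FFa : ProperFilter Fa} {FFb : ProperFilter Fb} (la lb : R) :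
  Fa P -> Fb P ->
  (forall a b, P a -> P b -> exists l, is_RInt f a b l /\ norm l <= Rabs (phi b - phi a)) ->
  filterlim phi Fa (locally la) -> filterlim phi Fb (locally lb) ->
  ex_RInt_gen f Fa Fb.
Proof.
  intros HPa HPb Hf Hla Hlb.
  apply (proj1 (filterlimi_locally_cauchy (F := filter_prod Fa Fb) (fun ab : R * R => is_RInt f (fst ab) (snd ab))
    (Filter_prod _ _ _ P P HPa HPb (fun a b Ha Hb =>
       conj (match Hf a b Ha Hb with ex_intro l H => ex_intro _ l (proj1 H) end)
         (fun y1 y2 h1 h2 => eq_trans (eq_sym (is_RInt_unique _ _ _ _ h1)) (is_RInt_unique _ _ _ _ h2)))))).
  intros eps.
  assert (He : 0 < eps / 4) by (pose proof (cond_pos eps); lra).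
  pose proof (proj1 (filterlim_locally _ _) Hla (mkposreal _ He)) as Ua.
  pose proof (proj1 (filterlim_locally _ _) Hlb (mkposreal _ He)) as Ub.
  exists (fun ab => (P (fst ab) /\ ball la (mkposreal _ He) (phi (fst ab))) /\ (P (snd ab) /\ ball lb (mkposreal _ He) (phi (snd ab)))).
  split.
  - apply (Filter_prod _ _ _ (fun a => P a /\ ball la (mkposreal _ He) (phi a)) (fun b => P b /\ ball lb (mkposreal _ He) (phi b))).
    + apply filter_and; auto.
    + apply filter_and; auto.
    + intros; simpl; auto.
  - intros [a b] [a' b'] [[Pa Ba] [Pb Bb]] [[Pa' Ba'] [Pb' Bb']] l l' Hl Hl'. simpl in *.
    assert (Hbb : forall x y z : R, ball x (eps / 4) y -> ball x (eps / 4) z -> Rabs (y - z) < eps / 2).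
    { intros x y z Hy Hz. unfold ball in Hy, Hz; simpl in Hy, Hz; unfold AbsRing_ball, abs, minus, plus, opp in Hy, Hz; simpl in Hy, Hz.
      replace (y - z) with ((y + - x) - (z + - x)) by ring.
      eapply Rle_lt_trans; [apply Rabs_triang|]. rewrite Rabs_Ropp. lra. }
    destruct (Hf a' a Pa' Pa) as [m1 [Hm1 Nm1]].
    destruct (Hf b b' Pb Pb') as [m2 [Hm2 Nm2]].
    pose proof (is_RInt_Chasles _ _ _ _ _ _ Hm1 (is_RInt_Chasles _ _ _ _ _ _ Hl Hm2)) as Hl2.
    assert (E : l' = plus m1 (plus l m2)).
    { rewrite <- (is_RInt_unique _ _ _ _ Hl'). apply is_RInt_unique. exact Hl2. }
    apply (norm_compat1 (V := V)). rewrite E.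
    eapply Rle_lt_trans; [apply (norm_minus_cancel_mid (V := V))|].
    pose proof (Hbb _ _ _ Ba Ba'). pose proof (Hbb _ _ _ Bb' Bb).
    eapply Rle_lt_trans; [apply Rplus_le_compat; [exact Nm1|exact Nm2]|]. lra.
Qed.

Lemma ex_RInt_gen_exp (f : R -> R) K d : 0 < d -> 0 <= K ->
  (forall t, 0 <= t -> continuous f t) -> (forall t, 0 <= t -> Rabs (f t) <= K * exp (- d * t)) ->
  ex_RInt_gen f (at_point 0) (Rbar_locally p_infty).
Proof.
  intros Hd HK0 Hc HK.
  (* The primitive of the majorant [K * exp (- d * t)] that vanishes at infinity. *)
  set (phi := fun t => - (K / d * exp (- d * t))).
  assert (Hle : forall a b, 0 <= a -> a <= b -> exists l, is_RInt f a b l /\ Rabs l <= Rabs (phi b - phi a)).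
  { intros a b Ha Hab.
    destruct (ex_RInt_continuous (V := R_CompleteNormedModule) f a b) as [l Hl].
    { intros z Hz. rewrite Rmin_left, Rmax_right in Hz by lra. apply Hc; lra. }
    exists l. split; [exact Hl|].
    assert (Hg : is_RInt (fun t => K * exp (- d * t)) a b (phi b - phi a)).
    { apply (is_RInt_derive phi (fun t => K * exp (- d * t))).
      - intros t _. unfold phi. auto_derive; [trivial|field; lra].
      - intros t _. apply @ex_derive_continuous. auto_derive. trivial. }
    eapply Rle_trans; [|apply Rle_abs].
    apply (norm_RInt_le f (fun t => K * exp (- d * t)) a b l); auto.
    intros t Ht. apply HK. lra. }
  apply (ex_RInt_gen_cauchy (V := R_CompleteNormedModule) f (fun t => 0 <= t) phi (at_point 0) (Rbar_locally p_infty) (phi 0) 0).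
  - unfold at_point; lra.
  - exists 0. intros; lra.
  - intros a b Ha Hb. destruct (Rle_dec a b) as [h|h]; [apply Hle; auto|].
    destruct (Hle b a Hb ltac:(lra)) as [l [Hl HN]].
    exists (opp l). split; [apply is_RInt_swap; exact Hl|].
    change (Rabs (- l) <= Rabs (phi b - phi a)). rewrite Rabs_Ropp, Rabs_minus_sym. exact HN.
  - intros Q HQ. unfold filtermap, at_point. apply locally_singleton. exact HQ.
  - apply (filterlim_exp_decay phi (K / d) d Hd). intros t _.
    assert (0 <= K / d) by (apply Rdiv_le_0_compat; lra). pose proof (exp_pos (- d * t)).
    unfold phi. rewrite Rabs_Ropp, Rabs_pos_eq; [lra|]. nra.
Qed.

Lemma ex_RInt_gen_exp_C2 f d : 0 < d -> ex_exp_C2 d f -> ex_RInt_gen f (at_point 0) (Rbar_locally p_infty).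
Proof.
  intros Hd Hf. destruct (ex_exp_C2_bound d f Hf) as [K [HK0 HK]].
  apply (ex_RInt_gen_exp f K d); auto. intros t _. apply (ex_exp_C2_continuous d), Hf.
Qed.

Lemma is_RInt_gen_derive_decay (F f : R -> R) d l : 0 < d ->
  ex_exp_C2 d F -> (forall t, is_derive F t (f t)) -> (forall t, continuous f t) ->
  l = - F 0 -> is_RInt_gen f (at_point 0) (Rbar_locally p_infty) l.
Proof.
  intros Hd HF HD Hc ->. destruct (ex_exp_C2_bound d F HF) as [K [HK0 HK]].
  pose proof (filterlim_exp_decay F K d Hd HK) as HL.
  apply (filterlimi_lim_ext (fun ab : R * R => F (snd ab) - F (fst ab))).
  - intros [a b]; simpl. apply (is_RInt_derive F f); auto.
  - replace (- F 0) with (0 - F 0) by ring.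
    apply (filterlim_comp_2 (fun ab : R * R => F (snd ab)) (fun ab : R * R => - F (fst ab)) Rplus (G := locally 0) (H := locally (- F 0))).
    + intros Q HQ. apply (filterlim_comp _ _ _ snd F _ _ _ filterlim_snd HL). exact HQ.
    + intros Q HQ. apply (Filter_prod _ _ _ (fun a => a = 0) (fun _ => True)); [reflexivity|apply filter_true|].
      intros a b -> _. simpl. apply locally_singleton. exact HQ.
    + apply (filterlim_plus 0 (- F 0)).
Qed.

(** * Laplace transforms of powers *)

(* Real and imaginary part of [k! / (y - i w) ^ (k + 1)]. *)
Fixpoint laplace (k : nat) (y w : R) : R * R :=
  match k with
  | O => (y / (y ^ 2 + w ^ 2), w / (y ^ 2 + w ^ 2))
  | S k' => let (a, b) := laplace k' y w in
      (INR k * (y * a - w * b) / (y ^ 2 + w ^ 2), INR k * (y * b + w * a) / (y ^ 2 + w ^ 2))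
  end.

Lemma sum_sqr_pos y w : 0 < y -> 0 < y ^ 2 + w ^ 2.
Proof. intros; pose proof (pow2_ge_0 w); nra. Qed.

Lemma ex_exp_C2_pow_exp k y : 0 < y -> ex_exp_C2 (y / 2) (fun t => t ^ k * exp (- y * t)).
Proof.
  intros Hy. replace (y / 2) with (- (y / 2) + y) by field.
  apply ex_exp_C2_mult; [apply ex_exp_C2_pow; lra|apply ex_exp_C2_exp].
Qed.

Lemma ex_exp_C2_pow_exp_cos k y w : 0 < y -> ex_exp_C2 (y / 2) (fun t => t ^ k * exp (- y * t) * cos (w * t)).
Proof.
  intros Hy. replace (y / 2) with (y / 2 + 0) by ring.
  apply ex_exp_C2_mult; [apply ex_exp_C2_pow_exp, Hy|apply ex_exp_C2_cos].
Qed.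

Lemma ex_exp_C2_pow_exp_sin k y w : 0 < y -> ex_exp_C2 (y / 2) (fun t => t ^ k * exp (- y * t) * sin (w * t)).
Proof.
  intros Hy. replace (y / 2) with (y / 2 + 0) by ring.
  apply ex_exp_C2_mult; [apply ex_exp_C2_pow_exp, Hy|apply ex_exp_C2_sin].
Qed.

Lemma is_RInt_gen_lin (f g h : R -> R) (a b lf lg lh : R) Fa Fb {FFa : Filter Fa} {FFb : Filter Fb} :
  (forall t, h t = a * f t + b * g t) -> lh = a * lf + b * lg ->
  is_RInt_gen f Fa Fb lf -> is_RInt_gen g Fa Fb lg -> is_RInt_gen h Fa Fb lh.
Proof.
  intros E -> Hf Hg.
  eapply is_RInt_gen_ext; [|exact (is_RInt_gen_plus _ _ _ _ (is_RInt_gen_scal _ a _ Hf) (is_RInt_gen_scal _ b _ Hg))].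
  apply filter_forall. intros ab x _. rewrite E. reflexivity.
Qed.

(** The derivatives of [t ^ k * exp (- y t) * cos (w t)] and of its sine companion integrate to
    minus their primitives' values at 0. This gives two linear equations for the two transforms,
    with those for [k - 1] on the right when [k > 0]; the determinant is [y ^ 2 + w ^ 2]. *)
Lemma is_RInt_gen_laplace k y w : 0 < y ->
  is_RInt_gen (fun t => t ^ k * exp (- y * t) * cos (w * t)) (at_point 0) (Rbar_locally p_infty) (fst (laplace k y w)) /\
  is_RInt_gen (fun t => t ^ k * exp (- y * t) * sin (w * t)) (at_point 0) (Rbar_locally p_infty) (snd (laplace k y w)).
Proof.
  intros Hy. pose proof (sum_sqr_pos y w Hy) as Hn.
  induction k as [|k [IHc IHs]].
  - pose proof (ex_exp_C2_pow_exp_cos 0 y w Hy) as Ec.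
    pose proof (ex_exp_C2_pow_exp_sin 0 y w Hy) as Es.
    assert (Hc : is_RInt_gen (fun t => - y * (t ^ 0 * exp (- y * t) * cos (w * t)) + - w * (t ^ 0 * exp (- y * t) * sin (w * t)))
       (at_point 0) (Rbar_locally p_infty) (- 1)).
    { apply (is_RInt_gen_derive_decay (fun t => t ^ 0 * exp (- y * t) * cos (w * t)) _ (y / 2)); [lra|exact Ec| | |].
      - intros t. simpl. auto_derive; [trivial|ring].
      - intros t. apply @ex_derive_continuous. simpl. auto_derive. trivial.
      - simpl. rewrite !Rmult_0_r, exp_0, cos_0. ring. }
    assert (Hs : is_RInt_gen (fun t => - y * (t ^ 0 * exp (- y * t) * sin (w * t)) + w * (t ^ 0 * exp (- y * t) * cos (w * t)))
       (at_point 0) (Rbar_locally p_infty) 0).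
    { apply (is_RInt_gen_derive_decay (fun t => t ^ 0 * exp (- y * t) * sin (w * t)) _ (y / 2)); [lra|exact Es| | |].
      - intros t. simpl. auto_derive; [trivial|ring].
      - intros t. apply @ex_derive_continuous. simpl. auto_derive. trivial.
      - simpl. rewrite !Rmult_0_r, sin_0. ring. }
    split.
    + refine (is_RInt_gen_lin _ _ _ (- y / (y ^ 2 + w ^ 2)) (w / (y ^ 2 + w ^ 2)) _ _ _ _ _ _ _ Hc Hs).
      * intros t. field. lra.
      * simpl. field. simpl in Hn; lra.
    + refine (is_RInt_gen_lin _ _ _ (- w / (y ^ 2 + w ^ 2)) (- y / (y ^ 2 + w ^ 2)) _ _ _ _ _ _ _ Hc Hs).
      * intros t. field. lra.
      * simpl. field. simpl in Hn; lra.
  - pose proof (ex_exp_C2_pow_exp_cos (S k) y w Hy) as Ec.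
    pose proof (ex_exp_C2_pow_exp_sin (S k) y w Hy) as Es.
    set (n := INR (S k)).
    assert (Hc : is_RInt_gen (fun t => n * (t ^ k * exp (- y * t) * cos (w * t)) + (- y * (t ^ S k * exp (- y * t) * cos (w * t)) + - w * (t ^ S k * exp (- y * t) * sin (w * t))))
       (at_point 0) (Rbar_locally p_infty) 0).
    { apply (is_RInt_gen_derive_decay (fun t => t ^ S k * exp (- y * t) * cos (w * t)) _ (y / 2)); [lra|exact Ec| | |].
      - intros t. auto_derive; [trivial|]. change (Nat.pred (S k)) with k. fold n.
        change (match k with O => 1 | S _ => INR k + 1 end) with (INR (S k)). fold n. simpl. ring.
      - intros t. apply @ex_derive_continuous. auto_derive. trivial.
      - simpl. ring. }
    assert (Hs : is_RInt_gen (fun t => n * (t ^ k * exp (- y * t) * sin (w * t)) + (- y * (t ^ S k * exp (- y * t) * sin (w * t)) + w * (t ^ S k * exp (- y * t) * cos (w * t))))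
       (at_point 0) (Rbar_locally p_infty) 0).
    { apply (is_RInt_gen_derive_decay (fun t => t ^ S k * exp (- y * t) * sin (w * t)) _ (y / 2)); [lra|exact Es| | |].
      - intros t. auto_derive; [trivial|]. change (Nat.pred (S k)) with k.
        change (match k with O => 1 | S _ => INR k + 1 end) with (INR (S k)). fold n. simpl. ring.
      - intros t. apply @ex_derive_continuous. auto_derive. trivial.
      - simpl. ring. }
    assert (Hc' : is_RInt_gen (fun t => y * (t ^ S k * exp (- y * t) * cos (w * t)) + w * (t ^ S k * exp (- y * t) * sin (w * t)))
      (at_point 0) (Rbar_locally p_infty) (n * fst (laplace k y w))).
    { refine (is_RInt_gen_lin _ _ _ n (-1) _ _ _ _ _ _ _ IHc Hc); [intros; ring|ring]. }
    assert (Hs' : is_RInt_gen (fun t => y * (t ^ S k * exp (- y * t) * sin (w * t)) - w * (t ^ S k * exp (- y * t) * cos (w * t)))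
      (at_point 0) (Rbar_locally p_infty) (n * snd (laplace k y w))).
    { refine (is_RInt_gen_lin _ _ _ n (-1) _ _ _ _ _ _ _ IHs Hs); [intros; ring|ring]. }
    cbn [laplace]. fold n. destruct (laplace k y w) as [a b]. cbn [fst snd] in *.
    split.
    + refine (is_RInt_gen_lin _ _ _ (y / (y ^ 2 + w ^ 2)) (- w / (y ^ 2 + w ^ 2)) _ _ _ _ _ _ _ Hc' Hs').
      * intros t. field. lra.
      * field. lra.
    + refine (is_RInt_gen_lin _ _ _ (w / (y ^ 2 + w ^ 2)) (y / (y ^ 2 + w ^ 2)) _ _ _ _ _ _ _ Hc' Hs').
      * intros t. field. lra.
      * field. lra.
Qed.

(* The case [k = 2 p] of [(w - i y) ^ (- k - 1) = i ^ (k + 1) * conj ((y - i w) ^ (- k - 1))]. *)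
Lemma laplace_swap p y w : 0 < y -> 0 < w ->
  laplace (2 * p) w y = ((-1) ^ p * snd (laplace (2 * p) y w), (-1) ^ p * fst (laplace (2 * p) y w)).
Proof.
  intros Hy Hw. pose proof (sum_sqr_pos y w Hy) as Hn.
  induction p as [|p IH].
  - simpl. f_equal; field; simpl in Hn; lra.
  - replace (2 * S p)%nat with (S (S (2 * p))) by lia. cbn [laplace]. rewrite IH.
    destruct (laplace (2 * p) y w) as [a b]. cbn [fst snd].
    set (n := INR (S (2 * p))). set (n' := INR (S (S (2 * p)))). cbn [pow].
    f_equal; field; simpl in Hn; lra.
Qed.

Lemma laplace_scal k l y w : 0 < l -> 0 < y ->
  laplace k (l * y) (l * w) = (fst (laplace k y w) / l ^ S k, snd (laplace k y w) / l ^ S k).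
Proof.
  intros Hl Hy. pose proof (sum_sqr_pos y w Hy) as Hn.
  assert (Hn' : l ^ 2 * y ^ 2 + l ^ 2 * w ^ 2 <> 0) by (assert (0 < l ^ 2) by (apply pow_lt; lra); nra).
  induction k as [|k IH].
  - simpl. f_equal; field; simpl in Hn, Hn'; lra.
  - cbn [laplace]. rewrite IH. destruct (laplace k y w) as [a b]. cbn [fst snd].
    set (n := INR (S k)). assert (0 < l ^ k) by (apply pow_lt; lra).
    cbn [pow]. f_equal; field; simpl in Hn, Hn'; lra.
Qed.

Lemma laplace_0 k y : 0 < y -> laplace k y 0 = (INR (fact k) / y ^ S k, 0).
Proof.
  intros Hy. induction k as [|k IH].
  - simpl. f_equal; field; lra.
  - cbn [laplace]. rewrite IH. rewrite fact_simpl, mult_INR.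
    assert (0 < y ^ k) by (apply pow_lt; lra). cbn [pow].
    f_equal; field; lra.
Qed.

(** * The periodic geometric quotients *)

(* Equals [(z ^ h - z ^ q) / (1 - z ^ q)], written so that it makes sense at [z = 1]. *)
Definition geom_quot (q h : nat) (z : R) : R :=
  rsum (fun i => z ^ (h + i)) (q - h) * / rsum (fun i => z ^ i) q.

Lemma rsum_geom z n : (1 - z) * rsum (fun i => z ^ i) n = 1 - z ^ n.
Proof. induction n; simpl; [ring|rewrite Rmult_plus_distr_l, IHn; ring]. Qed.

Lemma rsum_pow_ge_1 z q : (0 < q)%nat -> 0 <= z -> 1 <= rsum (fun i => z ^ i) q.
Proof.
  intros Hq Hz. induction q as [|q IH]; [lia|].
  destruct q as [|q]; [simpl; lra|]. simpl in *. specialize (IH ltac:(lia)).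
  pose proof (pow_le z q Hz). nra.
Qed.

Lemma rsum_split f n m : rsum f (n + m) = rsum f n + rsum (fun i => f (n + i)%nat) m.
Proof.
  induction m as [|m IH].
  - rewrite Nat.add_0_r; simpl; ring.
  - rewrite Nat.add_succ_r. simpl. rewrite IH. ring.
Qed.

Lemma rsum_nonneg f n : (forall i, 0 <= f i) -> 0 <= rsum f n.
Proof. intros H; induction n; simpl; [lra|]. specialize (H n); lra. Qed.

Lemma geom_quot_bound q h z : (0 < q)%nat -> (h <= q)%nat -> 0 <= z -> 0 <= geom_quot q h z <= 1.
Proof.
  intros Hq Hh Hz. unfold geom_quot. pose proof (rsum_pow_ge_1 z q Hq Hz) as H1.
  assert (E := rsum_split (fun i => z ^ i) h (q - h)). replace (h + (q - h))%nat with q in E by lia.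
  assert (0 <= rsum (fun i => z ^ i) h) by (apply rsum_nonneg; intros; apply pow_le, Hz).
  assert (0 <= rsum (fun i => z ^ (h + i)) (q - h)) by (apply rsum_nonneg; intros; apply pow_le, Hz).
  split.
  - apply Rmult_le_pos; [lra|]. left; apply Rinv_0_lt_compat; lra.
  - apply Rle_div_l; lra.
Qed.

Lemma geom_quot_eq q h z : (0 < q)%nat -> (h <= q)%nat -> 0 <= z ->
  (1 - z ^ q) * geom_quot q h z = z ^ h - z ^ q.
Proof.
  intros Hq Hh Hz. unfold geom_quot. pose proof (rsum_pow_ge_1 z q Hq Hz) as H1.
  rewrite <- (rsum_geom z q).
  assert (E : rsum (fun i => z ^ (h + i)) (q - h) = z ^ h * rsum (fun i => z ^ i) (q - h)).
  { rewrite <- rsum_scal. apply rsum_ext. intros; apply pow_add. }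
  rewrite E. transitivity (z ^ h * ((1 - z) * rsum (fun i => z ^ i) (q - h))); [field; lra|].
  rewrite rsum_geom, Rmult_minus_distr_l, <- pow_add. replace (h + (q - h))%nat with q by lia. ring.
Qed.

(** Each [z ^ (i q + h)] is paired with [z ^ (i q + q)], so that the sum stays bounded as [z] tends
    to 1. The subtracted terms do not depend on [h] and disappear once weighted by character values
    of sum zero. *)
Lemma geom_quot_expand q h z N : (0 < q)%nat -> (h <= q)%nat -> 0 <= z ->
  geom_quot q h z = rsum (fun i => z ^ (i * q + h) - z ^ (i * q + q)) N + z ^ (N * q) * geom_quot q h z.
Proof.
  intros Hq Hh Hz. induction N as [|N IH]; [simpl; ring|].
  cbn [rsum]. rewrite IH at 1. rewrite Rplus_assoc. f_equal.
  rewrite !pow_add. replace (S N * q)%nat with (N * q + q)%nat by lia. rewrite pow_add.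
  pose proof (geom_quot_eq q h z Hq Hh Hz) as E.
  replace (z ^ (N * q) * z ^ h - z ^ (N * q) * z ^ q) with (z ^ (N * q) * (z ^ h - z ^ q)) by ring.
  rewrite <- E. ring.
Qed.

Lemma geom_quot_1 q h : (0 < q)%nat -> (h <= q)%nat -> geom_quot q h 1 = 1 - INR h / INR q.
Proof.
  intros Hq Hh. unfold geom_quot.
  assert (E : forall n m, rsum (fun i => 1 ^ (m + i)) n = INR n).
  { induction n; intros m; [reflexivity|]. cbn [rsum]. rewrite IHn, pow1, S_INR. ring. }
  rewrite (E (q - h)%nat h). rewrite (rsum_ext _ (fun i => 1 ^ (0 + i))) by reflexivity. rewrite E.
  rewrite minus_INR by exact Hh. field. apply not_0_INR; lia.
Qed.

Lemma exp_pow_mul c n t : exp (- c * t) ^ n = exp (- (c * INR n) * t).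
Proof. rewrite <- exp_mul_INR. f_equal. ring. Qed.

Lemma ex_exp_C2_geom_quot q h c : (0 < q)%nat -> (1 <= h <= q)%nat -> 0 < c ->
  ex_exp_C2 c (fun t => geom_quot q h (exp (- c * t))).
Proof.
  intros Hq Hh Hc. unfold geom_quot. replace c with (c + 0) at 1 by ring.
  apply ex_exp_C2_mult.
  - apply (ex_exp_C2_rsum c (fun i t => exp (- c * t) ^ (h + i))).
    intros i _. apply ex_exp_C2_weaken with (c * INR (h + i)).
    + assert (1 <= INR (h + i)) by (apply (le_INR 1); lia). nra.
    + eapply ex_exp_C2_ext; [intros t; symmetry; apply exp_pow_mul|]. apply ex_exp_C2_exp.
  - apply ex_exp_C2_inv.
    + intros t. apply rsum_pow_ge_1; [exact Hq|left; apply exp_pos].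
    + apply (ex_exp_C2_rsum 0 (fun i t => exp (- c * t) ^ i)).
      intros i _. apply ex_exp_C2_weaken with (c * INR i).
      * pose proof (pos_INR i). nra.
      * eapply ex_exp_C2_ext; [intros t; symmetry; apply exp_pow_mul|]. apply ex_exp_C2_exp.
Qed.

Lemma ex_exp_C2_pow_geom_quot k q h c : (0 < q)%nat -> (1 <= h <= q)%nat -> 0 < c ->
  ex_exp_C2 (c / 2) (fun t => t ^ k * geom_quot q h (exp (- c * t))).
Proof.
  intros Hq Hh Hc. replace (c / 2) with (- (c / 2) + c) by field.
  apply ex_exp_C2_mult; [apply ex_exp_C2_pow; lra|apply ex_exp_C2_geom_quot; auto].
Qed.

Definition cos_transform (k q h : nat) (c w : R) : R :=
  RInt_gen (fun t => t ^ k * geom_quot q h (exp (- c * t)) * cos (w * t)) (at_point 0) (Rbar_locally p_infty).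

Lemma is_RInt_gen_cos_transform k q h c w : (0 < q)%nat -> (1 <= h <= q)%nat -> 0 < c ->
  is_RInt_gen (fun t => t ^ k * geom_quot q h (exp (- c * t)) * cos (w * t)) (at_point 0) (Rbar_locally p_infty)
    (cos_transform k q h c w).
Proof.
  intros Hq Hh Hc. apply (RInt_gen_correct (V := R_CompleteNormedModule)).
  apply (ex_RInt_gen_exp_C2 _ (c / 2)); [lra|].
  replace (c / 2) with (c / 2 + 0) by ring.
  apply ex_exp_C2_mult; [apply ex_exp_C2_pow_geom_quot; auto|apply ex_exp_C2_cos].
Qed.

(** Truncating the geometric expansion after [N] blocks leaves [z ^ (N q)] times a quotient between
    0 and 1. The error is therefore at most the transform of [t ^ k * exp (- c N q t)] at frequency
    0, namely [k! / (c N q) ^ (k + 1)], which tends to 0 even for [k = 0]. *)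
Lemma cos_transform_lim k q h c w : (0 < q)%nat -> (1 <= h <= q)%nat -> 0 < c ->
  is_lim_seq (fun N => rsum (fun i => fst (laplace k (c * INR (i * q + h)) w) - fst (laplace k (c * INR (i * q + q)) w)) N)
    (cos_transform k q h c w).
Proof.
  intros Hq Hh Hc.
  set (u := fun i => fst (laplace k (c * INR (i * q + h)) w) - fst (laplace k (c * INR (i * q + q)) w)).
  assert (HqR : 1 <= INR q) by (apply (le_INR 1); lia).
  assert (Hrem : forall N, (1 <= N)%nat -> Rabs (cos_transform k q h c w - rsum u N) <= INR (fact k) / (c * INR (N * q)) ^ S k).
  { intros N HN.
    assert (Hpos : forall n, (1 <= n)%nat -> 0 < c * INR n).
    { intros n Hn. apply Rmult_lt_0_compat; [exact Hc|apply lt_0_INR; lia]. }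
    assert (HS : is_RInt_gen (fun t => rsum (fun i => (t ^ k * exp (- (c * INR (i * q + h)) * t) * cos (w * t)) - (t ^ k * exp (- (c * INR (i * q + q)) * t) * cos (w * t))) N)
      (at_point 0) (Rbar_locally p_infty) (rsum u N)).
    { apply (is_RInt_gen_rsum (fun i t => (t ^ k * exp (- (c * INR (i * q + h)) * t) * cos (w * t)) - (t ^ k * exp (- (c * INR (i * q + q)) * t) * cos (w * t))) u (at_point 0) (Rbar_locally p_infty)).
      intros i _.
      assert (Hih : 0 < c * INR (i * q + h)) by (apply Hpos; lia).
      assert (Hiq : 0 < c * INR (i * q + q)) by (apply Hpos; lia).
      exact (is_RInt_gen_minus _ _ _ _ (proj1 (is_RInt_gen_laplace k _ w Hih)) (proj1 (is_RInt_gen_laplace k _ w Hiq))). }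
    pose proof (is_RInt_gen_minus _ _ _ _ (is_RInt_gen_cos_transform k q h c w Hq Hh Hc) HS) as HD.
    assert (HNq : 0 < c * INR (N * q)) by (apply Hpos; nia).
    destruct (is_RInt_gen_laplace k (c * INR (N * q)) 0 HNq) as [HG _].
    rewrite laplace_0 in HG by exact HNq. cbn [fst] in HG.
    refine (RInt_gen_norm (V := R_CompleteNormedModule) _ _ _ _ _ _ HD HG).
    - apply (Filter_prod _ _ _ (fun a => a = 0) (fun b => 0 < b)); [reflexivity|exists 0; auto|].
      intros a b -> Hb. simpl. lra.
    - apply (Filter_prod _ _ _ (fun a => a = 0) (fun b => 0 < b)); [reflexivity|exists 0; auto|].
      intros a b -> Hb x Hx. simpl in Hx.
      assert (E : rsum (fun i => (x ^ k * exp (- (c * INR (i * q + h)) * x) * cos (w * x)) - (x ^ k * exp (- (c * INR (i * q + q)) * x) * cos (w * x))) N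
        = x ^ k * cos (w * x) * rsum (fun i => exp (- c * x) ^ (i * q + h) - exp (- c * x) ^ (i * q + q)) N).
      { rewrite <- rsum_scal. apply rsum_ext. intros i _. rewrite !exp_pow_mul. ring. }
      change (Rabs (x ^ k * geom_quot q h (exp (- c * x)) * cos (w * x) - rsum (fun i => (x ^ k * exp (- (c * INR (i * q + h)) * x) * cos (w * x)) - (x ^ k * exp (- (c * INR (i * q + q)) * x) * cos (w * x))) N) <= x ^ k * exp (- (c * INR (N * q)) * x) * cos (0 * x)).
      rewrite E, (geom_quot_expand q h (exp (- c * x)) N) by (try lia; left; apply exp_pos).
      rewrite Rmult_0_l, cos_0, <- exp_pow_mul.
      set (G := geom_quot q h (exp (- c * x))). set (Z := exp (- c * x) ^ (N * q)).
      match goal with |- Rabs ?e <= _ => replace e with (x ^ k * Z * (G * cos (w * x))) by ring end.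
      assert (HG0 : 0 <= G <= 1) by (apply geom_quot_bound; [lia|lia|left; apply exp_pos]).
      assert (HZ : 0 <= x ^ k * Z) by (apply Rmult_le_pos; [apply pow_le; lra|apply pow_le; left; apply exp_pos]).
      rewrite Rabs_mult, (Rabs_pos_eq _ HZ). apply Rmult_le_compat_l; [exact HZ|].
      rewrite Rabs_mult, (Rabs_pos_eq G) by lra. pose proof (Rabs_cos_le (w * x)). pose proof (Rabs_pos (cos (w * x))). nra. }
  apply is_lim_seq_spec. intros eps.
  set (B := INR (fact k) / c ^ S k).
  assert (HB : 0 < B) by (apply Rdiv_lt_0_compat; [apply INR_fact_lt_0|apply pow_lt; lra]).
  destruct (nfloor_ex (B / eps)) as [M [_ HM]]; [apply Rdiv_le_0_compat; [lra|apply cond_pos]|].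
  exists (S M). intros N HN. rewrite Rabs_minus_sym.
  eapply Rle_lt_trans; [apply Hrem; lia|].
  assert (HNR : INR M + 1 <= INR N) by (rewrite <- S_INR; apply le_INR, HN).
  pose proof (pos_INR M).
  assert (HNq : INR N <= INR (N * q)) by (rewrite mult_INR; nra).
  rewrite Rpow_mult_distr. unfold Rdiv. rewrite Rinv_mult, <- Rmult_assoc. fold (INR (fact k) / c ^ S k). fold B.
  assert (Hp : INR (N * q) <= INR (N * q) ^ S k).
  { simpl. rewrite <- (Rmult_1_r (INR (N * q))) at 1. apply Rmult_le_compat_l; [lra|]. apply pow_R1_Rle. lra. }
  eapply Rle_lt_trans; [apply Rmult_le_compat_l; [lra|apply Rinv_le_contravar; [|exact Hp]]; lra|].
  apply Rlt_div_l; [lra|]. apply Rlt_div_l in HM; [|apply cond_pos].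
  pose proof (cond_pos eps). nra.
Qed.

(** * Complex sums and limits *)

Fixpoint csum (f : nat -> C) (n : nat) : C :=
  match n with O => RtoC 0 | S m => (csum f m + f m)%C end.

Lemma csum_ext f g n : (forall i, (i < n)%nat -> f i = g i) -> csum f n = csum g n.
Proof.
  induction n as [|n IH]; intros H; simpl; auto.
  rewrite IH by (intros; apply H; lia). rewrite H by lia. reflexivity.
Qed.

Lemma csum_plus f g n : csum (fun i => f i + g i)%C n = (csum f n + csum g n)%C.
Proof. induction n; simpl; [ring|rewrite IHn; ring]. Qed.

Lemma csum_scal c f n : csum (fun i => c * f i)%C n = (c * csum f n)%C.
Proof. induction n; simpl; [ring|rewrite IHn; ring]. Qed.

Lemma csum_minus f g n : csum (fun i => f i - g i)%C n = (csum f n - csum g n)%C.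
Proof. induction n; simpl; [ring|rewrite IHn; ring]. Qed.

Lemma csum_zero n : csum (fun _ => RtoC 0) n = RtoC 0.
Proof. induction n; simpl; [|rewrite IHn]; ring. Qed.

Lemma csum_swap (f : nat -> nat -> C) n m :
  csum (fun i => csum (fun j => f i j) m) n = csum (fun j => csum (fun i => f i j) n) m.
Proof.
  induction n; simpl.
  - symmetry. apply csum_zero.
  - rewrite IHn, csum_plus. reflexivity.
Qed.

Lemma csum_split f n m : csum f (n + m) = (csum f n + csum (fun i => f (n + i)%nat) m)%C.
Proof.
  induction m as [|m IH].
  - rewrite Nat.add_0_r; simpl; ring.
  - rewrite Nat.add_succ_r. simpl. rewrite IH. ring.
Qed.

Lemma csum_head f n : csum f (S n) = (f O + csum (fun i => f (S i)) n)%C.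
Proof. change (S n) with (1 + n)%nat. rewrite csum_split. simpl. f_equal. ring. Qed.

Lemma csum_rev f n : csum f n = csum (fun i => f (n - 1 - i)%nat) n.
Proof.
  induction n as [|n IH]; [reflexivity|].
  rewrite (csum_head (fun i => f (S n - 1 - i)%nat)). simpl csum at 1. rewrite IH.
  rewrite Cplus_comm. f_equal; [f_equal; lia|].
  apply csum_ext. intros i Hi. f_equal. lia.
Qed.

Lemma csum_RtoC f n : csum (fun i => RtoC (f i)) n = RtoC (rsum f n).
Proof. induction n; simpl; [reflexivity|rewrite IHn, RtoC_plus; reflexivity]. Qed.

Lemma Cmod_csum f n : Cmod (csum f n) <= rsum (fun i => Cmod (f i)) n.
Proof.
  induction n; simpl; [rewrite Cmod_0; lra|].
  eapply Rle_trans; [apply Cmod_triangle|lra].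
Qed.

Lemma csum_blocks f n m : csum f (n * m) = csum (fun j => csum (fun h => f (j * m + h)%nat) m) n.
Proof.
  induction n as [|n IH]; [reflexivity|].
  replace (S n * m)%nat with (n * m + m)%nat by lia. rewrite csum_split, IH. reflexivity.
Qed.

Lemma csum_fold f a n : fold_right Cplus (RtoC 0) (map f (seq a n)) = csum (fun i => f (a + i)%nat) n.
Proof.
  revert a. induction n as [|n IH]; intros a; [reflexivity|].
  rewrite csum_head. simpl. rewrite IH, Nat.add_0_r. f_equal.
  apply csum_ext. intros; f_equal; lia.
Qed.

Lemma fold_Cplus_perm (l l' : list C) : Permutation l l' ->
  fold_right Cplus (RtoC 0) l = fold_right Cplus (RtoC 0) l'.
Proof.
  induction 1; simpl; auto.
  - rewrite IHPermutation; reflexivity.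
  - ring.
  - congruence.
Qed.

(** * Limits of complex sequences and series, measured by the modulus *)

Definition Clim (u : nat -> C) (l : C) : Prop := is_lim_seq (fun n => Cmod (u n - l)%C) 0.

Lemma Clim_bound u l (e : nat -> R) : (forall n, Cmod (u n - l)%C <= e n) -> is_lim_seq e 0 -> Clim u l.
Proof.
  intros H He. apply is_lim_seq_le_le with (u := fun _ => 0) (w := e); auto.
  - intros n; split; [apply Cmod_ge_0|apply H].
  - apply is_lim_seq_const.
Qed.

Lemma Clim_ext u v l : (forall n, u n = v n) -> Clim u l -> Clim v l.
Proof. intros E H. eapply is_lim_seq_ext; [|exact H]. intros; cbv beta; rewrite E; reflexivity. Qed.

Lemma Clim_const c : Clim (fun _ => c) c.
Proof.
  apply (is_lim_seq_ext (fun _ => 0)); [|apply is_lim_seq_const].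
  intros _. replace (c - c)%C with (RtoC 0) by ring. symmetry; apply Cmod_0.
Qed.

Lemma Clim_plus u v l m : Clim u l -> Clim v m -> Clim (fun n => u n + v n)%C (l + m)%C.
Proof.
  intros Hu Hv. apply (Clim_bound _ _ (fun n => Cmod (u n - l)%C + Cmod (v n - m)%C)).
  - intros n. replace (u n + v n - (l + m))%C with ((u n - l) + (v n - m))%C by ring. apply Cmod_triangle.
  - replace (Finite 0) with (Finite (0 + 0)) by (f_equal; ring). apply is_lim_seq_plus'; auto.
Qed.

Lemma Clim_scal c u l : Clim u l -> Clim (fun n => c * u n)%C (c * l)%C.
Proof.
  intros Hu. apply (Clim_bound _ _ (fun n => Cmod c * Cmod (u n - l)%C)).
  - intros n. replace (c * u n - c * l)%C with (c * (u n - l))%C by ring. rewrite Cmod_mult. lra.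
  - replace (Finite 0) with (Rbar_mult (Cmod c) (Finite 0)) by (simpl; f_equal; ring).
    apply (is_lim_seq_scal_l _ (Cmod c) 0 Hu).
Qed.

Lemma Clim_RtoC u l : is_lim_seq u (Finite l) -> Clim (fun n => RtoC (u n)) (RtoC l).
Proof.
  intros H. apply (is_lim_seq_ext (fun n => Rabs (u n - l))).
  - intros n. rewrite <- RtoC_minus, Cmod_R. reflexivity.
  - replace (Finite 0) with (Rbar_abs (Finite (l - l))) by (simpl; f_equal; rewrite Rminus_diag, Rabs_R0; ring).
    apply is_lim_seq_abs. apply is_lim_seq_minus'; [exact H|apply is_lim_seq_const].
Qed.

Lemma Clim_csum (u : nat -> nat -> C) (l : nat -> C) n :
  (forall i, (i < n)%nat -> Clim (fun N => u N i) (l i)) -> Clim (fun N => csum (u N) n) (csum l n).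
Proof.
  induction n as [|n IH]; intros H; simpl.
  - apply Clim_const.
  - apply Clim_plus; [apply IH; intros; apply H; lia|apply H; lia].
Qed.

Lemma Clim_incr_1 u l : Clim (fun n => u (S n)) l <-> Clim u l.
Proof. symmetry. apply (is_lim_seq_incr_1 (fun n => Cmod (u n - l)%C) 0). Qed.

Lemma Clim_unique u l m : Clim u l -> Clim u m -> l = m.
Proof.
  intros Hl Hm.
  assert (H : is_lim_seq (fun _ => Cmod (m - l)%C) 0).
  { apply is_lim_seq_le_le with (u := fun _ => 0) (w := fun n => Cmod (u n - l)%C + Cmod (u n - m)%C).
    - intros n; split; [apply Cmod_ge_0|].
      replace (m - l)%C with ((u n - l) + - (u n - m))%C by ring.
      rewrite <- (Cmod_opp (u n - m)%C). apply Cmod_triangle.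
    - apply is_lim_seq_const.
    - replace (Finite 0) with (Finite (0 + 0)) by (f_equal; ring). apply is_lim_seq_plus'; auto. }
  apply is_lim_seq_unique in H. rewrite Lim_seq_const in H. injection H as H.
  apply Cmod_eq_0 in H. replace l with (m - (m - l))%C by ring. rewrite H. ring.
Qed.

Lemma sum_n_csum (a : nat -> C) n : @sum_n C_AbelianMonoid a n = csum a (S n).
Proof.
  induction n.
  - rewrite sum_O; simpl. ring.
  - rewrite sum_Sn, IHn; reflexivity.
Qed.

(** The uniform structure of [C] is that of a product, so its balls and those of the modulus agree
    only up to the factor [sqrt 2]. *)
Lemma is_series_Clim (a : nat -> C) l : is_series a l <-> Clim (csum a) l.
Proof.
  rewrite <- Clim_incr_1. unfold Clim, is_series. split; intros H.
  - apply is_lim_seq_spec. intros eps.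
    assert (Hs : 0 < sqrt 2) by (apply sqrt_lt_R0; lra).
    assert (He : 0 < eps / sqrt 2) by (apply Rdiv_lt_0_compat; [apply cond_pos|exact Hs]).
    destruct (proj1 (filterlim_locally _ _) H (mkposreal _ He)) as [N HN].
    exists N. intros n Hn. specialize (HN n Hn).
    apply (C_NormedModule_mixin_compat2 l _ (mkposreal _ He)) in HN.
    rewrite Rminus_0_r, Rabs_pos_eq by apply Cmod_ge_0.
    rewrite <- sum_n_csum.
    replace (pos eps) with (sqrt 2 * (eps / sqrt 2)) by (field; lra). exact HN.
  - apply filterlim_locally. intros eps.
    destruct (proj2 (is_lim_seq_spec _ _) H eps) as [N HN].
    exists N. intros n Hn. specialize (HN n Hn). cbv beta in HN.
    rewrite Rminus_0_r, Rabs_pos_eq in HN by apply Cmod_ge_0.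
    apply C_NormedModule_mixin_compat1. rewrite <- sum_n_csum in HN. exact HN.
Qed.

Lemma CSeries_eq (a : nat -> C) l : is_series a l -> CSeries a = l.
Proof.
  intros H. unfold CSeries.
  assert (H' : is_series a (epsilon (inhabits (RtoC 0)) (fun l => is_series a l))).
  { apply epsilon_spec. exists l; exact H. }
  apply is_series_Clim in H, H'. exact (Clim_unique _ _ _ H' H).
Qed.

Lemma is_series_C_comparison (a : nat -> C) (b : nat -> R) :
  (forall n, Cmod (a n) <= b n) -> ex_series b -> exists l, is_series a l.
Proof.
  intros Hab Hb. apply (ex_series_le (K := C_AbsRing) (V := C_CompleteNormedModule) a b); auto.
Qed.

(** * Gauss sums *)

Definition zeta (q n : nat) : C := Cexp (0%R, (2 * PI * INR n / INR q)%R).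

Lemma Cexp_imag t : Cexp (0, t) = (cos t, sin t).
Proof. unfold Cexp. simpl. rewrite exp_0, !Rmult_1_l. reflexivity. Qed.

Lemma Cexp_plus z w : Cexp (z + w)%C = (Cexp z * Cexp w)%C.
Proof.
  destruct z as [a b], w as [c d]. unfold Cexp, Cmult, Cplus, Re, Im. simpl.
  rewrite exp_plus, cos_plus, sin_plus. f_equal; ring.
Qed.

Lemma zeta_plus q m n : (0 < q)%nat -> zeta q (m + n) = (zeta q m * zeta q n)%C.
Proof.
  intros Hq. unfold zeta. rewrite <- Cexp_plus. f_equal. unfold Cplus; simpl. f_equal; [ring|].
  rewrite plus_INR. field. apply not_0_INR; lia.
Qed.

Lemma zeta_mul_q q n : (0 < q)%nat -> zeta q (n * q) = RtoC 1.
Proof.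
  intros Hq. unfold zeta. rewrite Cexp_imag, mult_INR.
  replace (2 * PI * (INR n * INR q) / INR q) with (0 + 2 * INR n * PI) by (field; apply not_0_INR; lia).
  rewrite cos_period, sin_period, cos_0, sin_0. reflexivity.
Qed.

Lemma zeta_mod q n : (0 < q)%nat -> zeta q (n mod q) = zeta q n.
Proof.
  intros Hq. rewrite (Nat.div_mod n q) at 2 by lia.
  rewrite zeta_plus, Nat.mul_comm, zeta_mul_q by exact Hq. ring.
Qed.

Lemma zeta_conj q n : (zeta q n * Cconj (zeta q n))%C = RtoC 1.
Proof.
  unfold zeta. rewrite Cexp_imag. unfold Cmult, Cconj, RtoC; simpl.
  set (t := 2 * PI * INR n / INR q). pose proof (sin2_cos2 t) as H. unfold Rsqr in H.
  f_equal; [lra|ring].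
Qed.

Lemma csum_geom x n : ((RtoC 1 - x) * csum (fun i => Cpow x i) n)%C = (RtoC 1 - Cpow x n)%C.
Proof. induction n; simpl; [ring|rewrite Cmult_plus_distr_l, IHn; ring]. Qed.

Lemma zeta_pow q n d : (0 < q)%nat -> zeta q (n * d) = Cpow (zeta q n) d.
Proof.
  intros Hq. induction d as [|d IH].
  - rewrite Nat.mul_0_r. exact (zeta_mul_q q 0 Hq).
  - simpl. rewrite <- IH, Nat.mul_succ_r, Nat.add_comm. apply zeta_plus, Hq.
Qed.

Lemma zeta_neq q j h : (j < q)%nat -> (h < q)%nat -> j <> h -> (zeta q j * Cconj (zeta q h))%C <> RtoC 1.
Proof.
  intros Hj Hh Hne E. unfold zeta in E. rewrite !Cexp_imag in E.
  assert (HqR : 0 < INR q) by (apply lt_0_INR; lia).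
  set (t := 2 * PI * INR j / INR q) in E. set (s := 2 * PI * INR h / INR q) in E.
  apply (f_equal fst) in E. unfold Cmult, Cconj, RtoC in E; simpl in E.
  replace (cos t * cos s - sin t * - sin s) with (cos t * cos s + sin t * sin s) in E by ring.
  rewrite <- cos_minus in E.
  (* Half the angle between the two roots of unity. It lies strictly between [- PI] and [PI], where
     the sine vanishes only at 0. *)
  set (th := PI * ((INR j - INR h) / INR q)).
  replace (t - s) with (2 * th) in E by (unfold t, s, th; field; lra).
  rewrite cos_2a_sin in E.
  assert (Hs : sin th = 0) by nra.
  assert (Hb : -1 < (INR j - INR h) / INR q < 1).
  { apply lt_INR in Hj, Hh. pose proof (pos_INR j). pose proof (pos_INR h).
    split; [apply Rlt_div_r; lra|apply Rlt_div_l; lra]. }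
  pose proof PI_RGT_0.
  assert (Hne' : INR j <> INR h) by (intros e; apply INR_eq in e; auto).
  destruct (Rdichotomy _ _ Hne') as [h1|h1].
  - assert (0 < - th).
    { assert (Hx : 0 < (INR h - INR j) / INR q) by (apply Rdiv_lt_0_compat; lra).
      unfold th. replace (- (PI * ((INR j - INR h) / INR q))) with (PI * ((INR h - INR j) / INR q)) by (field; lra). nra. }
    assert (0 < sin (- th)) by (apply sin_gt_0; [lra|unfold th; nra]). rewrite sin_neg in H1. lra.
  - assert (0 < th).
    { assert (Hx : 0 < (INR j - INR h) / INR q) by (apply Rdiv_lt_0_compat; lra). unfold th; nra. }
    assert (0 < sin th) by (apply sin_gt_0; [lra|unfold th; nra]). lra.
Qed.

Lemma Cmult_eq_0 (x y : C) : (x * y)%C = RtoC 0 -> x = RtoC 0 \/ y = RtoC 0.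
Proof.
  intros H. apply (f_equal Cmod) in H. rewrite Cmod_mult, Cmod_0 in H.
  apply Rmult_integral in H. destruct H; [left|right]; apply Cmod_eq_0; assumption.
Qed.

Lemma zeta_orthogonal q j h : (j < q)%nat -> (h < q)%nat ->
  csum (fun d => zeta q (j * d) * Cconj (zeta q (h * d)))%C q = if Nat.eqb j h then RtoC (INR q) else RtoC 0.
Proof.
  intros Hj Hh. assert (Hq : (0 < q)%nat) by lia.
  destruct (Nat.eqb_spec j h) as [->|Hne].
  - rewrite (csum_ext _ (fun _ => RtoC 1)) by (intros; apply zeta_conj).
    rewrite (csum_RtoC (fun _ => 1)). f_equal. clear. induction q; [reflexivity|]. cbn [rsum]. rewrite IHq, S_INR. ring.
  - set (x := (zeta q j * Cconj (zeta q h))%C).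
    rewrite (csum_ext _ (fun d => Cpow x d)).
    2:{ intros d _. unfold x. rewrite !zeta_pow by exact Hq.
        rewrite Cpow_mult_l, Cpow_conj. reflexivity. }
    assert (Hx : Cpow x q = RtoC 1).
    { unfold x. rewrite Cpow_mult_l, <- Cpow_conj, <- !zeta_pow, !zeta_mul_q by exact Hq.
      unfold Cconj, Cmult, RtoC; simpl. f_equal; ring. }
    pose proof (csum_geom x q) as E. rewrite Hx in E. replace (RtoC 1 - RtoC 1)%C with (RtoC 0) in E by ring.
    apply Cmult_eq_0 in E. destruct E as [E|E]; [|exact E].
    exfalso. apply (zeta_neq q j h Hj Hh Hne). fold x.
    replace x with (RtoC 1 - (RtoC 1 - x))%C by ring. rewrite E. ring.
Qed.

(** Multiplication by a unit is injective on the residues modulo [q], hence permutes them by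
    counting. *)
Lemma csum_mul_unit (F : nat -> C) q n : (0 < q)%nat -> Nat.gcd n q = 1%nat ->
  (forall h, F (h mod q) = F h) -> csum (fun h => F (h * n)%nat) q = csum F q.
Proof.
  intros Hq Hg HF.
  rewrite (csum_ext (fun h => F (h * n)%nat) (fun h => F ((h * n) mod q))) by (intros; symmetry; apply HF).
  transitivity (fold_right Cplus (RtoC 0) (map (fun h => F ((h * n) mod q)) (seq 0 q)));
    [symmetry; apply csum_fold|].
  transitivity (fold_right Cplus (RtoC 0) (map F (seq 0 q))); [|apply csum_fold].
  rewrite <- (map_map (fun h => (h * n) mod q) F).
  apply fold_Cplus_perm, Permutation_map.
  apply NoDup_Permutation_bis.
  - apply NoDup_map_NoDup_ForallPairs; [|apply seq_NoDup].
    intros a b Ha Hb E. apply in_seq in Ha, Hb.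
    assert (Hdiv : forall a b, (a <= b < q)%nat -> (a * n) mod q = (b * n) mod q -> a = b).
    { clear a b Ha Hb E. intros a b Hab E.
      assert (D : Nat.divide q ((b - a) * n)).
      { apply Nat.Lcm0.mod_divide. rewrite Nat.mul_sub_distr_r.
        pose proof (Nat.div_mod (a * n) q ltac:(lia)). pose proof (Nat.div_mod (b * n) q ltac:(lia)).
        assert (a * n <= b * n)%nat by nia.
        rewrite H, H0, E. replace (q * (b * n / q) + (b * n) mod q - (q * (a * n / q) + (b * n) mod q))%nat with (q * (b * n / q - a * n / q))%nat by nia.
        rewrite Nat.mul_comm. apply Nat.Div0.mod_mul. }
      rewrite Nat.mul_comm in D. apply Nat.gauss in D; [|rewrite Nat.gcd_comm; exact Hg].
      destruct (Nat.eq_dec (b - a) 0); [lia|]. apply Nat.divide_pos_le in D; lia. }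
    destruct (Nat.le_ge_cases a b); [apply Hdiv; [lia|exact E]|symmetry; apply Hdiv; [lia|symmetry; exact E]].
  - rewrite length_map. lia.
  - intros x Hx. apply in_map_iff in Hx. destruct Hx as [h [<- _]]. apply in_seq.
    pose proof (Nat.mod_upper_bound (h * n) q ltac:(lia)). lia.
Qed.

(** * Dirichlet characters and the Fourier expansion of a primitive character *)

Lemma char_mod q chi n : dirichlet_char q chi -> chi (n mod q) = chi n.
Proof.
  intros [Hq [_ [_ [Hp _]]]].
  assert (H : forall j m, chi (m + j * q)%nat = chi m).
  { induction j as [|j IH]; intros m; [f_equal; lia|].
    replace (m + S j * q)%nat with (m + j * q + q)%nat by lia. rewrite Hp. apply IH. }
  rewrite (Nat.div_mod n q) at 2 by lia. rewrite Nat.add_comm, Nat.mul_comm. symmetry. apply H.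
Qed.

Lemma char_add_mul q chi n j : dirichlet_char q chi -> chi (j * q + n)%nat = chi n.
Proof.
  intros H. rewrite <- (char_mod q chi (j * q + n) H), <- (char_mod q chi n H).
  f_equal. rewrite Nat.add_comm. apply Nat.Div0.mod_add.
Qed.

Lemma char_bounded q chi : dirichlet_char q chi -> exists M, forall n, Cmod (chi n) <= M.
Proof.
  intros H. exists (rsum (fun h => Cmod (chi h)) q). intros n.
  rewrite <- (char_mod q chi n H). destruct H as [Hq _].
  pose proof (Nat.mod_upper_bound n q ltac:(lia)) as Hn. set (m := n mod q) in *.
  replace q with (m + S (q - S m))%nat by lia. rewrite rsum_split, <- (Nat.add_1_l (q - S m)), rsum_split.
  cbn [rsum]. rewrite Nat.add_0_r.
  assert (0 <= rsum (fun h => Cmod (chi h)) m) by (apply rsum_nonneg; intros; apply Cmod_ge_0).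
  assert (0 <= rsum (fun i => Cmod (chi (m + (1 + i))%nat)) (q - S m)) by (apply rsum_nonneg; intros; apply Cmod_ge_0).
  lra.
Qed.

(** A value of modulus above 1 would have unbounded powers [chi (n ^ j)], whereas periodicity bounds
    [chi]. *)
Lemma char_Cmod_le q chi n : dirichlet_char q chi -> Cmod (chi n) <= 1.
Proof.
  intros H. destruct (char_bounded q chi H) as [M HM].
  destruct (Rle_dec (Cmod (chi n)) 1) as [h|h]; [exact h|exfalso].
  destruct H as [_ [H1 [Hm _]]].
  assert (E : forall j, Cmod (chi (n ^ j)%nat) = Cmod (chi n) ^ j).
  { induction j as [|j IH]; [simpl; rewrite H1; apply Cmod_1|].
    simpl. rewrite Hm, Cmod_mult, IH. reflexivity. }
  destruct (Pow_x_infinity (Cmod (chi n)) ltac:(rewrite Rabs_pos_eq; [lra|apply Cmod_ge_0]) (M + 1)) as [N HN].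
  specialize (HN N (le_n N)). rewrite Rabs_pos_eq in HN by (apply pow_le, Cmod_ge_0).
  rewrite <- E in HN. specialize (HM (n ^ N)%nat). lra.
Qed.

Lemma unit_inverse_mod q n : (0 < q)%nat -> Nat.gcd n q = 1%nat -> exists m, ((n * m) mod q = 1 mod q)%nat.
Proof.
  intros Hq Hg. destruct (Nat.eq_dec n 0) as [->|Hn].
  { exists O. simpl in Hg. subst q. reflexivity. }
  destruct (Nat.gcd_bezout_pos n q ltac:(lia)) as [a [b E]]. rewrite Hg in E.
  exists a. rewrite Nat.mul_comm, E. apply Nat.Div0.mod_add.
Qed.

(** The values at [n] and at an inverse of [n] have product 1 and moduli at most 1, so both moduli
    equal 1. *)
Lemma char_conj_mul q chi n : dirichlet_char q chi -> Nat.gcd n q = 1%nat -> (Cconj (chi n) * chi n)%C = RtoC 1.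
Proof.
  intros H Hg. rewrite Cmult_comm, <- Cmod2_conj.
  assert (E : Cmod (chi n) = 1).
  { destruct (unit_inverse_mod q n (proj1 H) Hg) as [m Hm].
    assert (E : (chi n * chi m)%C = RtoC 1).
    { pose proof H as [Hq [H1 [Hmul HH]]]. rewrite <- Hmul, <- H1, <- (char_mod q chi (n * m)), Hm by exact H.
      apply char_mod. exact H. }
    apply (f_equal Cmod) in E. rewrite Cmod_mult, Cmod_1 in E.
    pose proof (char_Cmod_le q chi n H). pose proof (char_Cmod_le q chi m H).
    pose proof (Cmod_ge_0 (chi n)). pose proof (Cmod_ge_0 (chi m)). nra. }
  rewrite E, pow1. reflexivity.
Qed.

(** The defining sum runs over [1 .. q]; moving the residue [q] to 0 gives the range [0 .. q - 1]
    used by all other sums over residues. *)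
Lemma gauss_sum_csum q chi : dirichlet_char q chi -> gauss_sum q chi = csum (fun h => chi h * zeta q h)%C q.
Proof.
  intros H. unfold gauss_sum. rewrite csum_fold.
  pose proof (proj1 H) as Hq. destruct q as [|q]; [lia|].
  rewrite (csum_head (fun h => chi h * zeta (S q) h)%C). cbn [csum]. rewrite Cplus_comm. f_equal.
  assert (Ec : chi (1 + q)%nat = chi O) by (rewrite <- (char_mod (S q) chi (1 + q) H); f_equal; apply Nat.Div0.mod_same).
  assert (Ez : zeta (S q) (1 + q) = zeta (S q) 0) by (rewrite <- (zeta_mod (S q) (1 + q)) by lia; f_equal; apply Nat.Div0.mod_same).
  rewrite Ec. f_equal. exact Ez.
Qed.

(** If [d] is a unit this is a change of variable. Otherwise primitivity supplies a unit [n],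
    congruent to 1 modulo [q / gcd(d, q)], with [chi n <> 1]. Replacing [h] by [h n] fixes
    [zeta q (h * d)] and multiplies the sum by [chi n], so the sum vanishes, as does [chi d]. *)
Lemma gauss_sum_twist q chi d : dirichlet_char q chi -> primitive_char q chi ->
  csum (fun h => chi h * zeta q (h * d))%C q = (Cconj (chi d) * gauss_sum q chi)%C.
Proof.
  intros H Hprim. rewrite gauss_sum_csum by exact H. pose proof (proj1 H) as Hq.
  pose proof H as [_ [H1 [Hm [Hp H0]]]].
  destruct (Nat.eq_dec (Nat.gcd d q) 1) as [Hg|Hg].
  - rewrite <- (csum_mul_unit (fun h => chi h * zeta q h)%C q d Hq Hg).
    2:{ intros h. rewrite zeta_mod, char_mod by assumption. reflexivity. }
    rewrite <- csum_scal. apply csum_ext. intros h _. rewrite Hm.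
    transitivity ((Cconj (chi d) * chi d) * (chi h * zeta q (h * d)))%C; [|ring].
    rewrite char_conj_mul with (q := q) by assumption. ring.
  - assert (E : chi d = RtoC 0) by (apply H0, Hg).
    rewrite E. replace (Cconj (RtoC 0)) with (RtoC 0) by (unfold Cconj, RtoC; simpl; f_equal; ring).
    rewrite Cmult_0_l.
    set (g := Nat.gcd d q) in *.
    destruct (Nat.gcd_divide_l d q) as [d' Hd']. destruct (Nat.gcd_divide_r d q) as [q' Hq']. fold g in Hd', Hq'.
    assert (Hq'0 : (q' <> 0)%nat) by (intros ->; lia).
    assert (Hg0 : (g <> 0)%nat) by (intros e; rewrite e in Hq'; lia).
    clearbody g.
    assert (Hdiv : Nat.divide q' q) by (exists g; rewrite Nat.mul_comm; exact Hq').
    assert (Hlt : (q' < q)%nat) by nia.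
    assert (HP := Hprim q' Hdiv Hlt).
    apply not_all_ex_not in HP. destruct HP as [n HP].
    apply imply_to_and in HP. destruct HP as [Hn1 HP].
    apply imply_to_and in HP. destruct HP as [Hn2 Hn3].
    (* [n] and 1 have the same remainder modulo [q'], and [d] is a multiple of [g] with
       [q' * g = q]; so the two arguments agree modulo [q]. *)
    assert (Hz : forall h, zeta q (h * n * d) = zeta q (h * d)).
    { intros h. rewrite <- (zeta_mod q (h * n * d)), <- (zeta_mod q (h * d)) by exact Hq. f_equal.
      pose proof (Nat.div_mod n q' Hq'0) as E1. rewrite Hn2 in E1.
      pose proof (Nat.div_mod 1 q' Hq'0) as E2.
      set (x := (n / q')%nat) in *. set (y := (1 / q')%nat) in *. set (r := (1 mod q')%nat) in *.
      rewrite E1.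
      replace (h * (q' * x + r) * d)%nat with (h * r * d + (h * x * d') * q)%nat by (rewrite Hq', Hd'; ring).
      replace (h * d)%nat with (h * (q' * y + r) * d)%nat by (rewrite <- E2; ring).
      replace (h * (q' * y + r) * d)%nat with (h * r * d + (h * y * d') * q)%nat by (rewrite Hq', Hd'; ring).
      rewrite !Nat.Div0.mod_add. reflexivity. }
    set (S0 := csum (fun h => chi h * zeta q (h * d))%C q).
    assert (ES : S0 = (chi n * S0)%C).
    { unfold S0 at 1. rewrite <- (csum_mul_unit (fun h => chi h * zeta q (h * d))%C q n Hq Hn1).
      2:{ intros h. rewrite char_mod by assumption. f_equal.
          rewrite <- (zeta_mod q (h mod q * d)), <- (zeta_mod q (h * d)) by exact Hq. f_equal.
          apply Nat.Div0.mul_mod_idemp_l. }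
      unfold S0. rewrite <- csum_scal. apply csum_ext. intros h _. rewrite Hm, Hz. ring. }
    assert (EZ : ((RtoC 1 - chi n) * S0)%C = RtoC 0).
    { replace ((RtoC 1 - chi n) * S0)%C with (S0 - chi n * S0)%C by ring. rewrite <- ES. ring. }
    apply Cmult_eq_0 in EZ. destruct EZ as [EZ|EZ]; [|exact EZ].
    exfalso. apply Hn3. replace (chi n) with (RtoC 1 - (RtoC 1 - chi n))%C by ring. rewrite EZ. ring.
Qed.

(** Fourier inversion modulo [q]: [Cconj (chi d) * gauss_sum q chi] is opened as a twisted sum, and
    orthogonality of the roots of unity isolates the residue of [h]. *)
Lemma char_fourier q chi h : dirichlet_char q chi -> primitive_char q chi ->
  (RtoC (INR q) * chi h)%C = (gauss_sum q chi * csum (fun d => Cconj (chi d) * Cconj (zeta q (h * d))) q)%C.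
Proof.
  intros H Hprim. pose proof (proj1 H) as Hq.
  rewrite <- (char_mod q chi h H).
  rewrite (csum_ext _ (fun d => Cconj (chi d) * Cconj (zeta q (h mod q * d)))%C).
  2:{ intros d _. do 2 f_equal. rewrite <- (zeta_mod q (h mod q * d)), <- (zeta_mod q (h * d)) by exact Hq. f_equal.
      symmetry. apply Nat.Div0.mul_mod_idemp_l. }
  pose proof (Nat.mod_upper_bound h q ltac:(lia)) as Hh. set (m := h mod q) in *.
  rewrite <- csum_scal.
  rewrite (csum_ext _ (fun d => csum (fun j => chi j * (zeta q (j * d) * Cconj (zeta q (m * d)))) q)%C).
  2:{ intros d _. transitivity (Cconj (zeta q (m * d)) * (Cconj (chi d) * gauss_sum q chi))%C; [ring|].
      rewrite <- gauss_sum_twist, <- csum_scal by assumption. apply csum_ext. intros; ring. }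
  rewrite csum_swap.
  rewrite (csum_ext _ (fun j => if Nat.eqb j m then (RtoC (INR q) * chi m)%C else RtoC 0)).
  2:{ intros j Hj. rewrite csum_scal, zeta_orthogonal by assumption.
      destruct (Nat.eqb_spec j m) as [->|]; ring. }
  generalize (RtoC (INR q) * chi m)%C. intros v. clear - Hh.
  assert (E : forall n, csum (fun j => if Nat.eqb j m then v else RtoC 0) n = if Nat.ltb m n then v else RtoC 0).
  { induction n as [|n IH]; [reflexivity|]. cbn [csum]. rewrite IH.
    destruct (Nat.ltb_spec m n), (Nat.ltb_spec m (S n)), (Nat.eqb_spec n m); try lia; ring. }
  rewrite E. destruct (Nat.ltb_spec m q); [reflexivity|lia].
Qed.

Lemma gcd_pred q : (1 < q)%nat -> Nat.gcd (q - 1) q = 1%nat.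
Proof.
  intros Hq. destruct (Nat.gcd_divide_l (q - 1) q) as [a Ha]. destruct (Nat.gcd_divide_r (q - 1) q) as [b Hb].
  set (g := Nat.gcd (q - 1) q) in *.
  assert (Hd : Nat.divide g 1) by (exists (b - a)%nat; rewrite Nat.mul_sub_distr_r; lia).
  apply Nat.divide_1_r in Hd. exact Hd.
Qed.

Lemma odd_char_gt_2 q chi : dirichlet_char q chi -> odd_char q chi -> (2 < q)%nat.
Proof.
  intros H Ho. unfold odd_char in Ho. pose proof (proj1 H). destruct (proj2 H) as [H1 _].
  assert (Hne : RtoC (-1) <> RtoC 1) by (intros E; apply (f_equal fst) in E; simpl in E; lra).
  destruct q as [|[|[|q]]]; try lia; exfalso; apply Hne.
  - rewrite <- Ho, <- H1. simpl. rewrite <- (char_mod 1 chi 1 H). reflexivity.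
  - rewrite <- Ho, <- H1. reflexivity.
Qed.

(** The substitution [h -> h * (q - 1)], that is [h -> - h], changes the sign of the character and
    fixes [G]. *)
Lemma odd_char_csum_even q chi (G : nat -> C) : dirichlet_char q chi -> odd_char q chi ->
  (forall h, G (h mod q) = G h) -> (forall h, G (h * (q - 1))%nat = G h) ->
  csum (fun h => Cconj (chi h) * G h)%C q = RtoC 0.
Proof.
  intros H Ho HG1 HG2. pose proof (odd_char_gt_2 q chi H Ho) as Hq2.
  set (S0 := csum (fun h => Cconj (chi h) * G h)%C q).
  assert (E : S0 = (- S0)%C).
  { unfold S0 at 1. rewrite <- (csum_mul_unit (fun h => Cconj (chi h) * G h)%C q (q - 1)).
    - unfold S0. replace (- csum (fun h => Cconj (chi h) * G h)%C q)%C with (RtoC (-1) * csum (fun h => Cconj (chi h) * G h)%C q)%C by ring.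
      rewrite <- csum_scal. apply csum_ext. intros h _.
      rewrite HG2. destruct H as [_ [_ [Hm _]]]. rewrite Hm, Ho.
      rewrite Cmult_conj. replace (Cconj (RtoC (-1))) with (RtoC (-1)) by (unfold Cconj, RtoC; simpl; f_equal; ring). ring.
    - lia.
    - apply gcd_pred; lia.
    - intros h. rewrite HG1, char_mod by exact H. reflexivity. }
  assert (E2 : (RtoC 2 * S0)%C = RtoC 0).
  { replace (RtoC 2 * S0)%C with (S0 + S0)%C by (replace (RtoC 2) with (RtoC 1 + RtoC 1)%C by (rewrite <- RtoC_plus; f_equal; ring); ring).
    rewrite E at 2. ring. }
  apply Cmult_eq_0 in E2. destruct E2 as [E2|E2]; [|exact E2].
  apply (f_equal fst) in E2. simpl in E2. lra.
Qed.

(* The nonzero residues [1 .. q - 1] are indexed as [S i] with [i < q - 1]. *)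
Lemma csum_char_shift q chi (G : nat -> C) : dirichlet_char q chi -> (1 < q)%nat ->
  csum (fun h => Cconj (chi h) * G h)%C q = csum (fun i => Cconj (chi (S i)) * G (S i))%C (q - 1).
Proof.
  intros H Hq. replace q with (S (q - 1)) at 1 by lia. rewrite csum_head.
  assert (E : chi O = RtoC 0).
  { destruct H as [_ [_ [_ [_ H0]]]]. apply H0. simpl. lia. }
  rewrite E. replace (Cconj (RtoC 0)) with (RtoC 0) by (unfold Cconj, RtoC; simpl; f_equal; ring). ring.
Qed.

Lemma csum_conj_char q chi : dirichlet_char q chi -> odd_char q chi ->
  csum (fun i => Cconj (chi (S i))) (q - 1) = RtoC 0.
Proof.
  intros H Ho. pose proof (odd_char_gt_2 q chi H Ho).
  pose proof (odd_char_csum_even q chi (fun _ => RtoC 1) H Ho ltac:(reflexivity) ltac:(reflexivity)) as E.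
  rewrite csum_char_shift in E by (auto; lia). rewrite <- E. apply csum_ext. intros; ring.
Qed.

Lemma char_reflect q chi h : dirichlet_char q chi -> odd_char q chi -> (h <= q)%nat -> chi (q - h)%nat = (- chi h)%C.
Proof.
  intros H Ho Hh. pose proof (odd_char_gt_2 q chi H Ho).
  transitivity (chi (h * (q - 1))%nat).
  - rewrite <- (char_mod q chi (q - h) H), <- (char_mod q chi (h * (q - 1)) H). f_equal.
    destruct h as [|h].
    + simpl. rewrite Nat.sub_0_r, Nat.Div0.mod_same, Nat.Div0.mod_0_l. reflexivity.
    + replace (S h * (q - 1))%nat with (q - S h + h * q)%nat by nia. rewrite Nat.Div0.mod_add. reflexivity.
  - destruct H as [_ [_ [Hm _]]]. rewrite Hm, Ho. ring.
Qed.

(** In the Fourier expansion the cosine half is even in the residue and so cancels against an odd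
    character. *)
Lemma char_sin_sum q chi d : dirichlet_char q chi -> primitive_char q chi -> odd_char q chi ->
  chi d = (- Ci * gauss_sum q chi / RtoC (INR q)
    * csum (fun i => Cconj (chi (S i)) * RtoC (sin (2 * PI * INR (S i) / INR q * INR d))) (q - 1))%C.
Proof.
  intros H Hp Ho. pose proof (odd_char_gt_2 q chi H Ho) as Hq2.
  assert (HqR : INR q <> 0) by (apply not_0_INR; lia).
  assert (HqC : RtoC (INR q) <> RtoC 0) by (intros E; apply HqR; apply (f_equal fst) in E; exact E).
  rewrite <- (csum_char_shift q chi (fun h => RtoC (sin (2 * PI * INR h / INR q * INR d)))) by (auto; lia).
  pose proof (char_fourier q chi d H Hp) as E.
  assert (Ez : forall h, Cconj (zeta q (d * h)) = (RtoC (cos (2 * PI * INR h / INR q * INR d)) - Ci * RtoC (sin (2 * PI * INR h / INR q * INR d)))%C).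
  { intros h. unfold zeta. rewrite Cexp_imag, mult_INR.
    replace (2 * PI * (INR d * INR h) / INR q) with (2 * PI * INR h / INR q * INR d) by (field; exact HqR).
    unfold Cconj, Ci, RtoC, Cminus, Cmult, Cplus, Copp; simpl. f_equal; ring. }
  rewrite (csum_ext _ (fun h => Cconj (chi h) * RtoC (cos (2 * PI * INR h / INR q * INR d)) + - Ci * (Cconj (chi h) * RtoC (sin (2 * PI * INR h / INR q * INR d))))%C) in E.
  2:{ intros h _. rewrite Ez. ring. }
  rewrite csum_plus, csum_scal in E.
  assert (Ecos : csum (fun h => Cconj (chi h) * RtoC (cos (2 * PI * INR h / INR q * INR d)))%C q = RtoC 0).
  (* Residues summing to a multiple of [q] have equal cosines. Periodicity follows by applying this
     twice, through [q - h mod q], and evenness by applying it once. *)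
  { assert (Hc : forall a b c : nat, (a + b = c * q)%nat -> cos (2 * PI * INR a / INR q * INR d) = cos (2 * PI * INR b / INR q * INR d)).
    { intros a b c Eab. assert (EI : INR a = INR c * INR q - INR b) by (rewrite <- mult_INR, <- Eab, plus_INR; ring).
      rewrite EI. replace (2 * PI * (INR c * INR q - INR b) / INR q * INR d) with (- (2 * PI * INR b / INR q * INR d) + 2 * INR (c * d) * PI) by (rewrite mult_INR; field; exact HqR).
      rewrite cos_period. apply cos_neg. }
    apply (odd_char_csum_even q chi (fun h => RtoC (cos (2 * PI * INR h / INR q * INR d))) H Ho).
    - intros h. f_equal.
      transitivity (cos (2 * PI * INR (q - h mod q) / INR q * INR d)).
      + apply (Hc _ _ 1%nat). pose proof (Nat.mod_upper_bound h q ltac:(lia)). lia.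
      + apply (Hc _ _ (S (h / q))). pose proof (Nat.mod_upper_bound h q ltac:(lia)).
        pose proof (Nat.div_mod h q ltac:(lia)). nia.
    - intros h. f_equal. apply (Hc _ _ h). nia. }
  rewrite Ecos in E.
  transitivity ((RtoC (INR q) * chi d) / RtoC (INR q))%C; [field; exact HqC|].
  rewrite E. field. exact HqC.
Qed.

(** * Dirichlet convolutions *)

Lemma divsum_csum n f X : (n <= X)%nat -> (0 < n)%nat ->
  divsum n f = csum (fun i => if Nat.eqb (n mod S i) 0 then f (S i) else RtoC 0) X.
Proof.
  intros HX Hn. unfold divsum.
  assert (E : forall l, fold_right Cplus (RtoC 0) (map f (filter (fun d => Nat.eqb (n mod d) 0) l))
    = fold_right Cplus (RtoC 0) (map (fun d => if Nat.eqb (n mod d) 0 then f d else RtoC 0) l)).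
  { induction l as [|d l IH]; [reflexivity|]. cbn [filter map fold_right].
    destruct (Nat.eqb (n mod d) 0); cbn [map fold_right]; rewrite IH; ring. }
  rewrite E, csum_fold. replace X with (n + (X - n))%nat by lia. rewrite csum_split.
  rewrite (csum_ext (fun i => if Nat.eqb (n mod S (n + i)) 0 then f (S (n + i)) else RtoC 0) (fun _ => RtoC 0)).
  - rewrite csum_zero, Cplus_0_r. reflexivity.
  - intros i _. rewrite Nat.mod_small by lia. destruct (Nat.eqb_spec n 0); [lia|reflexivity].
Qed.

(** All indices are shifted by one, so [S n] runs over [1 .. X]. The quotients of the multiples of
    [S d] are recorded by a test over the full range of [j]; this keeps the double sum rectangular,
    so that its order can be exchanged. *)
Lemma csum_multiples (b : nat -> C) d X :
  csum (fun n => if Nat.eqb (S n mod S d) 0 then b (S n / S d)%nat else RtoC 0) X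
  = csum (fun j => if Nat.leb (S d * S j) X then b (S j) else RtoC 0) X.
Proof.
  assert (E : forall Y, csum (fun n => if Nat.eqb (S n mod S d) 0 then b (S n / S d)%nat else RtoC 0) Y
    = csum (fun j => b (S j)) (Y / S d)).
  { induction Y as [|Y IH]; [rewrite Nat.Div0.div_0_l; reflexivity|].
    cbn [csum]. rewrite IH.
    pose proof (Nat.div_mod Y (S d) ltac:(lia)) as E1.
    pose proof (Nat.mod_upper_bound Y (S d) ltac:(lia)) as E2.
    destruct (Nat.eq_dec (Y mod S d) d) as [e|e].
    - assert (EY : S Y = ((S (Y / S d)) * S d)%nat) by nia.
      rewrite EY. rewrite Nat.Div0.mod_mul, Nat.div_mul by lia. reflexivity.
    - assert (Em : (S Y mod S d)%nat = S (Y mod S d)).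
      { symmetry. apply (Nat.mod_unique _ _ (Y / S d)); lia. }
      assert (Ed : (S Y / S d)%nat = (Y / S d)%nat).
      { symmetry. apply (Nat.div_unique _ _ _ (S (Y mod S d))); lia. }
      rewrite Em, Ed. cbn [Nat.eqb]. ring. }
  rewrite E.
  assert (Hle : (X / S d <= X)%nat) by (apply Nat.Div0.div_le_upper_bound; nia).
  transitivity (csum (fun j => if Nat.leb (S d * S j) X then b (S j) else RtoC 0) (X / S d + (X - X / S d)));
    [|f_equal; lia].
  rewrite csum_split.
  pose proof (Nat.div_mod X (S d) ltac:(lia)) as E1.
  pose proof (Nat.mod_upper_bound X (S d) ltac:(lia)) as E2.
  rewrite (csum_ext (fun i => if Nat.leb (S d * S (X / S d + i)) X then b (S (X / S d + i)) else RtoC 0) (fun _ => RtoC 0)).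
  2:{ intros i _. destruct (Nat.leb_spec (S d * S (X / S d + i)) X); [nia|reflexivity]. }
  rewrite csum_zero, Cplus_0_r. apply csum_ext. intros j Hj.
  destruct (Nat.leb_spec (S d * S j) X); [reflexivity|nia].
Qed.

(** Divisor sums up to [X] enumerate the pairs under the hyperbola [i j <= X]. *)
Lemma csum_divsum (a : nat -> nat -> C) X :
  csum (fun n => divsum (S n) (fun d => a d (S n / d)%nat)) X
  = csum (fun i => csum (fun j => if Nat.leb (S i * S j) X then a (S i) (S j) else RtoC 0) X) X.
Proof.
  rewrite (csum_ext _ (fun n => csum (fun i => if Nat.eqb (S n mod S i) 0 then a (S i) (S n / S i)%nat else RtoC 0) X)).
  2:{ intros n Hn. apply divsum_csum; lia. }
  rewrite csum_swap. apply csum_ext. intros i _. apply csum_multiples.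
Qed.

Lemma Clim_Cmod_le u l v K N : Clim u l -> (forall n, (N <= n)%nat -> Cmod (u n - v)%C <= K) -> Cmod (l - v)%C <= K.
Proof.
  intros Hu Hb.
  assert (H : is_lim_seq (fun n => Cmod (u n - l)%C + K) (0 + K)).
  { apply is_lim_seq_plus'; [exact Hu|apply is_lim_seq_const]. }
  rewrite Rplus_0_l in H.
  refine (is_lim_seq_le_loc (fun _ => Cmod (l - v)%C) _ (Finite _) (Finite K) _ (is_lim_seq_const _) H).
  exists N. intros n Hn.
  replace (l - v)%C with (- (u n - l) + (u n - v))%C by ring.
  eapply Rle_trans; [apply Cmod_triangle|]. rewrite Cmod_opp. specialize (Hb n Hn). lra.
Qed.

Lemma is_lim_seq_inv_S (K : R) : is_lim_seq (fun X => K / INR (S X)) 0.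
Proof.
  replace (Finite 0) with (Rbar_mult K (Finite 0)) by (simpl; f_equal; ring).
  apply (is_lim_seq_scal_l (fun J => / INR (S J)) K 0).
  apply (is_lim_seq_incr_1 (fun J => / INR J)).
  replace (Finite 0) with (Rbar_inv p_infty) by reflexivity.
  apply is_lim_seq_inv; [apply is_lim_seq_INR|discriminate].
Qed.

(** The hyperbolic and the iterated sums differ only in pairs with [i j > X]. There the factor
    [1 / (i j)] of the bound is at most [1 / (X + 1)], and the rest is summable in each variable, so
    the error is at most [KA * KB / (X + 1)]. *)
Lemma dirichlet_rearrange (a : nat -> nat -> C) (A B : nat -> R) KA KB (r : nat -> C) R0 :
  (forall i, 0 <= A i) -> (forall i, 0 <= B i) ->
  (forall n, rsum A n <= KA) -> (forall n, rsum B n <= KB) ->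
  (forall i j, Cmod (a (S i) (S j)) <= A i * B j / INR (S i * S j)) ->
  (forall i, Clim (csum (fun j => a (S i) (S j))) (r i)) -> Clim (csum r) R0 ->
  Clim (csum (fun n => divsum (S n) (fun d => a d (S n / d)%nat))) R0.
Proof.
  intros HA HB HKA HKB Hab Hr HR.
  assert (HKA0 : 0 <= KA) by (apply (HKA O)). assert (HKB0 : 0 <= KB) by (apply (HKB O)).
  apply (Clim_ext (fun X => csum r X + (csum (fun n => divsum (S n) (fun d => a d (S n / d)%nat)) X - csum r X))%C); [intros; ring|].
  replace R0 with (R0 + RtoC 0)%C by ring. apply Clim_plus; [exact HR|].
  apply (Clim_bound _ _ (fun X => (KA * KB) / INR (S X))); [|apply is_lim_seq_inv_S].
  intros X. pose proof (INR_S_pos X) as HX.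
  replace (csum (fun n => divsum (S n) (fun d => a d (S n / d)%nat)) X - csum r X - RtoC 0)%C
    with (csum (fun n => divsum (S n) (fun d => a d (S n / d)%nat)) X - csum r X)%C by ring.
  rewrite csum_divsum, <- csum_minus.
  eapply Rle_trans; [apply Cmod_csum|].
  eapply Rle_trans; [apply (rsum_le _ (fun i => (KB / INR (S X)) * A i))|].
  2:{ rewrite rsum_scal. unfold Rdiv.
      replace (KA * KB * / INR (S X)) with (KB * / INR (S X) * KA) by ring.
      apply Rmult_le_compat_l; [apply Rmult_le_pos; [lra|left; apply Rinv_0_lt_compat, HX]|apply HKA]. }
  intros i _.
  match goal with |- Cmod (?v - ?w)%C <= _ => replace (v - w)%C with (- (w - v))%C by ring end.
  rewrite Cmod_opp.
  (* The row sum [r i] is only known as a limit, so the difference is estimated on its partial sums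
     of length [n >= X], split at [X]. *)
  apply (Clim_Cmod_le _ _ _ _ X (Hr i)). intros n Hn.
  replace n with (X + (n - X))%nat by lia. set (m := (n - X)%nat).
  rewrite csum_split.
  match goal with |- Cmod (?u + ?v - ?w)%C <= _ => replace (u + v - w)%C with ((u - w) + v)%C by ring end.
  rewrite <- csum_minus.
  eapply Rle_trans; [apply Cmod_triangle|].
  assert (Hterm : forall j, (X < S i * S j)%nat -> Cmod (a (S i) (S j)) <= (A i / INR (S X)) * B j).
  { intros j Hj. eapply Rle_trans; [apply Hab|].
    unfold Rdiv. replace (A i * / INR (S X) * B j) with (A i * B j * / INR (S X)) by ring.
    apply Rmult_le_compat_l; [apply Rmult_le_pos; auto|]. apply Rinv_le_contravar; [exact HX|apply le_INR; lia]. }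
  assert (HAX : 0 <= A i / INR (S X)) by (apply Rdiv_le_0_compat; auto).
  eapply Rle_trans; [apply Rplus_le_compat|].
  - eapply Rle_trans; [apply Cmod_csum|]. apply (rsum_le _ (fun j => (A i / INR (S X)) * B j)).
    intros j _. destruct (Nat.leb_spec (S i * S j) X) as [h|h].
    + replace (a (S i) (S j) - a (S i) (S j))%C with (RtoC 0) by ring. rewrite Cmod_0.
      apply Rmult_le_pos; auto.
    + replace (a (S i) (S j) - RtoC 0)%C with (a (S i) (S j)) by ring. apply Hterm. exact h.
  - eapply Rle_trans; [apply Cmod_csum|]. apply (rsum_le _ (fun j => (A i / INR (S X)) * B (X + j)%nat)).
    intros j _. apply Hterm. nia.
  - rewrite !rsum_scal, <- Rmult_plus_distr_l, <- rsum_split.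
    replace (KB / INR (S X) * A i) with (A i / INR (S X) * KB) by (field; lra).
    apply Rmult_le_compat_l; [exact HAX|apply HKB].
Qed.

Lemma dirichlet_rearrange_flip (a : nat -> nat -> C) (A B : nat -> R) KA KB (r : nat -> C) R0 :
  (forall i, 0 <= A i) -> (forall i, 0 <= B i) ->
  (forall n, rsum A n <= KA) -> (forall n, rsum B n <= KB) ->
  (forall i j, Cmod (a (S i) (S j)) <= A i * B j / INR (S i * S j)) ->
  (forall j, Clim (csum (fun i => a (S i) (S j))) (r j)) -> Clim (csum r) R0 ->
  Clim (csum (fun n => divsum (S n) (fun d => a d (S n / d)%nat))) R0.
Proof.
  intros HA HB HKA HKB Hab Hr HR.
  eapply Clim_ext; [|apply (dirichlet_rearrange (fun m d => a d m) B A KB KA r R0); auto].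
  - intros X. rewrite (csum_divsum a), (csum_divsum (fun m d => a d m)), csum_swap. apply csum_ext. intros i _. apply csum_ext. intros j _.
    rewrite Nat.mul_comm. reflexivity.
  - intros i j. rewrite Nat.mul_comm, (Rmult_comm (B i)). apply Hab.
Qed.

Definition rdivsum (n : nat) (f : nat -> R) : R :=
  rsum (fun i => if Nat.eqb (n mod S i) 0 then f (S i) else 0) n.

Lemma Cmod_divsum n f g : (0 < n)%nat -> (forall d, (0 < d)%nat -> Nat.divide d n -> Cmod (f d) <= g d) ->
  Cmod (divsum n f) <= rdivsum n g.
Proof.
  intros Hn Hfg. rewrite (divsum_csum n f n) by lia.
  eapply Rle_trans; [apply Cmod_csum|]. apply rsum_le. intros i _.
  destruct (Nat.eqb_spec (n mod S i) 0) as [e|e].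
  - apply Hfg; [lia|]. apply Nat.Lcm0.mod_divide. exact e.
  - rewrite Cmod_0. lra.
Qed.

Lemma divsum_RtoC n f : (0 < n)%nat -> divsum n (fun d => RtoC (f d)) = RtoC (rdivsum n f).
Proof.
  intros Hn. rewrite (divsum_csum n _ n) by lia. unfold rdivsum. rewrite <- csum_RtoC.
  apply csum_ext. intros i _. destruct (Nat.eqb _ _); reflexivity.
Qed.

Lemma rsum_rdivsum_le (A B : nat -> R) X :
  (forall i, 0 <= A i) -> (forall i, 0 <= B i) ->
  rsum (fun n => rdivsum (S n) (fun d => A d * B (S n / d)%nat)) X
    <= rsum (fun i => A (S i)) X * rsum (fun j => B (S j)) X.
Proof.
  intros HA HB.
  assert (E : rsum (fun n => rdivsum (S n) (fun d => A d * B (S n / d)%nat)) X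
    = rsum (fun i => rsum (fun j => if Nat.leb (S i * S j) X then A (S i) * B (S j) else 0) X) X).
  { apply RtoC_inj. rewrite <- csum_RtoC.
    rewrite (csum_ext _ (fun n => divsum (S n) (fun d => RtoC (A d * B (S n / d)%nat)))).
    2:{ intros n _. symmetry. apply divsum_RtoC. lia. }
    rewrite (csum_divsum (fun d m => RtoC (A d * B m))). rewrite <- csum_RtoC.
    apply csum_ext. intros i _. rewrite <- csum_RtoC. apply csum_ext. intros j _. destruct (Nat.leb _ _); reflexivity. }
  rewrite E. rewrite Rmult_comm, <- rsum_scal. apply rsum_le. intros i _.
  rewrite Rmult_comm, <- rsum_scal. apply rsum_le. intros j _.
  destruct (Nat.leb _ _); [lra|apply Rmult_le_pos; auto].
Qed.

(** The integral test in telescoping form: by the mean value theorem [(x + 1) ^ (- 1 - e)] is at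
    most [(x ^ (- e) - (x + 1) ^ (- e)) / e]. *)
Lemma Rpower_sum_bound e : 0 < e -> forall n, rsum (fun i => Rpower (INR (S i)) (- (1 + e))) n <= 1 + / e.
Proof.
  intros He. assert (0 < / e) by (apply Rinv_0_lt_compat; lra).
  assert (H0 : forall n, rsum (fun i => Rpower (INR (S i)) (- (1 + e))) (S n) <= 1 + / e * (1 - Rpower (INR (S n)) (- e))).
  { induction n as [|n IH].
    - simpl. unfold Rpower. rewrite ln_1, !Rmult_0_r, exp_0. lra.
    - cbn [rsum] in *. set (x := INR (S n)) in *. assert (Hx : 0 < x) by apply INR_S_pos.
      assert (Ex : INR (S (S n)) = x + 1) by (unfold x; apply S_INR).
      rewrite Ex.
      assert (Hd : Rpower (x + 1) (- (1 + e)) <= / e * (Rpower x (- e) - Rpower (x + 1) (- e))).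
      { destruct (MVT_gen (fun t => Rpower t (- e)) x (x + 1) (fun t => - e * Rpower t (- (1 + e)))) as [c [Hc E]].
        - intros t Ht. rewrite Rmin_left, Rmax_right in Ht by lra.
          unfold Rpower. auto_derive; [lra|].
          replace (- (1 + e) * ln t) with (- e * ln t + - ln t) by ring. rewrite exp_plus, exp_Ropp, exp_ln by lra. field. lra.
        - intros t Ht. rewrite Rmin_left, Rmax_right in Ht by lra.
          apply continuity_pt_filterlim. apply (ex_derive_continuous (V := R_NormedModule) (fun t => Rpower t (- e)) t). unfold Rpower. auto_derive. lra.
        - rewrite Rmin_left, Rmax_right in Hc by lra.
          replace (Rpower x (- e) - Rpower (x + 1) (- e)) with (e * Rpower c (- (1 + e))).
          2:{ replace (e * Rpower c (- (1 + e))) with (- (- e * Rpower c (- (1 + e)) * (x + 1 - x))) by ring. rewrite <- E. ring. }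
          rewrite <- Rmult_assoc, Rinv_l, Rmult_1_l by lra.
          rewrite !Rpower_Ropp. apply Rinv_le_contravar; [apply exp_pos|].
          apply Rle_Rpower_l; lra. }
      lra. }
  intros [|n]; [simpl; lra|].
  eapply Rle_trans; [apply H0|]. assert (0 < Rpower (INR (S n)) (- e)) by apply exp_pos. nra.
Qed.

Lemma pow_exp_bounded n u : 0 < u -> exists K, 0 <= K /\ forall x, 0 <= x -> x ^ n * exp (- u * x) <= K.
Proof.
  intros Hu. destruct (ex_exp_C2_bound _ _ (ex_exp_C2_pow_exp n u Hu)) as [K [HK0 HK]].
  exists K. split; [exact HK0|]. intros x Hx. eapply Rle_trans; [apply Rle_abs|].
  eapply Rle_trans; [apply HK, Hx|].
  assert (exp (- (u / 2) * x) <= 1).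
  { rewrite <- exp_0. destruct (Req_dec x 0) as [->|]; [right; f_equal; ring|left; apply exp_increasing; nra]. }
  nra.
Qed.

(** * Character sums over blocks of length [q] *)

(** The values of an odd character sum to zero over a period, so the constant [b (j q + q)] may be
    subtracted throughout the [j]-th block, whose last position carries the character value 0. The
    resulting differences are the terms expanded by [geom_quot] and [cos_transform]. *)
Lemma csum_char_blocks q chi (b : nat -> R) N : dirichlet_char q chi -> odd_char q chi ->
  csum (fun n => Cconj (chi (S n)) * RtoC (b (S n)))%C (N * q)
  = csum (fun i => Cconj (chi (S i)) * RtoC (rsum (fun j => (b (j * q + S i)%nat - b (j * q + q)%nat)%R) N))%C (q - 1).
Proof.
  intros H Ho. pose proof (odd_char_gt_2 q chi H Ho) as Hq.
  rewrite csum_blocks.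
  rewrite (csum_ext (fun i => Cconj (chi (S i)) * RtoC (rsum (fun j => (b (j * q + S i)%nat - b (j * q + q)%nat)%R) N))%C
    (fun i => csum (fun j => Cconj (chi (S i)) * RtoC (b (j * q + S i)%nat - b (j * q + q)%nat))%C N)).
  2:{ intros i _. rewrite csum_scal, csum_RtoC. reflexivity. }
  rewrite (csum_swap (fun i j => Cconj (chi (S i)) * RtoC (b (j * q + S i)%nat - b (j * q + q)%nat))%C).
  apply csum_ext. intros j _.
  transitivity (csum (fun h => Cconj (chi (S (j * q + h))) * RtoC (b (S (j * q + h))))%C (S (q - 1))); [f_equal; lia|].
  cbn [csum].
  assert (E0 : chi (S (j * q + (q - 1))) = RtoC 0).
  { replace (S (j * q + (q - 1))) with (S j * q + 0)%nat by lia. rewrite (char_add_mul q chi 0 (S j) H).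
    destruct H as [_ [_ [_ [_ H0]]]]. apply H0. simpl. lia. }
  rewrite E0. replace (Cconj (RtoC 0)) with (RtoC 0) by (unfold Cconj, RtoC; simpl; f_equal; ring).
  rewrite (csum_ext (fun i => Cconj (chi (S i)) * RtoC (b (j * q + S i)%nat - b (j * q + q)%nat))%C
    (fun i => Cconj (chi (S (j * q + i))) * RtoC (b (S (j * q + i))) - RtoC (b (j * q + q)%nat) * Cconj (chi (S i)))%C).
  - rewrite csum_minus, csum_scal, csum_conj_char by assumption. ring.
  - intros i _. replace (S (j * q + i)) with (j * q + S i)%nat by lia.
    rewrite (char_add_mul q chi (S i) j H), RtoC_minus. ring.
Qed.

(** An unfinished block has fewer than [q] terms, each eventually below [eps / (2 q)]. *)
Lemma Clim_blocks (a : nat -> C) q l : (0 < q)%nat -> is_lim_seq (fun n => Cmod (a n)) 0 ->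
  Clim (fun N => csum a (N * q)) l -> Clim (csum a) l.
Proof.
  intros Hq Ha Hl. apply is_lim_seq_spec. intros eps.
  assert (He : 0 < eps / 2) by (pose proof (cond_pos eps); lra).
  assert (HqR : 0 < INR q) by (apply lt_0_INR; lia).
  assert (He' : 0 < eps / 2 / INR q) by (apply Rdiv_lt_0_compat; lra).
  destruct (proj2 (is_lim_seq_spec _ _) Hl (mkposreal _ He)) as [N1 HN1].
  destruct (proj2 (is_lim_seq_spec _ _) Ha (mkposreal _ He')) as [N2 HN2].
  exists ((N1 + N2 + 1) * q)%nat. intros n Hn.
  rewrite Rminus_0_r, Rabs_pos_eq by apply Cmod_ge_0.
  pose proof (Nat.div_mod n q ltac:(lia)) as E. pose proof (Nat.mod_upper_bound n q ltac:(lia)) as E'.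
  assert (Hnq : (N1 + N2 + 1 <= n / q)%nat) by (apply Nat.div_le_lower_bound; lia).
  rewrite E, Nat.mul_comm, csum_split.
  set (N := (n / q)%nat) in *. set (m := (n mod q)%nat) in *.
  replace (csum a (N * q) + csum (fun i => a (N * q + i)%nat) m - l)%C with ((csum a (N * q) - l) + csum (fun i => a (N * q + i)%nat) m)%C by ring.
  eapply Rle_lt_trans; [apply Cmod_triangle|].
  specialize (HN1 N ltac:(lia)). simpl in HN1. rewrite Rminus_0_r, Rabs_pos_eq in HN1 by apply Cmod_ge_0.
  assert (HB : Cmod (csum (fun i => a (N * q + i)%nat) m) <= eps / 2).
  { eapply Rle_trans; [apply Cmod_csum|].
    eapply Rle_trans; [apply (rsum_le _ (fun _ => (eps / 2 / INR q) * 1))|].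
    - intros i _. specialize (HN2 (N * q + i)%nat ltac:(nia)). simpl in HN2.
      rewrite Rminus_0_r, Rabs_pos_eq in HN2 by apply Cmod_ge_0. lra.
    - rewrite rsum_scal.
      assert (E1 : forall n, rsum (fun _ => 1) n = INR n) by (induction n0; [reflexivity|cbn [rsum]; rewrite IHn0, S_INR; ring]).
      rewrite E1. apply lt_INR in E'. pose proof (pos_INR m).
      replace (eps / 2) with (eps / 2 / INR q * INR q) at 2 by (field; lra).
      apply Rmult_le_compat_l; lra. }
  lra.
Qed.

Lemma Clim_char_blocks q chi (b : nat -> R) (l : nat -> R) : dirichlet_char q chi -> odd_char q chi ->
  is_lim_seq b 0 ->
  (forall i, (i < q - 1)%nat -> is_lim_seq (fun N => rsum (fun j => (b (j * q + S i)%nat - b (j * q + q)%nat)%R) N) (l i)) ->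
  Clim (csum (fun n => Cconj (chi (S n)) * RtoC (b (S n)))%C) (csum (fun i => Cconj (chi (S i)) * RtoC (l i))%C (q - 1)).
Proof.
  intros H Ho Hb Hl. apply Clim_blocks with q; [apply H| |].
  - apply is_lim_seq_le_le with (u := fun _ => 0) (w := fun n => Rabs (b (S n))).
    + intros n. split; [apply Cmod_ge_0|]. rewrite Cmod_mult, Cmod_conj, Cmod_R.
      pose proof (char_Cmod_le q chi (S n) H). pose proof (Rabs_pos (b (S n))). nra.
    + apply is_lim_seq_const.
    + apply (is_lim_seq_incr_1 (fun n => Rabs (b n))). replace (Finite 0) with (Rbar_abs 0) by (simpl; rewrite Rabs_R0; reflexivity).
      apply is_lim_seq_abs, Hb.
  - eapply Clim_ext; [intros N; symmetry; apply csum_char_blocks; assumption|].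
    apply (Clim_csum (fun N i => Cconj (chi (S i)) * RtoC (rsum (fun j => (b (j * q + S i)%nat - b (j * q + q)%nat)%R) N))%C (fun i => Cconj (chi (S i)) * RtoC (l i))%C).
    intros i Hi. apply Clim_scal, Clim_RtoC, Hl, Hi.
Qed.

Lemma char_geom_series q chi z : dirichlet_char q chi -> odd_char q chi -> 0 < z < 1 ->
  Clim (csum (fun n => Cconj (chi (S n)) * RtoC (z ^ S n))%C)
    (csum (fun i => Cconj (chi (S i)) * RtoC (geom_quot q (S i) z))%C (q - 1)).
Proof.
  intros H Ho Hz. pose proof (odd_char_gt_2 q chi H Ho) as Hq.
  assert (Hg : is_lim_seq (fun n => z ^ n) 0) by (apply is_lim_seq_geom; rewrite Rabs_pos_eq; lra).
  apply (Clim_char_blocks q chi (fun n => z ^ n) (fun i => geom_quot q (S i) z) H Ho Hg).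
  intros i Hi.
  apply (is_lim_seq_ext (fun N => geom_quot q (S i) z - z ^ (N * q) * geom_quot q (S i) z)).
  - intros N. rewrite (geom_quot_expand q (S i) z N) at 1 by (try lia; lra). ring.
  - replace (Finite (geom_quot q (S i) z)) with (Finite (geom_quot q (S i) z - 0 * geom_quot q (S i) z)) by (f_equal; ring).
    apply is_lim_seq_minus'; [apply is_lim_seq_const|].
    apply is_lim_seq_mult'; [|apply is_lim_seq_const].
    apply (is_lim_seq_subseq (fun n => z ^ n) 0 (fun N => (N * q)%nat)); [|exact Hg].
    intros P [N0 HN0]. exists N0. intros n Hn. apply HN0. nia.
Qed.

Lemma is_lim_seq_laplace_0 k c : 0 < c -> is_lim_seq (fun n => fst (laplace k (c * INR n) 0)) 0.
Proof.
  intros Hc. apply is_lim_seq_incr_1.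
  apply is_lim_seq_le_le with (u := fun _ => 0) (w := fun n => (INR (fact k) / c ^ S k) / INR (S n)).
  - intros n. pose proof (INR_S_pos n) as Hn. assert (1 <= INR (S n)) by (apply (le_INR 1); lia).
    rewrite laplace_0 by (apply Rmult_lt_0_compat; lra). cbn [fst].
    assert (Hf : 0 < INR (fact k)) by apply INR_fact_lt_0.
    assert (Hck : 0 < c ^ S k) by (apply pow_lt; lra).
    rewrite Rpow_mult_distr. assert (Hp : INR (S n) <= INR (S n) ^ S k).
    { rewrite <- tech_pow_Rmult. rewrite <- (Rmult_1_r (INR (S n))) at 1. apply Rmult_le_compat_l; [lra|]. apply pow_R1_Rle; lra. }
    split.
    + apply Rdiv_le_0_compat; [lra|]. apply Rmult_lt_0_compat; lra.
    + unfold Rdiv. rewrite Rinv_mult, <- Rmult_assoc. apply Rmult_le_compat_l.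
      * apply Rmult_le_pos; [lra|left; apply Rinv_0_lt_compat; lra].
      * apply Rinv_le_contravar; lra.
  - apply is_lim_seq_const.
  - apply is_lim_seq_inv_S.
Qed.

Lemma RtoC_neq_0 x : x <> 0 -> RtoC x <> RtoC 0.
Proof. intros H E. apply H. apply (f_equal fst) in E. exact E. Qed.

(** At frequency 0 the Laplace transforms are [k! / (c n) ^ (k + 1)], so the block sums are partial
    sums of the Dirichlet series. Blocks respect the order of summation, which matters for [k = 0],
    where convergence is not absolute. *)
Lemma Lfun_conj_char q chi k c : dirichlet_char q chi -> odd_char q chi -> 0 < c ->
  csum (fun i => Cconj (chi (S i)) * RtoC (cos_transform k q (S i) c 0))%C (q - 1)
  = (RtoC (INR (fact k) / c ^ S k) * Lfun (k + 1) (conj_char chi))%C.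
Proof.
  intros H Ho Hc. pose proof (odd_char_gt_2 q chi H Ho) as Hq.
  assert (Hf : 0 < INR (fact k)) by apply INR_fact_lt_0.
  assert (Hck : 0 < c ^ S k) by (apply pow_lt; lra).
  set (V := csum (fun i => Cconj (chi (S i)) * RtoC (cos_transform k q (S i) c 0))%C (q - 1)).
  assert (HV : Clim (csum (fun n => Cconj (chi (S n)) * RtoC (fst (laplace k (c * INR (S n)) 0)))%C) V).
  { apply (Clim_char_blocks q chi (fun n => fst (laplace k (c * INR n) 0)) (fun i => cos_transform k q (S i) c 0) H Ho).
    - apply is_lim_seq_laplace_0, Hc.
    - intros i Hi. apply cos_transform_lim; [lia|lia|exact Hc]. }
  assert (HL : is_series (fun n => (conj_char chi (S n) / RtoC (INR (S n) ^ (k + 1)))%C) (RtoC (c ^ S k / INR (fact k)) * V)%C).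
  { apply is_series_Clim. eapply Clim_ext; [|apply (Clim_scal (RtoC (c ^ S k / INR (fact k))) _ _ HV)].
    intros N. cbv beta. rewrite <- csum_scal. apply csum_ext. intros n _.
    pose proof (INR_S_pos n) as Hn. rewrite laplace_0 by (apply Rmult_lt_0_compat; lra). cbn [fst].
    rewrite Rpow_mult_distr, Nat.add_1_r. unfold conj_char, Cdiv.
    assert (Hnk : 0 < INR (S n) ^ S k) by (apply pow_lt; lra).
    rewrite (Cmult_comm (RtoC _)), <- Cmult_assoc, <- RtoC_mult.
    rewrite <- RtoC_inv by lra. do 2 f_equal. field. lra. }
  unfold Lfun. rewrite (CSeries_eq _ _ HL). rewrite Cmult_assoc, <- RtoC_mult.
  replace (INR (fact k) / c ^ S k * (c ^ S k / INR (fact k))) with 1 by (field; lra). ring.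
Qed.

(** Inserting the sine expansion of [chi n] makes the series a finite combination of sawtooth series
    [sum sin (2 pi n x) / n = pi (1 / 2 - x)] at the points [x = h / q], which lie strictly between
    0 and 1. *)
Lemma Lfun_1_odd q chi : dirichlet_char q chi -> primitive_char q chi -> odd_char q chi ->
  Lfun 1 chi = (- Ci * gauss_sum q chi / RtoC (INR q) *
    csum (fun i => Cconj (chi (S i)) * RtoC (PI * (1 / 2 - INR (S i) / INR q))) (q - 1))%C.
Proof.
  intros H Hp Ho. pose proof (odd_char_gt_2 q chi H Ho) as Hq. pose proof PI_RGT_0.
  assert (HqR : 0 < INR q) by (apply lt_0_INR; lia).
  unfold Lfun. apply CSeries_eq, is_series_Clim.
  apply (Clim_ext (fun J => - Ci * gauss_sum q chi / RtoC (INR q) *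
    csum (fun i => Cconj (chi (S i)) * RtoC (PI * (bern1_rem J (INR (S i) / INR q) + (1 / 2 - INR (S i) / INR q)))) (q - 1))%C).
  - intros J.
    rewrite (csum_ext (fun n => (chi (S n) / RtoC (INR (S n) ^ 1))%C) (fun n => (- Ci * gauss_sum q chi / RtoC (INR q)) * csum (fun i => Cconj (chi (S i)) * RtoC (sin (2 * PI * INR (S i) / INR q * INR (S n)) / INR (S n))) (q - 1))%C).
    2:{ intros n _. pose proof (INR_S_pos n). rewrite (char_sin_sum q chi (S n)) by assumption.
        unfold Cdiv at 1. rewrite <- Cmult_assoc. f_equal. rewrite Cmult_comm, <- csum_scal. apply csum_ext. intros i _.
        rewrite pow_1, (RtoC_div _ (INR (S n))) by lra. unfold Cdiv. ring. }
    rewrite csum_scal. f_equal. rewrite csum_swap. apply csum_ext. intros i _.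
    rewrite csum_scal. f_equal. rewrite csum_RtoC. f_equal.
    unfold bern1_rem.
    transitivity (PI * rsum (fun j => sin (2 * PI * INR (S j) * (INR (S i) / INR q)) / (PI * INR (S j))) J); [field; lra|].
    rewrite <- rsum_scal. apply rsum_ext. intros j _. pose proof (INR_S_pos j).
    replace (2 * PI * INR (S j) * (INR (S i) / INR q)) with (2 * PI * INR (S i) / INR q * INR (S j)) by (field; lra).
    field. lra.
  - apply Clim_scal.
    apply (Clim_csum (fun J i => Cconj (chi (S i)) * RtoC (PI * (bern1_rem J (INR (S i) / INR q) + (1 / 2 - INR (S i) / INR q))))%C
      (fun i => Cconj (chi (S i)) * RtoC (PI * (1 / 2 - INR (S i) / INR q)))%C).
    intros i Hi. apply Clim_scal, Clim_RtoC.
    replace (PI * (1 / 2 - INR (S i) / INR q)) with (PI * (0 + (1 / 2 - INR (S i) / INR q))) by ring.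
    apply is_lim_seq_mult'; [apply is_lim_seq_const|]. apply is_lim_seq_plus'; [|apply is_lim_seq_const].
    apply bern1_rem_lim. pose proof (INR_S_pos i). assert (INR (S i) < INR q) by (apply lt_INR; lia).
    split; [apply Rdiv_lt_0_compat; lra|apply Rlt_div_l; lra].
Qed.

(** * The transformation formula of the Lambert series *)

Lemma laplace_opp k y w : fst (laplace k y (- w)) = fst (laplace k y w) /\ snd (laplace k y (- w)) = - snd (laplace k y w).
Proof.
  induction k as [|k [IH1 IH2]].
  - simpl. unfold Rdiv. replace (- w * (- w * 1)) with (w * (w * 1)) by ring. split; ring.
  - cbn [laplace]. destruct (laplace k y (- w)) as [a b]. destruct (laplace k y w) as [a' b'].
    cbn [fst snd] in *. subst a b. replace ((- w) ^ 2) with (w ^ 2) by ring. unfold Rdiv. split; ring.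
Qed.

Lemma ex_series_exp_C2 f d : 0 < d -> ex_exp_C2 d f -> ex_series (fun i => f (INR (S i))).
Proof.
  intros Hd Hf. destruct (ex_exp_C2_bound d f Hf) as [K [HK0 HK]].
  assert (Hr : 0 < exp (- d) < 1) by (split; [apply exp_pos|rewrite <- exp_0; apply exp_increasing; lra]).
  apply (ex_series_le (K := R_AbsRing) (V := R_CompleteNormedModule) (fun i => f (INR (S i))) (fun i => K * exp (- d) ^ S i)).
  - intros n. change (Rabs (f (INR (S n))) <= K * exp (- d) ^ S n). rewrite <- exp_mul_INR. apply HK, pos_INR.
  - apply (ex_series_ext (fun i => (K * exp (- d)) * exp (- d) ^ i)); [intros n; simpl; ring|].
    apply (ex_series_scal (K := R_AbsRing) (V := R_NormedModule) (K * exp (- d)) (fun i => exp (- d) ^ i)).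
    eexists. apply is_series_geom. rewrite Rabs_pos_eq; lra.
Qed.

Definition sin_coeff (k q : nat) (y : R) (n : nat) : R := snd (laplace k y (2 * PI * INR n / INR q)).

(** The product of sine and cosine splits the [j]-th transform into sine transforms at [w + 2 pi j]
    and [w - 2 pi j]. In units of [2 pi / q] these frequencies are [j q + h] and [- (j q - h)], and
    oddness in the frequency gives the minus sign. The boundary term at 0 vanishes with the sine. *)
Lemma sin_series_poisson k q h y : (1 <= h < q)%nat -> 0 < y ->
  exists s, is_series (fun d => INR (S d) ^ k * exp (- y * INR (S d)) * sin (2 * PI * INR h / INR q * INR (S d))) s /\
  is_lim_seq (fun J => sin_coeff k q y h + rsum (fun j => sin_coeff k q y (S j * q + h) - sin_coeff k q y (S j * q - h)) J) s.
Proof.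
  intros Hh Hy. set (w := 2 * PI * INR h / INR q).
  assert (HqR : 0 < INR q) by (apply lt_0_INR; lia).
  pose proof (ex_exp_C2_pow_exp_sin k y w Hy) as HC.
  assert (Hy2 : 0 < y / 2) by lra.
  assert (Hex : exists s : R, is_series (fun d => INR (S d) ^ k * exp (- y * INR (S d)) * sin (w * INR (S d))) s)
    by exact (ex_series_exp_C2 _ _ Hy2 HC).
  destruct Hex as [s Hs]. exists s. split; [exact Hs|].
  destruct HC as [f1 [f2 HC]].
  set (I := fun j => / 2 * snd (laplace k y (w + 2 * PI * INR j)) + / 2 * snd (laplace k y (w - 2 * PI * INR j))).
  assert (HI : forall j, is_RInt_gen (fun t => t ^ k * exp (- y * t) * sin (w * t) * cos (2 * PI * INR j * t)) (at_point 0) (Rbar_locally p_infty) (I j)).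
  { intros j. refine (is_RInt_gen_lin _ _ _ (/ 2) (/ 2) _ _ _ _ _ _ eq_refl
      (proj2 (is_RInt_gen_laplace k y (w + 2 * PI * INR j) Hy)) (proj2 (is_RInt_gen_laplace k y (w - 2 * PI * INR j) Hy))).
    intros t. rewrite Rmult_plus_distr_r, Rmult_minus_distr_r, sin_plus, sin_minus. field. }
  pose proof (half_line_poisson _ f1 f2 (y / 2) I s HC Hy2 HI Hs) as HP.  cbv beta in HP.
  replace (0 ^ k * exp (- y * 0) * sin (w * 0) / 2 + s) with s in HP by (rewrite (Rmult_0_r w), sin_0; field).
  eapply is_lim_seq_ext; [|exact HP]. intros J. cbv beta.
  assert (E0 : I O = sin_coeff k q y h).
  { unfold I, sin_coeff. fold w. simpl (INR 0). rewrite Rmult_0_r, Rplus_0_r, Rminus_0_r. field. }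
  rewrite E0. f_equal. rewrite <- rsum_scal. apply rsum_ext. intros j _.
  unfold I, sin_coeff.
  replace (2 * PI * INR (S j * q + h) / INR q) with (w + 2 * PI * INR (S j)) by (unfold w; rewrite plus_INR, mult_INR; field; lra).
  replace (2 * PI * INR (S j * q - h) / INR q) with (- (w - 2 * PI * INR (S j))) by (unfold w; rewrite minus_INR, mult_INR by nia; field; lra).
  rewrite (proj2 (laplace_opp k y (w - 2 * PI * INR (S j)))). field.
Qed.

(** The meeting point of the two Poisson summations: [laplace_swap] exchanges decay and frequency,
    and scaling by [2 pi / u] turns the new frequency [m u] into [2 pi m] and the new decay
    [2 pi n / q] into [4 pi ^ 2 n / (q u)]. *)
Lemma sin_coeff_laplace p q u m n : (0 < q)%nat -> (0 < n)%nat -> (0 < m)%nat -> 0 < u ->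
  sin_coeff (2 * p) q (INR m * u) n
  = (-1) ^ p * (2 * PI / u) ^ S (2 * p) * fst (laplace (2 * p) (4 * PI ^ 2 / (INR q * u) * INR n) (2 * PI * INR m)).
Proof.
  intros Hq Hn Hm Hu. pose proof PI_RGT_0.
  assert (HqR : 0 < INR q) by (apply lt_0_INR; lia).
  assert (HnR : 0 < INR n) by (apply lt_0_INR; lia).
  assert (HmR : 0 < INR m) by (apply lt_0_INR; lia).
  unfold sin_coeff. set (w := 2 * PI * INR n / INR q).
  assert (Hw : 0 < w) by (unfold w; apply Rdiv_lt_0_compat; [nra|lra]).
  assert (Hl : 0 < 2 * PI / u) by (apply Rdiv_lt_0_compat; lra).
  replace (4 * PI ^ 2 / (INR q * u) * INR n) with (2 * PI / u * w) by (unfold w; field; lra).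
  replace (2 * PI * INR m) with (2 * PI / u * (INR m * u)) by (field; lra).
  rewrite laplace_scal by assumption. cbn [fst].
  assert (Hmu : 0 < INR m * u) by (apply Rmult_lt_0_compat; lra).
  rewrite (laplace_swap p (INR m * u) w Hmu Hw). cbn [fst].
  assert (E : (-1) ^ p * (-1) ^ p = 1) by (rewrite <- Rpow_mult_distr; replace (-1 * -1) with 1 by ring; apply pow1).
  assert (Hlk : 0 < (2 * PI / u) ^ S (2 * p)) by (apply pow_lt; exact Hl).
  set (L := (2 * PI / u) ^ S (2 * p)) in *.
  transitivity ((-1) ^ p * (-1) ^ p * snd (laplace (2 * p) (INR m * u) w)); [rewrite E; ring|field; lra].
Qed.

(** The coefficients at [j q - h] belong to the residue [q - h]. Reflecting the residue and using
    oddness of [chi] cancels their minus sign, so they double the contribution of the coefficients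
    at [j q + h]; hence the factor 2. *)
Lemma lambert_inner p q chi u m : dirichlet_char q chi -> primitive_char q chi -> odd_char q chi ->
  0 < u -> (0 < m)%nat ->
  Clim (csum (fun d => RtoC (INR (S d) ^ (2 * p) * exp (- (INR m * u) * INR (S d))) * chi (S d))%C)
    (- Ci * gauss_sum q chi / RtoC (INR q) * RtoC (2 * ((-1) ^ p * (2 * PI / u) ^ S (2 * p)))
      * csum (fun i => Cconj (chi (S i)) * RtoC (cos_transform (2 * p) q (S i) (4 * PI ^ 2 / (INR q * u)) (2 * PI * INR m))) (q - 1))%C.
Proof.
  intros H Hp Ho Hu Hm. pose proof (odd_char_gt_2 q chi H Ho) as Hq. pose proof PI_RGT_0 as HPI.
  assert (HqR : 0 < INR q) by (apply lt_0_INR; lia).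
  assert (HmR : 0 < INR m) by (apply lt_0_INR; lia).
  set (k := (2 * p)%nat). set (y := INR m * u). assert (Hy : 0 < y) by (unfold y; apply Rmult_lt_0_compat; lra).
  set (c := 4 * PI ^ 2 / (INR q * u)).
  assert (Hc : 0 < c).
  { unfold c. apply Rdiv_lt_0_compat; [|apply Rmult_lt_0_compat; lra]. assert (0 < PI ^ 2) by (apply pow_lt; lra). lra. }
  set (kap := (-1) ^ p * (2 * PI / u) ^ S (2 * p)).
  set (al := sin_coeff k q y).
  (* Guarding the property by [1 <= h < q] makes [s] a total function, with 0 as a dummy value
     elsewhere. *)
  assert (Hex : forall h, exists s : R, (1 <= h < q)%nat ->
    is_series (fun d => INR (S d) ^ k * exp (- y * INR (S d)) * sin (2 * PI * INR h / INR q * INR (S d))) s /\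
    is_lim_seq (fun J => al h + rsum (fun j => al (S j * q + h)%nat - al (S j * q - h)%nat) J) s).
  { intros h. destruct (classic (1 <= h < q)%nat) as [Hh|Hh].
    - destruct (sin_series_poisson k q h y Hh Hy) as [s Hs]. exists s. intros _. exact Hs.
    - exists 0. intros Hh'. contradiction. }
  set (s := fun h => proj1_sig (constructive_indefinite_description _ (Hex h))).
  assert (Hs : forall h, (1 <= h < q)%nat ->
    is_series (fun d => INR (S d) ^ k * exp (- y * INR (S d)) * sin (2 * PI * INR h / INR q * INR (S d))) (s h) /\
    is_lim_seq (fun J => al h + rsum (fun j => al (S j * q + h)%nat - al (S j * q - h)%nat) J) (s h)).
  { intros h. exact (proj2_sig (constructive_indefinite_description _ (Hex h))). }
  clearbody s.
  set (X := fun N => csum (fun i => Cconj (chi (S i)) * RtoC (rsum (fun j => al (j * q + S i)%nat) N))%C (q - 1)).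
  set (W := csum (fun i => Cconj (chi (S i)) * RtoC (cos_transform k q (S i) c (2 * PI * INR m)))%C (q - 1)).
  assert (HX : Clim X (RtoC kap * W)%C).
  { set (b := fun n => fst (laplace k (c * INR n) (2 * PI * INR m))).
    (* Each [al] is [kap * b], and the terms [b (j q + q)] can be inserted because the weights
       [Cconj (chi (S i))] sum to zero. *)
    apply (Clim_ext (fun N => RtoC kap * csum (fun i => Cconj (chi (S i)) * RtoC (rsum (fun j => (b (j * q + S i)%nat - b (j * q + q)%nat)%R) N)) (q - 1))%C).
    - intros N. unfold X. rewrite <- csum_scal.
      rewrite (csum_ext _ (fun i => Cconj (chi (S i)) * RtoC (rsum (fun j => al (j * q + S i)%nat) N) - RtoC (rsum (fun j => (kap * b (j * q + q)%nat)%R) N) * Cconj (chi (S i)))%C).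
      + rewrite csum_minus, csum_scal, csum_conj_char by assumption. ring.
      + intros i Hi.
        rewrite (rsum_ext (fun j => al (j * q + S i)%nat) (fun j => kap * b (j * q + S i)%nat)).
        2:{ intros j _. unfold al, y, kap, b, k, c. apply sin_coeff_laplace; try lia; exact Hu. }
        rewrite !rsum_scal, (rsum_ext _ (fun j => b (j * q + S i)%nat + (-1) * b (j * q + q)%nat)) by (intros; ring).
        rewrite rsum_plus, rsum_scal, RtoC_plus, !RtoC_mult. ring.
    - apply Clim_scal. apply (Clim_csum (fun N i => Cconj (chi (S i)) * RtoC (rsum (fun j => (b (j * q + S i)%nat - b (j * q + q)%nat)%R) N))%C (fun i => Cconj (chi (S i)) * RtoC (cos_transform k q (S i) c (2 * PI * INR m)))%C).
      intros i Hi. apply Clim_scal, Clim_RtoC. apply cos_transform_lim; [lia|lia|exact Hc]. }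
  assert (HS : Clim (fun J => csum (fun i => Cconj (chi (S i)) * RtoC (al (S i) + rsum (fun j => (al (S j * q + S i)%nat - al (S j * q - S i)%nat)%R) J))%C (q - 1))
    (csum (fun i => Cconj (chi (S i)) * RtoC (s (S i)))%C (q - 1))).
  { apply (Clim_csum (fun J i => Cconj (chi (S i)) * RtoC (al (S i) + rsum (fun j => (al (S j * q + S i)%nat - al (S j * q - S i)%nat)%R) J))%C (fun i => Cconj (chi (S i)) * RtoC (s (S i)))%C).
    intros i Hi. apply Clim_scal, Clim_RtoC, Hs. lia. }
  assert (ES : csum (fun i => Cconj (chi (S i)) * RtoC (s (S i)))%C (q - 1) = (RtoC (2 * kap) * W)%C).
  { apply (Clim_unique _ _ _ HS).
    (* The indices [j q + h] start at [j = 0] and contribute [J + 1] terms per residue, the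
       reflected ones only [J]; both sums have the same limit. *)
    apply (Clim_ext (fun J => X (S J) + X J)%C).
    - intros J.
      rewrite (csum_ext _ (fun i => Cconj (chi (S i)) * RtoC (rsum (fun j => al (j * q + S i)%nat) (S J)) + - (Cconj (chi (S i)) * RtoC (rsum (fun j => al (S j * q - S i)%nat) J)))%C).
      + rewrite csum_plus. unfold X. f_equal.
        rewrite csum_rev. apply csum_ext. intros i Hi.
        replace (S (q - 1 - 1 - i)) with (q - S i)%nat by lia.
        rewrite (char_reflect q chi (S i)) by (auto; lia).
        rewrite (rsum_ext (fun j => al (j * q + (q - S i))%nat) (fun j => al (S j * q - S i)%nat)) by (intros; f_equal; nia).
        rewrite Copp_conj. ring.
      + intros i _. change (S J) with (1 + J)%nat. rewrite (rsum_split _ 1 J). cbn [rsum].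
        rewrite (rsum_ext (fun j => al (S j * q + S i)%nat - al (S j * q - S i)%nat) (fun j => al (S j * q + S i)%nat + (-1) * al (S j * q - S i)%nat)) by (intros; ring).
        rewrite rsum_plus, rsum_scal.
        change (fun i0 : nat => al ((1 + i0) * q + S i)%nat) with (fun j : nat => al (S j * q + S i)%nat).
        replace (al (0 * q + S i)%nat) with (al (S i)) by reflexivity.
        rewrite !RtoC_plus, !RtoC_mult. ring.
    - replace (RtoC (2 * kap) * W)%C with (RtoC kap * W + RtoC kap * W)%C by (rewrite (RtoC_mult 2); replace (RtoC 2) with (RtoC 1 + RtoC 1)%C by (rewrite <- RtoC_plus; f_equal; ring); ring).
      apply Clim_plus; [apply (Clim_incr_1 X)|]; exact HX. }
  match goal with |- Clim _ (?A * ?B * ?D)%C => replace (A * B * D)%C with (A * (RtoC (2 * kap) * W))%C by (rewrite Cmult_assoc; reflexivity) end.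
  rewrite <- ES.
  apply (Clim_ext (fun N => - Ci * gauss_sum q chi / RtoC (INR q) * csum (fun i => Cconj (chi (S i)) * RtoC (rsum (fun d => (INR (S d) ^ k * exp (- y * INR (S d)) * sin (2 * PI * INR (S i) / INR q * INR (S d)))%R) N)) (q - 1))%C).
  - intros N.
    rewrite (csum_ext (fun d => RtoC (INR (S d) ^ k * exp (- y * INR (S d))) * chi (S d))%C
      (fun d => (- Ci * gauss_sum q chi / RtoC (INR q)) * csum (fun i => Cconj (chi (S i)) * RtoC (INR (S d) ^ k * exp (- y * INR (S d)) * sin (2 * PI * INR (S i) / INR q * INR (S d)))) (q - 1))%C).
    2:{ intros d _. rewrite (char_sin_sum q chi (S d)) by assumption.
        rewrite Cmult_comm, <- Cmult_assoc. f_equal. rewrite Cmult_comm, <- csum_scal. apply csum_ext. intros i _.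
        rewrite (RtoC_mult (INR (S d) ^ k * exp (- y * INR (S d)))). ring. }
    rewrite csum_scal. f_equal. rewrite csum_swap. apply csum_ext. intros i _. rewrite csum_scal, csum_RtoC. reflexivity.
  - apply Clim_scal.
    apply (Clim_csum (fun N i => Cconj (chi (S i)) * RtoC (rsum (fun d => (INR (S d) ^ k * exp (- y * INR (S d)) * sin (2 * PI * INR (S i) / INR q * INR (S d)))%R) N))%C (fun i => Cconj (chi (S i)) * RtoC (s (S i)))%C).
    intros i Hi. apply Clim_scal, Clim_RtoC. apply is_series_rsum. apply Hs. lia.
Qed.

Lemma divsum_ext n f g : (0 < n)%nat -> (forall d, (0 < d)%nat -> Nat.divide d n -> f d = g d) -> divsum n f = divsum n g.
Proof.
  intros Hn H. rewrite !(divsum_csum n _ n) by lia. apply csum_ext. intros i _.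
  destruct (Nat.eqb_spec (n mod S i) 0) as [e|e]; [|reflexivity].
  apply H; [lia|]. apply Nat.Lcm0.mod_divide, e.
Qed.

Lemma divsum_scal n c f : (0 < n)%nat -> (divsum n f * c)%C = divsum n (fun d => f d * c)%C.
Proof.
  intros Hn. rewrite !(divsum_csum n _ n) by lia. rewrite Cmult_comm, <- csum_scal. apply csum_ext. intros i _.
  destruct (Nat.eqb (n mod S i) 0); ring.
Qed.

Lemma INR_divide d n : (0 < d)%nat -> Nat.divide d n -> INR n = INR d * INR (n / d).
Proof. intros Hd [m ->]. rewrite Nat.div_mul, mult_INR by lia. ring. Qed.

(** The exponent [k + 3] pays for the factor [INR (S i) ^ k], for a summable weight of exponent
    [- 2] in each variable, and for the factor [1 / (i j)] demanded by the rearrangement. *)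
Lemma exp_convolution_bound k u : 0 < u -> exists K, 0 <= K /\ forall i j,
  INR (S i) ^ k * exp (- u * (INR (S i) * INR (S j)))
    <= (K * Rpower (INR (S i)) (- (1 + 1))) * Rpower (INR (S j)) (- (1 + 1)) / INR (S i * S j).
Proof.
  intros Hu. destruct (pow_exp_bounded (k + 3) u Hu) as [K [HK0 HK]].
  exists K. split; [exact HK0|]. intros i j.
  pose proof (INR_S_pos i) as Hi. pose proof (INR_S_pos j) as Hj.
  assert (Hj1 : 1 <= INR (S j)) by (apply (le_INR 1); lia).
  rewrite mult_INR. set (x := INR (S i)) in *. set (y := INR (S j)) in *.
  assert (Er : forall z, 0 < z -> Rpower z (- (1 + 1)) = / z ^ 2).
  { intros z Hz. rewrite Rpower_Ropp. f_equal. replace (1 + 1) with (INR 2) by (simpl; ring). apply Rpower_pow, Hz. }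
  rewrite !Er by assumption.
  specialize (HK (x * y) ltac:(nra)).
  assert (Hxy : 0 < x ^ 2 * y ^ 2 * (x * y)).
  { repeat apply Rmult_lt_0_compat; lra. }
  replace (K * / x ^ 2 * / y ^ 2 / (x * y)) with (K / (x ^ 2 * y ^ 2 * (x * y))) by (field; lra).
  apply (proj1 (Rle_div_r _ _ _ Hxy)).
  eapply Rle_trans; [|exact HK].
  rewrite Rpow_mult_distr, !pow_add. pose proof (exp_pos (- u * (x * y))) as He.
  assert (Hxk : 0 < x ^ k) by (apply pow_lt; lra).
  assert (Hyk : 1 <= y ^ k) by (apply pow_R1_Rle; lra).
  replace (x ^ k * exp (- u * (x * y)) * (x ^ 2 * y ^ 2 * (x * y))) with (x ^ k * x ^ 3 * (1 * y ^ 3) * exp (- u * (x * y))) by ring.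
  apply Rmult_le_compat_r; [lra|].
  assert (0 < x ^ 3) by (apply pow_lt; lra). assert (0 < y ^ 3) by (apply pow_lt; lra).
  apply Rmult_le_compat_l; [nra|]. apply Rmult_le_compat_r; lra.
Qed.

(** The inner sum runs over the divisors, with the cofactor [S j] fixed, because the first Poisson
    summation acts on the divisor, which carries both the power and the character. *)
Lemma sigma_lambert k q chi u (r : nat -> C) R0 : dirichlet_char q chi -> 0 < u ->
  (forall j, Clim (csum (fun d => RtoC (INR (S d) ^ k * exp (- (INR (S j) * u) * INR (S d))) * chi (S d))%C) (r j)) ->
  Clim (csum r) R0 ->
  Clim (csum (fun n => sigma_char k chi (S n) * RtoC (exp (- u * INR (S n))))%C) R0.
Proof.
  intros H Hu Hr HR. destruct (exp_convolution_bound k u Hu) as [K [HK0 HK]].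
  set (P := fun i => Rpower (INR (S i)) (- (1 + 1))).
  assert (HP : forall i, 0 <= P i) by (intros; left; apply exp_pos).
  assert (HPs : forall n, rsum P n <= 1 + / 1) by (apply Rpower_sum_bound; lra).
  eapply Clim_ext; [|apply (dirichlet_rearrange_flip (fun d m => RtoC (INR d ^ k * exp (- u * (INR d * INR m))) * chi d)%C (fun i => K * P i) P (K * (1 + / 1)) (1 + / 1) r R0); auto].
  - intros N. apply csum_ext. intros n _. unfold sigma_char. rewrite divsum_scal by lia.
    apply divsum_ext; [lia|]. intros d Hd Hdn. rewrite (INR_divide d (S n) Hd Hdn), RtoC_mult. ring.
  - intros i. apply Rmult_le_pos; auto.
  - intros n. rewrite rsum_scal. apply Rmult_le_compat_l; auto.
  - intros i j. rewrite Cmod_mult, Cmod_R, Rabs_pos_eq.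
    + pose proof (char_Cmod_le q chi (S i) H). pose proof (Cmod_ge_0 (chi (S i))).
      eapply Rle_trans; [|apply HK].
      assert (0 <= INR (S i) ^ k * exp (- u * (INR (S i) * INR (S j)))) by (apply Rmult_le_pos; [apply pow_le, pos_INR|left; apply exp_pos]).
      nra.
    + apply Rmult_le_pos; [apply pow_le, pos_INR|left; apply exp_pos].
  - intros j. eapply Clim_ext; [|apply (Hr j)]. intros N. apply csum_ext. intros d _. do 4 f_equal. ring.
Qed.

(** Here the inner sum runs over the cofactor, which carries the character; it is a geometric
    character series, multiplied by the power of the divisor. *)
Lemma sigmabar_lambert k q chi u (r : nat -> C) R0 : dirichlet_char q chi -> 0 < u ->
  (forall i, Clim (csum (fun m => RtoC (INR (S i) ^ k) * (Cconj (chi (S m)) * RtoC (exp (- u * INR (S i)) ^ S m)))%C) (r i)) ->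
  Clim (csum r) R0 ->
  Clim (csum (fun n => sigmabar_char k (conj_char chi) (S n) * RtoC (exp (- u * INR (S n))))%C) R0.
Proof.
  intros H Hu Hr HR. destruct (exp_convolution_bound k u Hu) as [K [HK0 HK]].
  set (P := fun i => Rpower (INR (S i)) (- (1 + 1))).
  assert (HP : forall i, 0 <= P i) by (intros; left; apply exp_pos).
  assert (HPs : forall n, rsum P n <= 1 + / 1) by (apply Rpower_sum_bound; lra).
  eapply Clim_ext; [|apply (dirichlet_rearrange (fun d m => RtoC (INR d ^ k * exp (- u * (INR d * INR m))) * Cconj (chi m))%C (fun i => K * P i) P (K * (1 + / 1)) (1 + / 1) r R0); auto].
  - intros N. apply csum_ext. intros n _. unfold sigmabar_char, conj_char. rewrite divsum_scal by lia.
    apply divsum_ext; [lia|]. intros d Hd Hdn. rewrite (INR_divide d (S n) Hd Hdn), RtoC_mult. ring.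
  - intros i. apply Rmult_le_pos; auto.
  - intros n. rewrite rsum_scal. apply Rmult_le_compat_l; auto.
  - intros i j. rewrite Cmod_mult, Cmod_conj, Cmod_R, Rabs_pos_eq.
    + pose proof (char_Cmod_le q chi (S j) H). pose proof (Cmod_ge_0 (chi (S j))).
      eapply Rle_trans; [|apply HK].
      assert (0 <= INR (S i) ^ k * exp (- u * (INR (S i) * INR (S j)))) by (apply Rmult_le_pos; [apply pow_le, pos_INR|left; apply exp_pos]).
      nra.
    + apply Rmult_le_pos; [apply pow_le, pos_INR|left; apply exp_pos].
  - intros i. eapply Clim_ext; [|apply (Hr i)]. intros N. apply csum_ext. intros m _.
    rewrite <- exp_mul_INR, RtoC_mult. replace (- u * INR (S i) * INR (S m)) with (- u * (INR (S i) * INR (S m))) by ring. ring.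
Qed.

(** The inner sums are transforms at the frequencies [2 pi m] with [m >= 1], so twice their total is
    [f 0 / 2] plus the sum of [f] over positive integers minus the transform at 0. These three
    pieces give, in turn, the term with [L(1, chi)], the dual Lambert series, and the term with
    [L(k + 1, chibar)]. *)
Lemma lambert_transform p q chi u : dirichlet_char q chi -> primitive_char q chi -> odd_char q chi -> 0 < u ->
  exists SG,
  Clim (csum (fun n => sigmabar_char (2 * p) (conj_char chi) (S n) * RtoC (exp (- (4 * PI ^ 2 / (INR q * u)) * INR (S n))))%C) SG /\
  Clim (csum (fun n => sigma_char (2 * p) chi (S n) * RtoC (exp (- u * INR (S n))))%C)
   (RtoC (if Nat.eqb (2 * p) 0 then 1 else 0) * Lfun 1 chi * RtoC (/ u)
    + Ci * gauss_sum q chi * RtoC ((-1) ^ p * INR (fact (2 * p)) * INR q ^ (2 * p) / (2 * PI) ^ S (2 * p)) * Lfun (2 * p + 1) (conj_char chi)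
    - Ci * gauss_sum q chi * RtoC ((-1) ^ p * (2 * PI) ^ S (2 * p) / INR q * / u ^ S (2 * p)) * SG)%C.
Proof.
  intros H Hp Ho Hu. pose proof (odd_char_gt_2 q chi H Ho) as Hq. pose proof PI_RGT_0 as HPI.
  assert (HqR : 0 < INR q) by (apply lt_0_INR; lia).
  set (c := 4 * PI ^ 2 / (INR q * u)).
  assert (Hc : 0 < c).
  { unfold c. apply Rdiv_lt_0_compat; [|apply Rmult_lt_0_compat; lra]. assert (0 < PI ^ 2) by (apply pow_lt; lra). lra. }
  set (k := (2 * p)%nat).
  set (f := fun h t => t ^ k * geom_quot q h (exp (- c * t))).
  assert (Hc2 : 0 < c / 2) by lra.
  assert (Hex : forall h, exists s : R, (1 <= h < q)%nat -> is_series (fun i => f h (INR (S i))) s).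
  { intros h. destruct (classic (1 <= h < q)%nat) as [Hh|Hh].
    - destruct (ex_series_exp_C2 (f h) (c / 2) Hc2) as [s Hs]; [apply ex_exp_C2_pow_geom_quot; auto; lia|]. exists s. intros _. exact Hs.
    - exists 0. intros Hh'. contradiction. }
  set (s := fun h => proj1_sig (constructive_indefinite_description _ (Hex h))).
  assert (Hs : forall h, (1 <= h < q)%nat -> is_series (fun i => f h (INR (S i))) (s h)).
  { intros h. exact (proj2_sig (constructive_indefinite_description _ (Hex h))). }
  clearbody s.
  set (Rt := fun h m => cos_transform k q h c (2 * PI * INR m)).
  assert (HP : forall h, (1 <= h < q)%nat -> is_lim_seq (fun J => Rt h O + 2 * rsum (fun j => Rt h (S j)) J) (f h 0 / 2 + s h)).
  { intros h Hh. assert (Hx : ex_exp_C2 (c / 2) (f h)) by (apply ex_exp_C2_pow_geom_quot; auto; lia).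
    destruct Hx as [f1 [f2 Hx]].
    apply (half_line_poisson (f h) f1 f2 (c / 2) (Rt h) (s h) Hx Hc2); [|apply Hs, Hh].
    intros j. unfold Rt, f. apply is_RInt_gen_cos_transform; auto; lia. }
  set (chs := fun v : nat -> R => csum (fun i => Cconj (chi (S i)) * RtoC (v (S i)))%C (q - 1)).
  exists (chs s). split.
  - apply (sigmabar_lambert k q chi c (fun i => chs (fun h => f h (INR (S i)))) (chs s) H Hc).
    + intros i. set (z := exp (- c * INR (S i))).
      assert (Hz : 0 < z < 1).
      { unfold z. split; [apply exp_pos|]. rewrite <- exp_0. apply exp_increasing. pose proof (INR_S_pos i). nra. }
      apply (Clim_ext (fun N => RtoC (INR (S i) ^ k) * csum (fun m => Cconj (chi (S m)) * RtoC (z ^ S m)) N)%C).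
      * intros N. rewrite <- csum_scal. reflexivity.
      * replace (chs (fun h => f h (INR (S i)))) with (RtoC (INR (S i) ^ k) * csum (fun i => Cconj (chi (S i)) * RtoC (geom_quot q (S i) z)) (q - 1))%C.
        -- apply Clim_scal, char_geom_series; auto.
        -- unfold chs. rewrite <- csum_scal. apply csum_ext. intros j _. unfold f. fold z. rewrite RtoC_mult. ring.
    + apply (Clim_ext (fun N => csum (fun i => Cconj (chi (S i)) * RtoC (rsum (fun j => f (S i) (INR (S j))) N)) (q - 1))%C).
      * intros N. unfold chs. rewrite csum_swap. apply csum_ext. intros i _. rewrite csum_scal, csum_RtoC. reflexivity.
      * apply (Clim_csum (fun N i => Cconj (chi (S i)) * RtoC (rsum (fun j => f (S i) (INR (S j))) N))%C (fun i => Cconj (chi (S i)) * RtoC (s (S i)))%C).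
        intros i Hi. apply Clim_scal, Clim_RtoC, is_series_rsum, Hs. lia.
  - set (kap := (-1) ^ p * (2 * PI / u) ^ S k).
    set (G := (- Ci * gauss_sum q chi / RtoC (INR q))%C).
    apply (sigma_lambert k q chi u (fun j => G * RtoC (2 * kap) * chs (fun h => Rt h (S j)))%C _ H Hu).
    { intros j. apply (lambert_inner p q chi u (S j)); auto. lia. }
    assert (HL : Clim (csum (fun j => G * RtoC (2 * kap) * chs (fun h => Rt h (S j)))%C) (G * RtoC kap * chs (fun h => (f h 0 / 2 + s h - Rt h O)%R))%C).
    { apply (Clim_ext (fun N => G * RtoC kap * csum (fun i => Cconj (chi (S i)) * RtoC ((Rt (S i) O + 2 * rsum (fun j => Rt (S i) (S j)) N) - Rt (S i) O)) (q - 1))%C).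
      - intros N. rewrite csum_scal, RtoC_mult.
        transitivity (G * RtoC kap * (RtoC 2 * csum (fun j => chs (fun h => Rt h (S j))) N))%C; [|ring].
        f_equal. unfold chs. rewrite csum_swap, <- csum_scal. apply csum_ext. intros i _.
        rewrite csum_scal, csum_RtoC.
        replace (Rt (S i) O + 2 * rsum (fun j => Rt (S i) (S j)) N - Rt (S i) O) with (2 * rsum (fun j => Rt (S i) (S j)) N) by ring.
        rewrite RtoC_mult. ring.
      - apply Clim_scal.
        apply (Clim_csum (fun N i => Cconj (chi (S i)) * RtoC ((Rt (S i) O + 2 * rsum (fun j => Rt (S i) (S j)) N) - Rt (S i) O))%C (fun i => Cconj (chi (S i)) * RtoC (f (S i) 0 / 2 + s (S i) - Rt (S i) O))%C).
        intros i Hi. apply Clim_scal, Clim_RtoC. apply is_lim_seq_minus'; [apply HP; lia|apply is_lim_seq_const]. }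
    match goal with |- Clim _ ?T => replace T with (G * RtoC kap * chs (fun h => (f h 0 / 2 + s h - Rt h O)%R))%C; [exact HL|] end.
    assert (E1 : chs (fun h => (f h 0 / 2 + s h - Rt h O)%R) = (chs (fun h => (f h 0 / 2)%R) + chs s - chs (fun h => Rt h O))%C).
    { unfold chs. rewrite <- csum_plus, <- csum_minus. apply csum_ext. intros i _. rewrite RtoC_minus, RtoC_plus. ring. }
    rewrite E1.
    assert (E2 : chs (fun h => Rt h O) = (RtoC (INR (fact k) / c ^ S k) * Lfun (k + 1) (conj_char chi))%C).
    { rewrite <- (Lfun_conj_char q chi k c H Ho Hc). unfold chs, Rt. apply csum_ext. intros i _.
      simpl (INR 0). rewrite Rmult_0_r. reflexivity. }
    rewrite E2.
    assert (HqC : RtoC (INR q) <> RtoC 0) by (apply RtoC_neq_0; lra).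
    (* The factor [t ^ k] removes the value at 0 unless [k = 0]. Then that value is [1 - h / q],
       whose half differs from [1 / 2 - h / q] over 2 plus a constant only by terms free of [h], and
       the character annihilates constants; this matches the sawtooth values in [L(1, chi)]. *)
    assert (E3 : (G * RtoC kap * chs (fun h => (f h 0 / 2)%R))%C = (RtoC (if Nat.eqb k 0 then 1 else 0) * Lfun 1 chi * RtoC (/ u))%C).
    { destruct (Nat.eqb_spec k 0) as [e|e].
      - rewrite (Lfun_1_odd q chi H Hp Ho). fold G.
        assert (Ep : p = O) by (unfold k in e; lia).
        assert (Ek : kap = 2 * PI / u) by (unfold kap; rewrite e, Ep; simpl; ring).
        rewrite Ek.
        transitivity (G * (RtoC (2 * PI / u) * chs (fun h => (f h 0 / 2)%R)))%C; [ring|].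
        transitivity (G * (RtoC (/ u) * csum (fun i => Cconj (chi (S i)) * RtoC (PI * (1 / 2 - INR (S i) / INR q))) (q - 1)))%C; [|ring].
        f_equal.
        transitivity (csum (fun i => RtoC (/ u) * (Cconj (chi (S i)) * RtoC (PI * (1 / 2 - INR (S i) / INR q))) + RtoC (PI / (2 * u)) * Cconj (chi (S i)))%C (q - 1)).
        2:{ rewrite csum_plus, !csum_scal, csum_conj_char by assumption. ring. }
        unfold chs. rewrite <- csum_scal. apply csum_ext. intros i Hi.
        assert (Ef : f (S i) 0 = 1 - INR (S i) / INR q).
        { unfold f. rewrite e, Rmult_0_r, exp_0, geom_quot_1 by lia. simpl. ring. }
        rewrite Ef.
        transitivity (Cconj (chi (S i)) * RtoC (2 * PI / u * ((1 - INR (S i) / INR q) / 2)))%C; [rewrite RtoC_mult; ring|].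
        transitivity (Cconj (chi (S i)) * RtoC (/ u * (PI * (1 / 2 - INR (S i) / INR q)) + PI / (2 * u)))%C; [|rewrite RtoC_plus, RtoC_mult; ring].
        do 2 f_equal. field. lra.
      - assert (Ez : chs (fun h => (f h 0 / 2)%R) = RtoC 0).
        { unfold chs. rewrite <- (csum_zero (q - 1)). apply csum_ext. intros i _. unfold f. rewrite pow_i by lia.
          replace (0 * geom_quot q (S i) (exp (- c * 0)) / 2) with 0 by field. ring. }
        rewrite Ez. ring. }
    transitivity ((G * RtoC kap * chs (fun h => (f h 0 / 2)%R)) + G * RtoC kap * chs s - G * (RtoC kap * RtoC (INR (fact k) / c ^ S k)) * Lfun (k + 1) (conj_char chi))%C; [ring|].
    rewrite E3.
    assert (E4 : (G * RtoC kap)%C = (- (Ci * gauss_sum q chi * RtoC ((-1) ^ p * (2 * PI) ^ S k / INR q * / u ^ S k)))%C).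
    { unfold G. assert (Hk : 0 < u ^ S k) by (apply pow_lt; lra).
      replace kap with (INR q * ((-1) ^ p * (2 * PI) ^ S k / INR q * / u ^ S k)).
      - rewrite RtoC_mult. field. exact HqC.
      - assert (Ek : (2 * PI / u) ^ S k = (2 * PI) ^ S k * / u ^ S k)
          by (unfold Rdiv; rewrite (Rpow_mult_distr (2 * PI) (/ u)), pow_inv; reflexivity).
        unfold kap. rewrite Ek. field. lra. }
    assert (E5 : (G * (RtoC kap * RtoC (INR (fact k) / c ^ S k)))%C = (- (Ci * gauss_sum q chi * RtoC ((-1) ^ p * INR (fact k) * INR q ^ k / (2 * PI) ^ S k)))%C).
    { unfold G. rewrite <- RtoC_mult.
      replace (kap * (INR (fact k) / c ^ S k)) with (INR q * ((-1) ^ p * INR (fact k) * INR q ^ k / (2 * PI) ^ S k)).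
      - rewrite RtoC_mult. field. exact HqC.
      - unfold kap.
        assert (Ec : c = (2 * PI) * (2 * PI / u) * / INR q) by (unfold c; field; lra).
        assert (Hlam : 0 < 2 * PI / u) by (apply Rdiv_lt_0_compat; lra).
        rewrite Ec, !Rpow_mult_distr, pow_inv. set (lam := (2 * PI / u)) in *.
        assert (0 < lam ^ S k) by (apply pow_lt; lra). assert (0 < PI ^ S k) by (apply pow_lt; lra). assert (0 < 2 ^ S k) by (apply pow_lt; lra).
        assert (0 < INR q ^ S k) by (apply pow_lt; lra).
        rewrite <- (tech_pow_Rmult (INR q) k). assert (0 < INR q ^ k) by (apply pow_lt; lra).
        field. lra. }
    rewrite E4, E5. ring.
Qed.

(** * Complex powers of positive reals *)

Lemma Rcpow_pair x z : Rcpow x z =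
  (exp (Re z * ln x) * cos (Im z * ln x), exp (Re z * ln x) * sin (Im z * ln x)).
Proof.
  unfold Rcpow, Cexp. destruct z as [a b]. unfold Cmult, RtoC, Re, Im; simpl.
  replace (a * ln x - b * 0) with (a * ln x) by ring. replace (a * 0 + b * ln x) with (b * ln x) by ring. reflexivity.
Qed.

Lemma Cmod_Cexp z : Cmod (Cexp z) = exp (Re z).
Proof.
  unfold Cmod, Cexp; simpl.
  replace (exp (Re z) * cos (Im z) * (exp (Re z) * cos (Im z) * 1) + exp (Re z) * sin (Im z) * (exp (Re z) * sin (Im z) * 1))
    with ((exp (Re z))² * ((sin (Im z))² + (cos (Im z))²)) by (unfold Rsqr; ring).
  rewrite sin2_cos2, Rmult_1_r. apply sqrt_Rsqr. left; apply exp_pos.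
Qed.

Lemma Cmod_Rcpow x z : Cmod (Rcpow x z) = Rpower x (Re z).
Proof.
  unfold Rcpow. rewrite Cmod_Cexp. unfold Rpower. f_equal. destruct z; unfold Re, RtoC; simpl. ring.
Qed.

Lemma Rcpow_neq_0 x z : Rcpow x z <> RtoC 0.
Proof. apply Cmod_gt_0. rewrite Cmod_Rcpow. apply exp_pos. Qed.

Lemma Rcpow_plus x z w : Rcpow x (z + w)%C = (Rcpow x z * Rcpow x w)%C.
Proof. unfold Rcpow. rewrite Cmult_plus_distr_r. apply Cexp_plus. Qed.

Lemma Rcpow_0 x : Rcpow x (RtoC 0) = RtoC 1.
Proof. rewrite Rcpow_pair. simpl. rewrite !Rmult_0_l, exp_0, cos_0, sin_0. unfold RtoC. f_equal; ring. Qed.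

Lemma Rcpow_opp x z : Rcpow x (- z)%C = (/ Rcpow x z)%C.
Proof.
  assert (E : (Rcpow x z * Rcpow x (- z))%C = RtoC 1).
  { rewrite <- Rcpow_plus. replace (z + - z)%C with (RtoC 0) by ring. apply Rcpow_0. }
  pose proof (Rcpow_neq_0 x z). transitivity ((Rcpow x z * Rcpow x (- z)) * / Rcpow x z)%C; [field; assumption|].
  rewrite E. ring.
Qed.

Lemma Rcpow_minus x z w : Rcpow x (z - w)%C = (Rcpow x z / Rcpow x w)%C.
Proof. unfold Cminus. rewrite Rcpow_plus, Rcpow_opp. reflexivity. Qed.

Lemma Rcpow_mult x y z : 0 < x -> 0 < y -> Rcpow (x * y) z = (Rcpow x z * Rcpow y z)%C.
Proof.
  intros Hx Hy. unfold Rcpow. rewrite <- Cexp_plus. f_equal. rewrite ln_mult, RtoC_plus by assumption. ring.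
Qed.

Lemma Rcpow_inv x z : 0 < x -> Rcpow (/ x) z = (/ Rcpow x z)%C.
Proof.
  intros Hx. rewrite <- Rcpow_opp. unfold Rcpow. f_equal. rewrite ln_Rinv, RtoC_opp by assumption. ring.
Qed.

Lemma Rcpow_RtoC x r : Rcpow x (RtoC r) = RtoC (Rpower x r).
Proof.
  rewrite Rcpow_pair. unfold RtoC, Rpower; simpl. rewrite !Rmult_0_l, cos_0, sin_0. f_equal; ring.
Qed.

Lemma Rcpow_INR x n : 0 < x -> Rcpow x (RtoC (INR n)) = RtoC (x ^ n).
Proof. intros Hx. rewrite Rcpow_RtoC, Rpower_pow by exact Hx. reflexivity. Qed.

Lemma Rcpow_exp t z : Rcpow (exp t) z = Cexp (z * RtoC t)%C.
Proof. unfold Rcpow. rewrite ln_exp. reflexivity. Qed.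

(** * Mellin integrals *)

Definition is_CInt (f : R -> C) (l : C) : Prop :=
  @is_RInt_gen C_R_NormedModule f (at_right 0) (Rbar_locally p_infty) l.

Lemma norm_C_R (z : C) : @norm R_AbsRing C_R_NormedModule z = Cmod z.
Proof.
  change (sqrt (Rabs (fst z) ^ 2 + Rabs (snd z) ^ 2) = Cmod z).
  rewrite !pow2_abs. reflexivity.
Qed.

Lemma filter_prod_pos (P : R -> R -> Prop) : (forall a b, 0 < a -> a <= b -> P a b) ->
  filter_prod (at_right 0) (Rbar_locally p_infty) (fun ab : R * R => P (fst ab) (snd ab)).
Proof.
  intros H. apply (Filter_prod _ _ _ (fun a => 0 < a < 1) (fun b => 1 < b)).
  - exists (mkposreal 1 Rlt_0_1). intros y Hy Hy0. unfold ball in Hy; simpl in Hy; unfold AbsRing_ball, abs, minus, plus, opp in Hy; simpl in Hy.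
    rewrite Ropp_0, Rplus_0_r in Hy. apply Rabs_def2 in Hy. cbv beta. lra.
  - exists 1. auto.
  - intros a b Ha Hb. apply (H a b); lra.
Qed.

Lemma is_CInt_ext f g l : (forall t, 0 < t -> f t = g t) -> is_CInt f l -> is_CInt g l.
Proof.
  intros E H. refine (is_RInt_gen_ext (V := C_R_NormedModule) (Fa := at_right 0) (Fb := Rbar_locally p_infty) f g l _ H).
  apply (filter_prod_pos (fun a b => forall x, Rmin a b < x < Rmax a b -> f x = g x)).
  intros a b Ha Hb x Hx. apply E. rewrite Rmin_left in Hx by lra. lra.
Qed.

Lemma is_CInt_plus f g l m : is_CInt f l -> is_CInt g m -> is_CInt (fun t => f t + g t)%C (l + m)%C.
Proof.
  intros Hf Hg.
  exact (is_RInt_gen_plus (V := C_R_NormedModule) (Fa := at_right 0) (Fb := Rbar_locally p_infty) f g l m Hf Hg).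
Qed.

(** Integrals into [C] are linear over the reals by construction; multiplication by [Ci] permutes
    the components up to sign, and general complex multiples follow from it. *)
Lemma is_RInt_Ci (f : R -> C) a b (l : C) : @is_RInt C_R_NormedModule f a b l ->
  @is_RInt C_R_NormedModule (fun t => Ci * f t)%C a b (Ci * l)%C.
Proof.
  intros H.
  assert (E : forall z : C, (Ci * z)%C = (- snd z, fst z)).
  { intros [x y]. unfold Ci, Cmult; simpl. f_equal; ring. }
  rewrite E.
  apply (is_RInt_ext (V := C_R_NormedModule) (fun t => (- snd (f t), fst (f t)))); [intros; symmetry; apply E|].
  apply (is_RInt_fct_extend_pair (U := R_NormedModule) (V := R_NormedModule) (fun t => (- snd (f t), fst (f t)))); simpl.
  - apply (is_RInt_opp (V := R_NormedModule)).
    apply (is_RInt_fct_extend_snd (U := R_NormedModule) (V := R_NormedModule) f a b l H).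
  - apply (is_RInt_fct_extend_fst (U := R_NormedModule) (V := R_NormedModule) f a b l H).
Qed.

Lemma is_RInt_Cmult (c : C) (f : R -> C) a b (l : C) : @is_RInt C_R_NormedModule f a b l ->
  @is_RInt C_R_NormedModule (fun t => c * f t)%C a b (c * l)%C.
Proof.
  intros H. destruct c as [x y].
  assert (E : forall z : C, ((x, y) * z)%C = plus (scal x z : C_R_NormedModule) (scal y (Ci * z)%C : C_R_NormedModule)).
  { intros [u v]. unfold plus, scal; simpl. unfold prod_plus, prod_scal, Ci, Cmult, plus, scal; simpl. unfold mult; simpl. f_equal; ring. }
  rewrite E.
  apply (is_RInt_ext (V := C_R_NormedModule) (fun t => plus (scal x (f t) : C_R_NormedModule) (scal y (Ci * f t)%C : C_R_NormedModule))); [intros; symmetry; apply E|].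
  apply (is_RInt_plus (V := C_R_NormedModule)); apply (is_RInt_scal (V := C_R_NormedModule)); [exact H|apply is_RInt_Ci, H].
Qed.

(** The factor [sqrt 2] converts a ball of the uniform structure into a bound on the modulus; the
    added 1 covers [c = 0]. *)
Lemma ball_C_Cmult (c l z : C) (eps : posreal) (Hd : 0 < eps / (sqrt 2 * (Cmod c + 1))) :
  @ball C_UniformSpace l (mkposreal _ Hd) z -> @ball C_UniformSpace (c * l)%C eps (c * z)%C.
Proof.
  intros H. apply C_NormedModule_mixin_compat2 in H. simpl in H.
  apply C_NormedModule_mixin_compat1.
  change (Cmod (z - l)%C < sqrt 2 * (eps / (sqrt 2 * (Cmod c + 1)))) in H.
  change (Cmod (c * z - c * l)%C < eps).
  replace (c * z - c * l)%C with (c * (z - l))%C by ring. rewrite Cmod_mult.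
  pose proof (Cmod_ge_0 c). pose proof (Cmod_ge_0 (z - l)%C). pose proof (cond_pos eps).
  assert (Hs : 0 < sqrt 2) by (apply sqrt_lt_R0; lra).
  replace (sqrt 2 * (eps / (sqrt 2 * (Cmod c + 1)))) with (eps / (Cmod c + 1)) in H by (field; lra).
  apply Rle_lt_trans with (Cmod c * (eps / (Cmod c + 1))); [apply Rmult_le_compat_l; lra|].
  replace (Cmod c * (eps / (Cmod c + 1))) with (eps * Cmod c / (Cmod c + 1)) by (field; lra).
  apply Rlt_div_l; nra.
Qed.

Lemma is_RInt_gen_Cmult (c : C) (f : R -> C) (l : C) Fa Fb {FFa : Filter Fa} {FFb : Filter Fb} :
  @is_RInt_gen C_R_NormedModule f Fa Fb l ->
  @is_RInt_gen C_R_NormedModule (fun t => c * f t)%C Fa Fb (c * l)%C.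
Proof.
  intros H. apply filterlimi_locally. intros eps.
  assert (Hd : 0 < eps / (sqrt 2 * (Cmod c + 1))).
  { apply Rdiv_lt_0_compat; [apply cond_pos|]. pose proof (Cmod_ge_0 c). apply Rmult_lt_0_compat; [apply sqrt_lt_R0|]; lra. }
  pose proof (proj1 (filterlimi_locally _ _) H (mkposreal _ Hd)) as H1.
  revert H1. apply filter_imp. intros [a b] [z [Hz1 Hz2]]. exists (c * z)%C. split.
  - apply is_RInt_Cmult, Hz1.
  - apply (ball_C_Cmult c l z eps Hd Hz2).
Qed.

Lemma is_CInt_scal c f l : is_CInt f l -> is_CInt (fun t => c * f t)%C (c * l)%C.
Proof. intros H. exact (is_RInt_gen_Cmult c f l (at_right 0) (Rbar_locally p_infty) H). Qed.

Lemma is_CInt_csum (f : nat -> R -> C) (I : nat -> C) n :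
  (forall i, is_CInt (f i) (I i)) -> is_CInt (fun t => csum (fun i => f i t) n) (csum I n).
Proof.
  intros H. induction n as [|n IH]; simpl.
  - exact (is_RInt_gen_zero (V := C_R_NormedModule) (at_right 0) (Rbar_locally p_infty)).
  - apply is_CInt_plus; auto.
Qed.

Lemma is_CInt_bound f l (G : R -> R) KG : is_CInt f l ->
  is_RInt_gen G (at_right 0) (Rbar_locally p_infty) KG ->
  (forall t, 0 < t -> Cmod (f t) <= G t) -> Cmod l <= KG.
Proof.
  intros Hf HG Hb. rewrite <- norm_C_R.
  refine (RInt_gen_norm (V := C_R_CompleteNormedModule) f G l KG _ _ Hf HG).
  - apply (filter_prod_pos (fun a b => a <= b)). auto.
  - apply (filter_prod_pos (fun a b => forall x, a <= x <= b -> @norm R_AbsRing C_R_NormedModule (f x) <= G x)).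
    intros a b Ha _ x Hx. rewrite norm_C_R. apply Hb. lra.
Qed.

Lemma Rpower_le_pow t s n : 0 < t -> 0 <= s <= INR n -> Rpower t s <= 1 + t ^ n.
Proof.
  intros Ht Hs. destruct (Rle_dec t 1) as [h|h].
  - assert (Rpower t s <= 1).
    { replace 1 with (Rpower 1 s) by (unfold Rpower; rewrite ln_1, Rmult_0_r; apply exp_0). apply Rle_Rpower_l; lra. }
    pose proof (pow_lt t n Ht). lra.
  - rewrite <- (Rpower_pow n t Ht). assert (Rpower t s <= Rpower t (INR n)) by (apply Rle_Rpower; lra). lra.
Qed.

Lemma Rpower_exp_bounded s A : 0 <= s -> 0 < A -> exists K, 0 <= K /\ forall t, 0 < t -> Rpower t s * exp (- A * t) <= K.
Proof.
  intros Hs HA. destruct (nfloor_ex s Hs) as [n [_ Hn]].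
  destruct (pow_exp_bounded (S n) A HA) as [K [HK0 HK]].
  destruct (pow_exp_bounded 0 A HA) as [K' [HK0' HK']].
  exists (K' + K). split; [lra|]. intros t Ht.
  specialize (HK t ltac:(lra)). specialize (HK' t ltac:(lra)). simpl in HK'. pose proof (exp_pos (- A * t)).
  eapply Rle_trans; [apply Rmult_le_compat_r; [lra|apply (Rpower_le_pow t s (S n) Ht); rewrite S_INR; lra]|]. nra.
Qed.

(* [t ^ s / (1 + t ^ s)] is bounded and its derivative dominates [t ^ (s - 1) * exp (- A t)]. *)
Lemma ex_RInt_gen_mellin {V : CompleteNormedModule R_AbsRing} (f : R -> V) s A : 0 < s -> 0 < A ->
  (forall t, 0 < t -> continuous f t) ->
  (forall t, 0 < t -> norm (f t) <= Rpower t (s - 1) * exp (- A * t)) ->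
  ex_RInt_gen f (at_right 0) (Rbar_locally p_infty).
Proof.
  intros Hs HA Hc Hb.
  destruct (Rpower_exp_bounded 0 A (Rle_refl 0) HA) as [K0 [HK0 HK0']].
  destruct (Rpower_exp_bounded s A ltac:(lra) HA) as [K1 [HK1 HK1']].
  destruct (Rpower_exp_bounded (2 * s) A ltac:(lra) HA) as [K2 [HK2 HK2']].
  (* [K0 + 2 * K1 + K2] bounds [(1 + t ^ s) ^ 2 * exp (- A t)] term by term; the division by [s]
     undoes the factor [s] of the derivative. *)
  set (K := (K0 + 2 * K1 + K2) / s).
  assert (HK : 0 <= K) by (apply Rdiv_le_0_compat; lra).
  set (phi := fun t => - K * / (1 + Rpower t s)).
  set (dphi := fun t => K * (s * Rpower t (s - 1) / (1 + Rpower t s) ^ 2)).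
  assert (Hdphi : forall t, 0 < t -> is_derive phi t (dphi t)).
  { intros t Ht. unfold phi, dphi, Rpower. pose proof (exp_pos (s * ln t)).
    auto_derive; [split; [lra|split; [lra|trivial]]|].
    replace ((s - 1) * ln t) with (s * ln t + - ln t) by ring. rewrite exp_plus, exp_Ropp, exp_ln by lra. field. lra. }
  assert (Hcd : forall t, 0 < t -> continuous dphi t).
  { intros t Ht. apply @ex_derive_continuous. unfold dphi, Rpower. pose proof (exp_pos (s * ln t)).
    auto_derive. repeat split; try lra. apply Rgt_not_eq. nra. }
  assert (Hdom : forall t, 0 < t -> norm (f t) <= dphi t).
  { intros t Ht. eapply Rle_trans; [apply Hb, Ht|]. unfold dphi.
    pose proof (exp_pos (s * ln t)) as Hp. change (exp (s * ln t)) with (Rpower t s) in Hp.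
    pose proof (exp_pos ((s - 1) * ln t)) as Hp1. change (exp ((s - 1) * ln t)) with (Rpower t (s - 1)) in Hp1.
    specialize (HK0' t Ht). specialize (HK1' t Ht). specialize (HK2' t Ht).
    replace (2 * s) with (s + s) in HK2' by ring. rewrite Rpower_plus in HK2'.
    rewrite Rpower_O in HK0' by exact Ht.
    set (x := Rpower t s) in *. set (e := exp (- A * t)) in *.
    replace (K * (s * Rpower t (s - 1) / (1 + x) ^ 2)) with (Rpower t (s - 1) * ((K0 + 2 * K1 + K2) / (1 + x) ^ 2)) by (unfold K; field; lra).
    apply Rmult_le_compat_l; [lra|].
    apply Rle_div_r; [apply pow_lt; lra|]. simpl. nra. }
  assert (Hle : forall a b, 0 < a -> a <= b -> exists l, is_RInt f a b l /\ norm l <= Rabs (phi b - phi a)).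
  { intros a b Ha Hab.
    destruct (ex_RInt_continuous (V := V) f a b) as [l Hl].
    { intros z Hz. rewrite Rmin_left, Rmax_right in Hz by lra. apply Hc; lra. }
    exists l. split; [exact Hl|].
    assert (Hg : is_RInt dphi a b (phi b - phi a)).
    { apply (is_RInt_derive phi dphi).
      - intros t Ht. rewrite Rmin_left, Rmax_right in Ht by lra. apply Hdphi; lra.
      - intros t Ht. rewrite Rmin_left, Rmax_right in Ht by lra. apply Hcd; lra. }
    eapply Rle_trans; [|apply Rle_abs].
    apply (norm_RInt_le f dphi a b l); auto.
    intros t Ht. apply Hdom. lra. }
  (* For [r <> 0] the limit is taken at the end where [exp (r v)] vanishes. With [v = ln t] it is
     used for [r = s] at 0 and for [r = - s] at infinity. *)
  assert (Hlimexp : forall r, is_lim (fun v => exp (r * v)) (if Rlt_dec 0 r then m_infty else p_infty) (if Req_EM_T r 0 then 1 else 0)).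
  { intros r. destruct (Req_EM_T r 0) as [->|Hr].
    - apply (is_lim_ext (fun _ => 1)); [intros; rewrite Rmult_0_l, exp_0; reflexivity|apply is_lim_const].
    - apply is_lim_comp with m_infty.
      + apply is_lim_exp_m.
      + destruct (Rlt_dec 0 r).
        * evar_last; [apply (is_lim_scal_l (fun t => t) r m_infty m_infty); apply is_lim_id|].
          simpl. destruct (Rle_dec 0 r); [|exfalso; lra]. destruct (Rle_lt_or_eq_dec 0 r r1); [reflexivity|exfalso; lra].
        * evar_last; [apply (is_lim_scal_l (fun t => t) r p_infty p_infty); apply is_lim_id|].
          simpl. destruct (Rle_dec 0 r); [exfalso; lra|]. reflexivity.
      + destruct (Rlt_dec 0 r); exists 0; intros; discriminate. }
  apply (ex_RInt_gen_cauchy f (fun t => 0 < t) phi (at_right 0) (Rbar_locally p_infty) (- K) 0).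
  - exists (mkposreal 1 Rlt_0_1). intros y _ Hy. exact Hy.
  - exists 0. auto.
  - intros a b Ha Hb'. destruct (Rle_dec a b) as [h|h]; [apply Hle; auto|].
    destruct (Hle b a Hb' ltac:(lra)) as [l [Hl HN]].
    exists (opp l). split; [apply is_RInt_swap; exact Hl|].
    rewrite norm_opp, Rabs_minus_sym. exact HN.
  - assert (H1 : filterlim (fun t => Rpower t s) (at_right 0) (locally 0)).
    { unfold Rpower. apply (filterlim_comp _ _ _ ln (fun v => exp (s * v)) _ (Rbar_locally m_infty)); [apply is_lim_ln_0|].
      specialize (Hlimexp s). destruct (Rlt_dec 0 s); [|exfalso; lra]. destruct (Req_EM_T s 0); [exfalso; lra|]. exact Hlimexp. }
    apply (filterlim_comp _ _ _ (fun t => Rpower t s) (fun x => - K * / (1 + x)) _ (locally 0)); [exact H1|].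
    assert (Hk : continuous (fun x : R => - K * / (1 + x)) 0).
    { apply (ex_derive_continuous (V := R_NormedModule) (fun x => - K * / (1 + x)) 0). auto_derive. lra. }
    unfold continuous in Hk. replace (- K * / (1 + 0)) with (- K) in Hk by field. exact Hk.
  - assert (H1 : filterlim (fun t => Rpower t (- s)) (Rbar_locally p_infty) (locally 0)).
    { unfold Rpower. apply (filterlim_comp _ _ _ ln (fun v => exp (- s * v)) _ (Rbar_locally p_infty)); [apply is_lim_ln_p|].
      specialize (Hlimexp (- s)). destruct (Rlt_dec 0 (- s)); [exfalso; lra|]. destruct (Req_EM_T (- s) 0); [exfalso; lra|]. exact Hlimexp. }
    apply (filterlim_ext_loc (fun t => - K * (Rpower t (- s) * / (1 + Rpower t (- s))))).
    + exists 0. intros t Ht. unfold phi. rewrite Rpower_Ropp. pose proof (exp_pos (s * ln t)) as Hp. change (exp (s * ln t)) with (Rpower t s) in Hp.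
      field. lra.
    + apply (filterlim_comp _ _ _ (fun t => Rpower t (- s)) (fun x => - K * (x * / (1 + x))) _ (locally 0)); [exact H1|].
      assert (Hk : continuous (fun x : R => - K * (x * / (1 + x))) 0).
      { apply (ex_derive_continuous (V := R_NormedModule) (fun x => - K * (x * / (1 + x))) 0). auto_derive. lra. }
      unfold continuous in Hk. replace (- K * (0 * / (1 + 0))) with 0 in Hk by field. exact Hk.
Qed.

(** * The Gamma and Bessel functions as Mellin integrals *)

Lemma continuous_C_pair (f g : R -> R) t : continuous f t -> continuous g t ->
  @continuous R_UniformSpace C_R_NormedModule (fun t => (f t, g t)) t.
Proof.
  intros Hf Hg P [eps HP].
  pose proof (proj1 (filterlim_locally _ _) Hf eps) as H1.
  pose proof (proj1 (filterlim_locally _ _) Hg eps) as H2.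
  pose proof (filter_and _ _ H1 H2) as H12. revert H12. unfold filtermap. apply filter_imp.
  intros y [A B]. apply HP. split; assumption.
Qed.

Lemma continuous_Rcpow_mult z (g : R -> R) t : 0 < t -> continuous g t ->
  @continuous R_UniformSpace C_R_NormedModule (fun t => Rcpow t z * RtoC (g t))%C t.
Proof.
  intros Ht Hg.
  apply (continuous_ext (fun t => ((exp (Re z * ln t) * cos (Im z * ln t)) * g t, (exp (Re z * ln t) * sin (Im z * ln t)) * g t))).
  { intros y. rewrite Rcpow_pair. unfold Cmult, RtoC; simpl. f_equal; ring. }
  apply continuous_C_pair; apply (continuous_mult (K := R_AbsRing) _ g); auto;
    apply @ex_derive_continuous; auto_derive; lra.
Qed.

(** For [B = 0] this is the Gamma integrand; for [B = y ^ 2 / 4] its integral is the Mellin form of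
    the Bessel function of order [s] at [y]. *)
Definition mellin_kernel (s : C) (B t : R) : C := (Rcpow t (s - RtoC 1) * RtoC (exp (- t - B / t)))%C.

Lemma Re_minus_1 s : Re (s - RtoC 1)%C = Re s - 1.
Proof. destruct s; unfold Re, Cminus, Cplus, Copp, RtoC; simpl. ring. Qed.

Lemma Cmod_mellin_kernel s B t : Cmod (mellin_kernel s B t) = Rpower t (Re s - 1) * exp (- t - B / t).
Proof.
  unfold mellin_kernel. rewrite Cmod_mult, Cmod_Rcpow, Cmod_R, Rabs_pos_eq, Re_minus_1 by (left; apply exp_pos). reflexivity.
Qed.

Lemma exp_le_compat x y : x <= y -> exp x <= exp y.
Proof. intros [H| ->]; [left; apply exp_increasing, H|right; reflexivity]. Qed.

Lemma continuous_mellin_kernel s B t : 0 < t ->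
  @continuous R_UniformSpace C_R_NormedModule (mellin_kernel s B) t.
Proof.
  intros Ht. apply (continuous_Rcpow_mult (s - RtoC 1)%C (fun t => exp (- t - B / t))); [exact Ht|].
  apply @ex_derive_continuous. auto_derive. lra.
Qed.

Lemma ex_CInt_mellin_kernel s B : 0 < Re s -> 0 <= B -> exists l, is_CInt (mellin_kernel s B) l.
Proof.
  intros Hs HB. apply (ex_RInt_gen_mellin (V := C_R_CompleteNormedModule) (mellin_kernel s B) (Re s) 1 Hs Rlt_0_1).
  - intros t Ht. apply continuous_mellin_kernel, Ht.
  - intros t Ht. eapply Rle_trans; [right; apply norm_C_R|]. rewrite Cmod_mellin_kernel.
    apply Rmult_le_compat_l; [left; apply exp_pos|]. apply exp_le_compat.
    assert (0 <= B / t) by (apply Rdiv_le_0_compat; lra). lra.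
Qed.

Lemma is_CInt_CGamma s : 0 < Re s -> is_CInt (fun t => Rcpow t (s - RtoC 1) * RtoC (exp (- t)))%C (CGamma s).
Proof.
  intros Hs.
  refine (RInt_gen_correct (V := C_R_CompleteNormedModule) (Fa := at_right 0) (Fb := Rbar_locally p_infty)
    (fun t => (Rcpow t (s - RtoC 1) * RtoC (exp (- t)))%C) _).
  destruct (ex_CInt_mellin_kernel s 0 Hs (Rle_refl 0)) as [l Hl].
  exists l. apply (is_CInt_ext (mellin_kernel s 0)); [|exact Hl].
  intros t Ht. unfold mellin_kernel. do 3 f_equal. unfold Rdiv. ring.
Qed.

Lemma filterlim_at_right_scal A : 0 < A -> filterlim (fun t => A * t + 0) (at_right 0) (at_right 0).
Proof.
  intros HA P [eps HP].
  assert (He : 0 < eps / A) by (apply Rdiv_lt_0_compat; [apply cond_pos|exact HA]).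
  exists (mkposreal _ He). intros y Hy Hy0. apply HP.
  - unfold ball in *; simpl in *; unfold AbsRing_ball, abs, minus, plus, opp in *; simpl in *.
    rewrite Ropp_0, !Rplus_0_r in *. rewrite Rabs_pos_eq in * by nra.
    apply Rlt_div_r in Hy; [|exact HA]. lra.
  - nra.
Qed.

Lemma filterlim_p_infty_scal A : 0 < A -> filterlim (fun t => A * t + 0) (Rbar_locally p_infty) (Rbar_locally p_infty).
Proof.
  intros HA P [M HM]. exists (M / A). intros y Hy. apply HM.
  apply Rlt_div_l in Hy; [|exact HA]. lra.
Qed.

Lemma is_CInt_Gamma_scal s A : 0 < Re s -> 0 < A ->
  is_CInt (fun t => Rcpow t (s - RtoC 1) * RtoC (exp (- (A * t))))%C (Rcpow A (- s) * CGamma s)%C.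
Proof.
  intros Hs HA. pose proof (is_CInt_CGamma s Hs) as HG.
  set (f := fun t => (Rcpow t (s - RtoC 1) * RtoC (exp (- t)))%C) in HG.
  assert (H1 : is_CInt (fun t => scal A (f (A * t + 0) : C_R_NormedModule)) (CGamma s)).
  { assert (H2 := filterlimi_comp_2 (F := filter_prod (at_right 0) (Rbar_locally p_infty))
      (fun ab : R * R => A * fst ab + 0) (fun ab : R * R => A * snd ab + 0)
      (fun a b => @is_RInt C_R_NormedModule f a b)
      (filterlim_comp _ _ _ fst (fun t => A * t + 0) _ _ _ filterlim_fst (filterlim_at_right_scal A HA))
      (filterlim_comp _ _ _ snd (fun t => A * t + 0) _ _ _ filterlim_snd (filterlim_p_infty_scal A HA)) HG).
    intros P HP. specialize (H2 P HP). unfold filtermapi in *. revert H2. apply filter_imp.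
    intros [a b] [z [Hz1 Hz2]]. exists z. split; [|exact Hz2].
    apply (is_RInt_comp_lin (V := C_R_NormedModule) f A 0 a b z). exact Hz1. }
  apply (is_CInt_scal (Rcpow A (- s))) in H1.
  apply (is_CInt_ext (fun t => Rcpow A (- s) * (scal A (f (A * t + 0)%R : C_R_NormedModule)))%C); [|exact H1].
  intros t Ht.
  assert (Es : forall z : C, scal A (z : C_R_NormedModule) = (RtoC A * z)%C).
  { intros [u v]. unfold scal; simpl. unfold prod_scal, Cmult, RtoC, scal; simpl. unfold mult; simpl. f_equal; ring. }
  rewrite Es. unfold f. rewrite Rplus_0_r, Rcpow_mult by assumption.
  rewrite Rcpow_opp, (Rcpow_minus A).
  assert (E1 : Rcpow A (RtoC 1) = RtoC A) by (rewrite Rcpow_RtoC, Rpower_1 by exact HA; reflexivity).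
  rewrite E1. pose proof (Rcpow_neq_0 A s). assert (RtoC A <> RtoC 0) by (apply RtoC_neq_0; lra).
  field. split; assumption.
Qed.

(** Links the Laplace integrals, which start at the point 0, to the Mellin integrals, which only
    approach 0: by continuity the piece between [a] and 0 tends to 0. *)
Lemma at_point_at_right (f : R -> R) l : (forall t, continuous f t) ->
  is_RInt_gen f (at_point 0) (Rbar_locally p_infty) l -> is_RInt_gen f (at_right 0) (Rbar_locally p_infty) l.
Proof.
  intros Hc H.
  replace l with (plus 0 l) by (unfold plus; simpl; ring).
  apply (is_RInt_gen_Chasles (V := R_NormedModule) f 0 0 l); [|exact H].
  set (F := fun a => RInt f a 0).
  assert (HF : filterlim F (at_right 0) (locally 0)).
  { assert (HFc : continuous F 0).
    { apply (ex_derive_continuous (V := R_NormedModule)). eexists.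
      apply (is_derive_RInt' f F 0 0).
      - exists (mkposreal 1 Rlt_0_1). intros y _. apply (RInt_correct (V := R_CompleteNormedModule)).
        apply (ex_RInt_continuous (V := R_CompleteNormedModule)). intros; apply Hc.
      - apply Hc. }
    assert (E0 : F 0 = 0) by exact (RInt_point (V := R_CompleteNormedModule) 0 f).
    unfold continuous in HFc. rewrite E0 in HFc.
    intros P HP. specialize (HFc P HP). unfold filtermap, at_right, within in *.
    revert HFc. apply filter_imp. auto. }
  intros P HP. specialize (HF P HP). unfold filtermapi.
  apply (Filter_prod _ _ _ (fun a => P (F a)) (fun b => b = 0)); [exact HF|reflexivity|].
  intros a b Ha ->. exists (F a). split; [|exact Ha]. simpl.
  apply (RInt_correct (V := R_CompleteNormedModule)). apply (ex_RInt_continuous (V := R_CompleteNormedModule)). intros; apply Hc.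
Qed.

Lemma is_CInt_RtoC (f : R -> R) l : is_RInt_gen f (at_right 0) (Rbar_locally p_infty) l -> is_CInt (fun t => RtoC (f t)) (RtoC l).
Proof.
  intros H P [eps HP].
  pose proof (proj1 (filterlimi_locally _ _) H eps) as H1.
  unfold filtermapi. revert H1. apply filter_imp. intros [a b] [z [Hz1 Hz2]]. exists (RtoC z). split.
  - apply (is_RInt_fct_extend_pair (U := R_NormedModule) (V := R_NormedModule) (fun t => RtoC (f t))); simpl; [exact Hz1|].
    evar_last; [apply (is_RInt_const (V := R_NormedModule))|]. unfold scal; simpl; unfold mult; simpl. ring.
  - apply HP. split; simpl; [exact Hz2|apply ball_center].
Qed.

Lemma is_CInt_unique f l m : is_CInt f l -> is_CInt f m -> l = m.
Proof.
  intros Hl Hm.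
  rewrite <- (is_RInt_gen_unique (V := C_R_CompleteNormedModule) f l Hl).
  apply (is_RInt_gen_unique (V := C_R_CompleteNormedModule) f m Hm).
Qed.

Lemma CGamma_fact k : CGamma (RtoC (INR k + 1)) = RtoC (INR (fact k)).
Proof.
  assert (Hs : 0 < Re (RtoC (INR k + 1))) by (simpl; pose proof (pos_INR k); lra).
  apply (is_CInt_unique (fun t => Rcpow t (RtoC (INR k + 1) - RtoC 1) * RtoC (exp (- t)))%C); [apply is_CInt_CGamma, Hs|].
  apply (is_CInt_ext (fun t => RtoC (t ^ k * exp (- 1 * t) * cos (0 * t)))).
  - intros t Ht. rewrite <- RtoC_minus. replace (INR k + 1 - 1) with (INR k) by ring.
    rewrite Rcpow_INR, <- RtoC_mult by exact Ht. f_equal. rewrite Rmult_0_l, cos_0. replace (- 1 * t) with (- t) by ring. ring.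
  - apply is_CInt_RtoC. apply at_point_at_right.
    + intros t. apply @ex_derive_continuous. auto_derive. trivial.
    + pose proof (proj1 (is_RInt_gen_laplace k 1 0 Rlt_0_1)) as H. rewrite laplace_0, pow1 in H by lra. cbn [fst] in H.
      replace (INR (fact k)) with (INR (fact k) / 1) by field. exact H.
Qed.

(* Substitute [s = (y / 2) * exp t], which symmetrises [cosh]. *)
Lemma BesselK_mellin nu y l : 0 < y -> is_CInt (mellin_kernel nu (y ^ 2 / 4)) l ->
  BesselK nu y = (RtoC (/ 2) * Rcpow (y / 2) (- nu) * l)%C.
Proof.
  intros Hy Hl. unfold BesselK.
  apply (is_RInt_gen_unique (V := C_R_CompleteNormedModule)).
  set (F := mellin_kernel nu (y ^ 2 / 4)) in *.
  set (g := fun t => y / 2 * exp t).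
  set (H := fun t => (Rcpow (y / 2) nu * (RtoC (exp (- y * cosh t)) * Cexp (nu * RtoC t)))%C).
  assert (Hy2 : 0 < y / 2) by lra.
  assert (Hg : forall t, 0 < g t) by (intros t; unfold g; pose proof (exp_pos t); nra).
  assert (EH : forall t, scal (g t) (F (g t) : C_R_NormedModule) = H t).
  { intros t.
    assert (Es : forall z : C, scal (g t) (z : C_R_NormedModule) = (RtoC (g t) * z)%C).
    { intros [u v]. unfold scal; simpl. unfold prod_scal, Cmult, RtoC, scal; simpl. unfold mult; simpl. f_equal; ring. }
    rewrite Es. unfold F, mellin_kernel, H.
    assert (E1 : Rcpow (g t) (RtoC 1) = RtoC (g t)) by (rewrite Rcpow_RtoC, Rpower_1 by apply Hg; reflexivity).
    rewrite Rcpow_minus, E1.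
    assert (E2 : - g t - y ^ 2 / 4 / g t = - y * cosh t).
    { unfold g, cosh. rewrite exp_Ropp. pose proof (exp_pos t). field. lra. }
    rewrite E2. unfold g at 2. rewrite Rcpow_mult, Rcpow_exp by (try lra; apply exp_pos).
    assert (RtoC (g t) <> RtoC 0) by (apply RtoC_neq_0; specialize (Hg t); lra).
    match goal with |- ?u = ?v => change (@eq C u v) end. field. assumption. }
  assert (HcH : forall t, @continuous R_UniformSpace C_R_NormedModule H t).
  { intros t. apply (continuous_ext (fun t => scal (g t) (F (g t) : C_R_NormedModule))); [exact EH|].
    assert (Hcg : continuous g t) by (apply @ex_derive_continuous; unfold g; auto_derive; trivial).
    apply (continuous_scal (V := C_R_NormedModule) g (fun t => F (g t)) t Hcg).
    apply (continuous_comp g F t Hcg). apply continuous_mellin_kernel, Hg. }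
  (* In the logarithmic variable the range is cut symmetrically to [[- T, T]] and folded at 0; the
     sum of the two halves is the hyperbolic cosine of the Bessel integrand. *)
  assert (Hsub : forall T z, @is_RInt C_R_NormedModule F (g (- T)) (g T) z ->
     @is_RInt C_R_NormedModule (fun t => H t + H (- t)%R)%C 0 T z).
  { intros T z Hz.
    assert (HI : @is_RInt C_R_NormedModule H (- T) T z).
    { rewrite <- (is_RInt_unique (V := C_R_CompleteNormedModule) _ _ _ _ Hz).
      apply (is_RInt_ext (V := C_R_NormedModule) (fun t => scal (g t) (F (g t) : C_R_NormedModule))); [intros; apply EH|].
      apply (is_RInt_comp (V := C_R_CompleteNormedModule) F g g (- T) T).
      - intros x _. apply continuous_mellin_kernel, Hg.
      - intros x _. split; [unfold g; auto_derive; [trivial|ring]|]. apply @ex_derive_continuous; unfold g; auto_derive; trivial. }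
    destruct (ex_RInt_continuous (V := C_R_CompleteNormedModule) H (- T) 0) as [z1 Hz1]; [intros; apply HcH|].
    destruct (ex_RInt_continuous (V := C_R_CompleteNormedModule) H 0 T) as [z2 Hz2]; [intros; apply HcH|].
    assert (Ez : z = plus (z2 : C_R_NormedModule) z1).
    { rewrite <- (is_RInt_unique (V := C_R_CompleteNormedModule) _ _ _ _ HI).
      rewrite (is_RInt_unique (V := C_R_CompleteNormedModule) _ _ _ _ (is_RInt_Chasles (V := C_R_NormedModule) _ _ _ _ _ _ Hz1 Hz2)).
      apply (plus_comm (z1 : C_R_NormedModule) z2). }
    rewrite Ez.
    apply (is_RInt_plus (V := C_R_NormedModule) H (fun t => H (- t))); [exact Hz2|].
    apply (is_RInt_swap (V := C_R_NormedModule)) in Hz1.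
    replace 0 with (- 0) in Hz1 by ring.
    apply (is_RInt_comp_opp (V := C_R_NormedModule)) in Hz1.
    apply (is_RInt_opp (V := C_R_NormedModule)) in Hz1.
    rewrite opp_opp in Hz1.
    apply (is_RInt_ext (V := C_R_NormedModule) (fun y0 : R => opp (opp (H (- y0)) : C_R_NormedModule))); [|exact Hz1].
    intros t _. apply (opp_opp (H (- t) : C_R_NormedModule)). }
  assert (HG : @is_RInt_gen C_R_NormedModule (fun t => H t + H (- t)%R)%C (at_point 0) (Rbar_locally p_infty) l).
  { assert (Hlg : filterlim g (Rbar_locally p_infty) (Rbar_locally p_infty)).
    { intros P [M HM]. exists (Rabs (M / (y / 2))). intros t Ht. apply HM. unfold g.
      assert (M / (y / 2) < exp t).
      { eapply Rle_lt_trans; [apply Rle_abs|]. eapply Rlt_trans; [exact Ht|].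
        pose proof (Rabs_pos (M / (y / 2))). pose proof (exp_ineq1 t ltac:(lra)). lra. }
      apply Rlt_div_l in H0; [|exact Hy2]. lra. }
    assert (Hlg' : filterlim (fun t => g (- t)) (Rbar_locally p_infty) (at_right 0)).
    { intros P [eps HP]. exists (Rabs (y / 2 / eps)). intros t Ht. pose proof (cond_pos eps).
      apply HP; [|apply Hg]. unfold ball; simpl; unfold AbsRing_ball, abs, minus, plus, opp; simpl.
      rewrite Ropp_0, Rplus_0_r, Rabs_pos_eq by (left; apply Hg). unfold g. rewrite exp_Ropp.
      pose proof (exp_pos t).
      assert (y / 2 / eps < exp t).
      { eapply Rle_lt_trans; [apply Rle_abs|]. eapply Rlt_trans; [exact Ht|].
        pose proof (Rabs_pos (y / 2 / eps)). pose proof (exp_ineq1 t ltac:(lra)). lra. }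
      apply Rlt_div_l in H2; [|apply cond_pos]. change (y / 2 / exp t < eps). apply Rlt_div_l; lra. }
    (* Convergence at both ends independently is specialised to the curve [T -> (g (- T), g T)]. *)
    assert (H2 := filterlimi_comp_2 (F := Rbar_locally p_infty) (fun T => g (- T)) g
      (fun a b => @is_RInt C_R_NormedModule F a b) Hlg' Hlg Hl).
    intros P HP. specialize (H2 P HP).
    apply (Filter_prod _ _ _ (fun a => a = 0) (fun T => exists z, @is_RInt C_R_NormedModule F (g (- T)) (g T) z /\ P z)); [reflexivity|exact H2|].
    intros a T -> [z [Hz1 Hz2]]. exists z. split; [apply Hsub, Hz1|exact Hz2]. }
  apply (is_RInt_gen_Cmult (RtoC (/ 2) * Rcpow (y / 2) (- nu))%C) in HG; try typeclasses eauto.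
  eapply (is_RInt_gen_ext (V := C_R_NormedModule)); [|exact HG].
  apply filter_forall. intros ab t _.
  unfold H, Ccosh. replace (cosh (- t)) with (cosh t) by (unfold cosh; rewrite Ropp_involutive; field).
  rewrite Rcpow_opp, RtoC_opp, RtoC_inv by lra.
  replace (nu * - RtoC t)%C with (- (nu * RtoC t))%C by ring.
  pose proof (Rcpow_neq_0 (y / 2) nu). assert (RtoC 2 <> RtoC 0) by (apply RtoC_neq_0; lra).
  match goal with |- ?u = ?v => change (@eq C u v) end. field. assumption.
Qed.

(** * Termwise integration *)

Lemma rsum_le_series m s n : (forall i, 0 <= m i) -> is_series m s -> rsum m n <= s.
Proof.
  intros Hm Hs. apply is_series_rsum in Hs.
  refine (is_lim_seq_le_loc (fun _ => rsum m n) (rsum m) (Finite _) (Finite s) _ (is_lim_seq_const _) Hs).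
  exists n. intros k Hk. replace k with (n + (k - n))%nat by lia. rewrite rsum_split.
  assert (0 <= rsum (fun i => m (n + i)%nat) (k - n)) by (apply rsum_nonneg; auto). lra.
Qed.

Lemma Cmod_series_tail (a : nat -> C) (m : nat -> R) g s l n :
  (forall i, 0 <= m i) -> 0 <= g -> (forall i, Cmod (a i) <= m i * g) -> is_series m s ->
  Clim (csum a) l -> Cmod (l - csum a n)%C <= (s - rsum m n) * g.
Proof.
  intros Hm Hg Ha Hs Hl. apply (Clim_Cmod_le _ _ _ _ n Hl). intros k Hk.
  replace k with (n + (k - n))%nat by lia. rewrite csum_split.
  replace (csum a n + csum (fun i => a (n + i)%nat) (k - n) - csum a n)%C with (csum (fun i => a (n + i)%nat) (k - n)) by ring.
  eapply Rle_trans; [apply Cmod_csum|].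
  eapply Rle_trans; [apply (rsum_le _ (fun i => g * m (n + i)%nat)); intros; rewrite Rmult_comm; apply Ha|].
  rewrite rsum_scal, Rmult_comm. apply Rmult_le_compat_r; [exact Hg|].
  pose proof (rsum_le_series m s (n + (k - n)) Hm Hs) as H. rewrite rsum_split in H. lra.
Qed.

(** The identity of partial sums is integrated, not each series by itself: by the pointwise
    identity, the integrand is a difference of two tails, dominated by [sM - rsum M n] and
    [sN - rsum N n] times fixed integrable functions, so its integral tends to 0. *)
Lemma is_CInt_series_exchange (f g : nat -> R -> C) (h : R -> C) (I J : nat -> C) (A : C)
  (M N : nat -> R) (G G' : R -> R) KG KG' sM sN :
  (forall n, is_CInt (f n) (I n)) -> (forall n, is_CInt (g n) (J n)) -> is_CInt h A ->
  is_RInt_gen G (at_right 0) (Rbar_locally p_infty) KG -> is_RInt_gen G' (at_right 0) (Rbar_locally p_infty) KG' ->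
  (forall t, 0 < t -> 0 <= G t) -> (forall t, 0 < t -> 0 <= G' t) ->
  (forall n, 0 <= M n) -> (forall n, 0 <= N n) ->
  (forall n t, 0 < t -> Cmod (f n t) <= M n * G t) -> (forall n t, 0 < t -> Cmod (g n t) <= N n * G' t) ->
  is_series M sM -> is_series N sN ->
  (forall t, 0 < t -> exists S0, Clim (csum (fun n => g n t)) S0 /\ Clim (csum (fun n => f n t)) (h t + S0)%C) ->
  forall SJ, Clim (csum J) SJ -> Clim (csum I) (A + SJ)%C.
Proof.
  intros Hf Hg Hh HG HG' HG0 HG0' HM HN Hbf Hbg HsM HsN Hid SJ HJ.
  assert (Hb : forall n, Cmod (csum I n - (A + csum J n))%C <= (sM - rsum M n) * KG + (sN - rsum N n) * KG').
  { intros n.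
    assert (HD : is_CInt (fun t => csum (fun i => f i t) n + RtoC (-1) * (h t + csum (fun i => g i t) n))%C (csum I n + RtoC (-1) * (A + csum J n))%C).
    { apply is_CInt_plus; [apply is_CInt_csum, Hf|]. apply is_CInt_scal. apply is_CInt_plus; [exact Hh|apply is_CInt_csum, Hg]. }
    replace (csum I n - (A + csum J n))%C with (csum I n + RtoC (-1) * (A + csum J n))%C by ring.
    apply (is_CInt_bound _ _ (fun t => (sM - rsum M n) * G t + (sN - rsum N n) * G' t) _ HD).
    - exact (is_RInt_gen_plus (V := R_NormedModule) _ _ _ _
        (is_RInt_gen_scal (V := R_NormedModule) (Fa := at_right 0) (Fb := Rbar_locally p_infty) G (sM - rsum M n) KG HG)
        (is_RInt_gen_scal (V := R_NormedModule) (Fa := at_right 0) (Fb := Rbar_locally p_infty) G' (sN - rsum N n) KG' HG')).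
    - intros t Ht. destruct (Hid t Ht) as [S0 [H1 H2]].
      pose proof (Cmod_series_tail _ M (G t) sM _ n HM (HG0 t Ht) (fun i => Hbf i t Ht) HsM H2) as B1.
      pose proof (Cmod_series_tail _ N (G' t) sN _ n HN (HG0' t Ht) (fun i => Hbg i t Ht) HsN H1) as B2.
      replace (csum (fun i => f i t) n + RtoC (-1) * (h t + csum (fun i => g i t) n))%C
        with (- (h t + S0 - csum (fun i => f i t) n) + (S0 - csum (fun i => g i t) n))%C by ring.
      eapply Rle_trans; [apply Cmod_triangle|]. rewrite Cmod_opp. lra. }
  apply (Clim_ext (fun n => (csum I n - (A + csum J n)) + (A + csum J n))%C); [intros; ring|].
  replace (A + SJ)%C with (RtoC 0 + (A + SJ))%C by ring.
  apply Clim_plus.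
  - apply (Clim_bound _ _ (fun n => (sM - rsum M n) * KG + (sN - rsum N n) * KG')).
    + intros n. replace (csum I n - (A + csum J n) - RtoC 0)%C with (csum I n - (A + csum J n))%C by ring. apply Hb.
    + apply is_series_rsum in HsM, HsN.
      replace (Finite 0) with (Finite ((sM - sM) * KG + (sN - sN) * KG')) by (f_equal; ring).
      apply is_lim_seq_plus'; (apply is_lim_seq_mult'; [apply is_lim_seq_minus'; [apply is_lim_seq_const|assumption]|apply is_lim_seq_const]).
  - apply Clim_plus; [apply Clim_const|exact HJ].
Qed.

Lemma ex_series_bounded (m : nat -> R) K : (forall n, 0 <= m n) -> (forall n, rsum m n <= K) -> exists s : R, is_series m s.
Proof.
  intros Hm HK. destruct (ex_finite_lim_seq_incr (rsum m) K) as [s Hs].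
  - intros n. simpl. specialize (Hm n). lra.
  - exact HK.
  - exists s. apply is_series_rsum, Hs.
Qed.

Lemma ex_RInt_gen_Rpower_exp s : 0 < s ->
  exists l : R, is_RInt_gen (fun t => Rpower t (s - 1) * exp (- 1 * t)) (at_right 0) (Rbar_locally p_infty) l.
Proof.
  intros Hs.
  refine (ex_RInt_gen_mellin (V := R_CompleteNormedModule) (fun t => Rpower t (s - 1) * exp (- 1 * t)) s 1 Hs Rlt_0_1 _ _).
  - intros t Ht. apply @ex_derive_continuous. unfold Rpower. auto_derive. lra.
  - intros t Ht. right. change (Rabs (Rpower t (s - 1) * exp (- 1 * t)) = Rpower t (s - 1) * exp (- 1 * t)).
    apply Rabs_pos_eq. apply Rmult_le_pos; left; apply exp_pos.
Qed.

(** * Bounds for the coefficients *)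

Lemma Cmod_sigma_char_le k q chi n : dirichlet_char q chi -> Cmod (sigma_char k chi (S n)) <= INR (S n) ^ S k.
Proof.
  intros H. unfold sigma_char.
  eapply Rle_trans; [apply (Cmod_divsum (S n) _ (fun _ => INR (S n) ^ k)); [lia|]|].
  - intros d Hd Hdn. rewrite Cmod_mult, Cmod_R, Rabs_pos_eq by apply pow_le, pos_INR.
    pose proof (char_Cmod_le q chi d H). pose proof (Cmod_ge_0 (chi d)).
    assert (INR d ^ k <= INR (S n) ^ k).
    { apply pow_incr. split; [apply pos_INR|]. apply le_INR. apply Nat.divide_pos_le; [lia|exact Hdn]. }
    assert (0 <= INR d ^ k) by apply pow_le, pos_INR. nra.
  - unfold rdivsum.
    eapply Rle_trans; [apply (rsum_le _ (fun _ => INR (S n) ^ k * 1))|].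
    + intros i _. destruct (Nat.eqb _ _); [lra|]. rewrite Rmult_1_r. apply pow_le, pos_INR.
    + rewrite rsum_scal. assert (E1 : forall m, rsum (fun _ => 1) m = INR m) by (induction m; [reflexivity|cbn [rsum]; rewrite IHm, S_INR; ring]).
      rewrite E1. right. simpl. ring.
Qed.

(** With [n = d m], the factor [d ^ k] leaves the exponent [- (1 + e)] for [d], while the exponent
    of [m] is at most that. The series is thus dominated by a product of two convergent sums of
    exponent [- (1 + e)]. *)
Lemma sigmabar_series k q chi e : dirichlet_char q chi -> 0 < e ->
  exists s : R, is_series (fun n => Cmod (sigmabar_char k (conj_char chi) (S n)) * Rpower (INR (S n)) (- (INR k + 1 + e))) s.
Proof.
  intros H He.
  set (P := fun d => if Nat.eqb d 0 then 0 else Rpower (INR d) (- (1 + e))).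
  assert (HP : forall d, 0 <= P d) by (intros d; unfold P; destruct (Nat.eqb d 0); [lra|left; apply exp_pos]).
  apply (ex_series_bounded _ ((1 + / e) * (1 + / e))).
  - intros n. apply Rmult_le_pos; [apply Cmod_ge_0|left; apply exp_pos].
  - intros X. eapply Rle_trans; [apply (rsum_le _ (fun n => rdivsum (S n) (fun d => P d * P (S n / d)%nat)))|].
    + intros n _. rewrite Rmult_comm. rewrite <- (Rabs_pos_eq (Rpower (INR (S n)) (- (INR k + 1 + e)))) by (left; apply exp_pos).
      rewrite <- Cmod_R, <- Cmod_mult, Cmult_comm. unfold sigmabar_char. rewrite divsum_scal by lia.
      apply Cmod_divsum; [lia|]. intros d Hd Hdn.
      assert (Hm : (0 < S n / d)%nat).
      { destruct Hdn as [m Hm]. rewrite Hm, Nat.div_mul by lia. destruct m; lia. }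
      rewrite (INR_divide d (S n) Hd Hdn).
      unfold conj_char. rewrite !Cmod_mult, Cmod_conj, !Cmod_R.
      rewrite (Rabs_pos_eq (INR d ^ k)) by apply pow_le, pos_INR.
      rewrite (Rabs_pos_eq (Rpower _ _)) by (left; apply exp_pos).
      assert (HdR : 0 < INR d) by (apply lt_0_INR; lia).
      set (m := (S n / d)%nat) in *. assert (HmR : 1 <= INR m) by (apply (le_INR 1); lia).
      unfold P. destruct (Nat.eqb_spec d 0); [lia|]. destruct (Nat.eqb_spec m 0); [lia|].
      rewrite <- (Rpower_mult_distr (INR d) (INR m)) by lra.
      pose proof (char_Cmod_le q chi m H). pose proof (Cmod_ge_0 (chi m)).
      assert (E1 : INR d ^ k * Rpower (INR d) (- (INR k + 1 + e)) = Rpower (INR d) (- (1 + e))).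
      { rewrite <- (Rpower_pow k (INR d) HdR), <- Rpower_plus. f_equal. ring. }
      assert (E2 : Rpower (INR m) (- (INR k + 1 + e)) <= Rpower (INR m) (- (1 + e))).
      { apply Rle_Rpower; [lra|]. pose proof (pos_INR k). lra. }
      assert (0 < Rpower (INR d) (- (1 + e))) by apply exp_pos.
      assert (0 < Rpower (INR m) (- (INR k + 1 + e))) by apply exp_pos.
      replace (INR d ^ k * Cmod (chi m) * (Rpower (INR d) (- (INR k + 1 + e)) * Rpower (INR m) (- (INR k + 1 + e))))
        with ((INR d ^ k * Rpower (INR d) (- (INR k + 1 + e))) * (Cmod (chi m) * Rpower (INR m) (- (INR k + 1 + e)))) by ring.
      rewrite E1. apply Rmult_le_compat_l; [lra|]. nra.
    + eapply Rle_trans; [apply rsum_rdivsum_le; exact HP|].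
      assert (Hs : rsum (fun i => P (S i)) X <= 1 + / e) by (unfold P; apply (Rpower_sum_bound e He X)).
      assert (H0 : 0 <= rsum (fun i => P (S i)) X) by (apply rsum_nonneg; intros; apply HP).
      apply Rmult_le_compat; auto.
Qed.

(** Trades the exponential for a power of [t] times a negative power of [n], the separated form
    required for termwise integration; the next lemma does the same for the dual series, with a real
    exponent. *)
Lemma exp_inv_bound P b : 0 < b -> exists K, 0 <= K /\ forall n t, 0 < t ->
  exp (- (b * INR (S n) / t)) <= K * t ^ P * / INR (S n) ^ P.
Proof.
  intros Hb. destruct (pow_exp_bounded P b Hb) as [K [HK0 HK]]. exists K. split; [exact HK0|].
  intros n t Ht. pose proof (INR_S_pos n) as Hn. set (x := INR (S n)) in *.
  assert (Hx : 0 < x / t) by (apply Rdiv_lt_0_compat; lra).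
  specialize (HK (x / t) ltac:(lra)).
  replace (- (b * x / t)) with (- b * (x / t)) by (field; lra).
  unfold Rdiv in HK at 1. rewrite Rpow_mult_distr, pow_inv in HK.
  assert (0 < t ^ P) by (apply pow_lt; lra). assert (0 < x ^ P) by (apply pow_lt; lra).
  set (E := exp (- b * (x / t))) in *.
  replace E with (x ^ P * / t ^ P * E * (t ^ P * / x ^ P)) by (field; lra).
  rewrite Rmult_assoc with (r1 := K). apply Rmult_le_compat_r; [|exact HK].
  apply Rmult_le_pos; [lra|left; apply Rinv_0_lt_compat; lra].
Qed.

Lemma exp_Rpower_bound P c : 0 <= P -> 0 < c -> exists K, 0 <= K /\ forall n t, 0 < t ->
  exp (- (c * INR (S n) * t)) <= K * Rpower (INR (S n)) (- P) * Rpower t (- P).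
Proof.
  intros HP Hc. destruct (Rpower_exp_bounded P c HP Hc) as [K [HK0 HK]]. exists K. split; [exact HK0|].
  intros n t Ht. pose proof (INR_S_pos n) as Hn. set (x := INR (S n)) in *.
  specialize (HK (x * t) ltac:(nra)).
  replace (K * Rpower x (- P) * Rpower t (- P)) with (K / Rpower (x * t) P)
    by (rewrite <- Rpower_mult_distr, !Rpower_Ropp by lra; unfold Rdiv; rewrite Rinv_mult; ring).
  replace (- (c * x * t)) with (- c * (x * t)) by ring.
  assert (0 < Rpower (x * t) P) by apply exp_pos.
  apply (proj1 (Rle_div_r _ _ _ H)). rewrite Rmult_comm. exact HK.
Qed.

(** * Summation against the Bessel kernel *)

Lemma is_series_scal_R (c : R) (m : nat -> R) s : is_series m s -> is_series (fun n => c * m n) (c * s).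
Proof. intros H. exact (is_series_scal (K := R_AbsRing) (V := R_NormedModule) c m s H). Qed.

Lemma Re_plus_R nu r : Re (nu + RtoC r)%C = Re nu + r.
Proof. destruct nu; reflexivity. Qed.

(** At [u = b / t] the factors [1 / u] and [1 / u ^ (k + 1)] raise the power of [t], which shifts
    the Gamma argument to [nu + 1] and [nu + k + 1]. The dual exponential becomes [exp (- c1 n t)]
    and joins [exp (- t)], so the rescaled Gamma integral yields [(1 + c1 n) ^ (- nu - k - 1)]. *)
Lemma sigma_mellin_sum p q chi nu b (I : nat -> C) Z :
  dirichlet_char q chi -> primitive_char q chi -> odd_char q chi -> 0 < b -> 0 < Re nu ->
  (forall n, is_CInt (mellin_kernel nu (b * INR (S n))) (I n)) ->
  Clim (csum (fun n => sigmabar_char (2 * p) (conj_char chi) (S n)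
    * Rcpow (1 + 4 * PI ^ 2 / (INR q * b) * INR (S n)) (- (nu + RtoC (INR (2 * p) + 1))))%C) Z ->
  Clim (csum (fun n => sigma_char (2 * p) chi (S n) * I n)%C)
   (RtoC (if Nat.eqb (2 * p) 0 then 1 else 0) * Lfun 1 chi * RtoC (/ b) * CGamma (RtoC 1 + nu)
    + Ci * gauss_sum q chi * RtoC ((-1) ^ p * INR (fact (2 * p)) * INR q ^ (2 * p) / (2 * PI) ^ S (2 * p))
       * Lfun (2 * p + 1) (conj_char chi) * CGamma nu
    - Ci * gauss_sum q chi * RtoC ((-1) ^ p * (2 * PI) ^ S (2 * p) / INR q * / b ^ S (2 * p))
       * CGamma (nu + RtoC (INR (2 * p) + 1)) * Z)%C.
Proof.
  intros H Hp Ho Hb Hnu HI HZ. pose proof (odd_char_gt_2 q chi H Ho) as Hq. pose proof PI_RGT_0 as HPI.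
  assert (HqR : 0 < INR q) by (apply lt_0_INR; lia).
  set (k := (2 * p)%nat) in *. set (s := (nu + RtoC (INR k + 1))%C) in *.
  set (c1 := 4 * PI ^ 2 / (INR q * b)) in *.
  assert (Hc1 : 0 < c1).
  { unfold c1. apply Rdiv_lt_0_compat; [|apply Rmult_lt_0_compat; lra]. assert (0 < PI ^ 2) by (apply pow_lt; lra). lra. }
  set (sg := Re nu) in *.
  assert (Hk0 := pos_INR k).
  assert (Hs : Re s = sg + (INR k + 1)) by apply Re_plus_R.
  set (L1 := (RtoC (if Nat.eqb k 0 then 1 else 0) * Lfun 1 chi)%C).
  set (B := (Ci * gauss_sum q chi * RtoC ((-1) ^ p * INR (fact k) * INR q ^ k / (2 * PI) ^ S k) * Lfun (k + 1) (conj_char chi))%C).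
  set (D := (Ci * gauss_sum q chi * RtoC ((-1) ^ p * (2 * PI) ^ S k / INR q * / b ^ S k))%C).
  set (sb := fun n => sigmabar_char k (conj_char chi) (S n)) in *.
  set (An := fun n => 1 + c1 * INR (S n)) in *.
  assert (HAn : forall n, 0 < An n) by (intros n; unfold An; pose proof (INR_S_pos n); nra).
  (* Half of [Re nu] makes the dual series summable, the other half keeps the power [t ^ (e - 1)]
     integrable at 0. *)
  set (e := sg / 2). assert (He : 0 < e) by (unfold e, sg in *; lra).
  set (P := INR k + 1 + e).
  (* Of the exponent [k + 3], the part [k + 1] absorbs the growth of [sigma_char] and 2 are left for
     summability. *)
  destruct (exp_inv_bound (k + 3) b Hb) as [K1 [HK1 HB1]].
  destruct (exp_Rpower_bound P c1 ltac:(unfold P; lra) Hc1) as [K2 [HK2 HB2]].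
  destruct (ex_RInt_gen_Rpower_exp (sg + INR (k + 3))) as [KG HKG]; [pose proof (pos_INR (k + 3)); unfold sg in *; lra|].
  destruct (ex_RInt_gen_Rpower_exp e He) as [KG' HKG'].
  destruct (ex_series_bounded (fun n => Rpower (INR (S n)) (- (1 + 1))) (1 + / 1)) as [s1 Hs1];
    [intros; left; apply exp_pos|apply Rpower_sum_bound; lra|].
  destruct (sigmabar_series k q chi e H He) as [s2 Hs2]. fold P in Hs2.
  replace (L1 * RtoC (/ b) * CGamma (RtoC 1 + nu) + B * CGamma nu - D * CGamma s * Z)%C
    with ((L1 * RtoC (/ b) * CGamma (RtoC 1 + nu) + B * CGamma nu) + (- (D * CGamma s)) * Z)%C by ring.
  apply (is_CInt_series_exchange
    (fun n t => sigma_char k chi (S n) * mellin_kernel nu (b * INR (S n)) t)%C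
    (fun n t => (- D * sb n) * (Rcpow t (s - RtoC 1) * RtoC (exp (- (An n * t)))))%C
    (fun t => (L1 * RtoC (/ b)) * (Rcpow t (RtoC 1 + nu - RtoC 1) * RtoC (exp (- t))) + B * (Rcpow t (nu - RtoC 1) * RtoC (exp (- t))))%C
    _ (fun n => (- D * sb n) * (Rcpow (An n) (- s) * CGamma s))%C _
    (fun n => K1 * Rpower (INR (S n)) (- (1 + 1)))
    (fun n => (Cmod D * K2) * (Cmod (sb n) * Rpower (INR (S n)) (- P)))
    (fun t => Rpower t (sg + INR (k + 3) - 1) * exp (- 1 * t))
    (fun t => Rpower t (e - 1) * exp (- 1 * t)) KG KG' (K1 * s1) ((Cmod D * K2) * s2)).
  - intros n. apply is_CInt_scal, HI.
  - intros n. apply is_CInt_scal. apply is_CInt_Gamma_scal; [rewrite Hs; unfold sg in *; lra|apply HAn].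
  - apply is_CInt_plus; apply is_CInt_scal; apply is_CInt_CGamma; [|exact Hnu].
    rewrite Cplus_comm, Re_plus_R. unfold sg in *; lra.
  - exact HKG.
  - exact HKG'.
  - intros t _. apply Rmult_le_pos; left; apply exp_pos.
  - intros t _. apply Rmult_le_pos; left; apply exp_pos.
  - intros n. apply Rmult_le_pos; [exact HK1|left; apply exp_pos].
  - intros n. apply Rmult_le_pos; [apply Rmult_le_pos; [apply Cmod_ge_0|exact HK2]|].
    apply Rmult_le_pos; [apply Cmod_ge_0|left; apply exp_pos].
  - intros n t Ht. rewrite Cmod_mult, Cmod_mellin_kernel.
    pose proof (Cmod_sigma_char_le k q chi n H) as Hsg. pose proof (Cmod_ge_0 (sigma_char k chi (S n))).
    specialize (HB1 n t Ht). pose proof (INR_S_pos n) as Hn.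
    unfold Rminus at 2. rewrite exp_plus.
    replace (sg + INR (k + 3) - 1) with ((sg - 1) + INR (k + 3)) by ring. rewrite Rpower_plus, (Rpower_pow (k + 3)) by exact Ht.
    replace (- 1 * t) with (- t) by ring. fold sg.
    set (x := INR (S n)) in *.
    assert (Ex : Rpower x (- (1 + 1)) = x ^ S k * / x ^ (k + 3)).
    { rewrite Rpower_Ropp. replace (1 + 1) with (INR 2) by (simpl; ring). rewrite Rpower_pow by exact Hn.
      replace (k + 3)%nat with (2 + S k)%nat by lia. rewrite pow_add.
      assert (0 < x ^ S k) by (apply pow_lt; lra). field. lra. }
    rewrite Ex.
    assert (H1 : 0 < Rpower t (sg - 1)) by apply exp_pos. assert (H2 : 0 < exp (- t)) by apply exp_pos.
    assert (H3 : 0 < x ^ S k) by (apply pow_lt; lra).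
    transitivity (x ^ S k * (Rpower t (sg - 1) * (exp (- t) * (K1 * t ^ (k + 3) * / x ^ (k + 3))))); [|right; ring].
    apply Rmult_le_compat; [exact H0| |exact Hsg|].
    + apply Rmult_le_pos; [lra|]. apply Rmult_le_pos; [lra|left; apply exp_pos].
    + apply Rmult_le_compat_l; [lra|]. apply Rmult_le_compat_l; [lra|exact HB1].
  - intros n t Ht. rewrite !Cmod_mult, Cmod_opp, Cmod_Rcpow, Cmod_R, Re_minus_1, Hs.
    rewrite Rabs_pos_eq by (left; apply exp_pos). specialize (HB2 n t Ht).
    unfold An. replace (- ((1 + c1 * INR (S n)) * t)) with (- t + - (c1 * INR (S n) * t)) by ring. rewrite exp_plus.
    replace (- 1 * t) with (- t) by ring.
    assert (Et : Rpower t (e - 1) = Rpower t (sg + (INR k + 1) - 1) * Rpower t (- P)).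
    { rewrite <- Rpower_plus. f_equal. unfold P, e. field. }
    rewrite Et.
    assert (H1 : 0 < Rpower t (sg + (INR k + 1) - 1)) by apply exp_pos. assert (H2 : 0 < exp (- t)) by apply exp_pos.
    pose proof (Cmod_ge_0 D). pose proof (Cmod_ge_0 (sb n)).
    transitivity (Cmod D * Cmod (sb n) * (Rpower t (sg + (INR k + 1) - 1) * (exp (- t) * (K2 * Rpower (INR (S n)) (- P) * Rpower t (- P))))); [|right; ring].
    apply Rmult_le_compat_l; [apply Rmult_le_pos; assumption|].
    apply Rmult_le_compat_l; [lra|]. apply Rmult_le_compat_l; [lra|exact HB2].
  - apply is_series_scal_R, Hs1.
  - apply is_series_scal_R, Hs2.
  - intros t Ht. set (u := b / t). assert (Hu : 0 < u) by (apply Rdiv_lt_0_compat; lra).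
    destruct (lambert_transform p q chi u H Hp Ho Hu) as [SG [HSG HT]]. fold k in HSG, HT.
    set (w := (Rcpow t (nu - RtoC 1) * RtoC (exp (- t)))%C).
    set (Du := (Ci * gauss_sum q chi * RtoC ((-1) ^ p * (2 * PI) ^ S k / INR q * / u ^ S k))%C) in *.
    exists (w * - Du * SG)%C.
    assert (EDu : (w * Du)%C = (D * (Rcpow t (s - RtoC 1) * RtoC (exp (- t))))%C).
    { unfold Du, D, w. replace (s - RtoC 1)%C with ((nu - RtoC 1) + RtoC (INR (S k)))%C by (unfold s; rewrite S_INR; ring).
      rewrite Rcpow_plus, Rcpow_INR by exact Ht.
      assert (Eu : / u ^ S k = / b ^ S k * t ^ S k).
      { unfold u, Rdiv. rewrite Rpow_mult_distr, pow_inv, Rinv_mult, Rinv_inv. reflexivity. }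
      rewrite Eu, <- Rmult_assoc, (RtoC_mult _ (t ^ S k)). ring. }
    split.
    + eapply Clim_ext; [|apply (Clim_scal (w * - Du)%C _ _ HSG)].
      intros N. cbv beta. rewrite <- csum_scal. apply csum_ext. intros n _.
      assert (EA : exp (- (An n * t)) = exp (- t) * exp (- (4 * PI ^ 2 / (INR q * u)) * INR (S n))).
      { rewrite <- exp_plus. f_equal. unfold An, c1, u. field. lra. }
      rewrite EA, RtoC_mult. fold (sb n).
      transitivity (- (w * Du) * (sb n * RtoC (exp (- (4 * PI ^ 2 / (INR q * u)) * INR (S n)))))%C; [ring|].
      rewrite EDu. ring.
    + match goal with |- Clim _ ?T => replace T with (w * (L1 * RtoC (/ u) + B - Du * SG))%C end.
      * eapply Clim_ext; [|apply (Clim_scal w _ _ HT)].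
        intros N. cbv beta. rewrite <- csum_scal. apply csum_ext. intros n _.
        unfold mellin_kernel, w.
        replace (- t - b * INR (S n) / t) with (- t + - u * INR (S n)) by (unfold u; field; lra).
        rewrite exp_plus, RtoC_mult. ring.
      * unfold w. replace (RtoC 1 + nu - RtoC 1)%C with ((nu - RtoC 1) + RtoC 1)%C by ring.
        rewrite Rcpow_plus, (Rcpow_RtoC t 1), Rpower_1 by exact Ht.
        replace (/ u) with (/ b * t) by (unfold u; field; lra). rewrite RtoC_mult. ring.
  - apply (Clim_ext (fun N => - (D * CGamma s) * csum (fun n => sb n * Rcpow (An n) (- s)) N)%C).
    + intros N. rewrite <- csum_scal. apply csum_ext. intros n _. ring.
    + apply Clim_scal. exact HZ.
Qed.

(** * From the Mellin sum to the Bessel series and its constants *)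

Lemma Rcpow_sqrt x z : 0 < x -> Rcpow (sqrt x) z = Rcpow x (z / RtoC 2)%C.
Proof.
  intros Hx. unfold Rcpow. f_equal.
  assert (E : ln (sqrt x) = / 2 * ln x).
  { assert (Hs : 0 < sqrt x) by (apply sqrt_lt_R0, Hx).
    rewrite <- (sqrt_sqrt x) at 2 by lra. rewrite ln_mult by exact Hs. field. }
  rewrite E, RtoC_mult, RtoC_inv by lra. field.
Qed.

Theorem theorem2p1 (k q : nat) (chi : nat -> C) (a x : R) (nu : C) :
  Nat.Even k ->
  dirichlet_char q chi -> primitive_char q chi -> odd_char q chi ->
  0 < a -> 0 < x -> 0 < Re nu ->
  is_series
    (fun n : nat =>
       (sigma_char k chi (S n) * Rcpow (INR (S n)) (nu / RtoC 2)
        * BesselK nu (a * sqrt (INR (S n) * x)))%C)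
    ((RtoC (if Nat.eqb k 0 then 1 else 0)
        * Rcpow 2 (nu + RtoC 1) / Rcpow a (nu + RtoC 2)
        * CGamma (RtoC 1 + nu) * Lfun 1 chi
        * Rcpow x (- nu / RtoC 2 - RtoC 1))
     + (RtoC ((-1) ^ (k / 2)) * Ci * RtoC (INR q ^ k)
        / (Rcpow a nu * Rcpow 2 (RtoC (INR k + 2) - nu) * RtoC (PI ^ (k + 1)))
        * CGamma nu * gauss_sum q chi * CGamma (RtoC (INR k + 1))
        * Lfun (k + 1) (conj_char chi)
        * Rcpow x (- nu / RtoC 2))
     - (RtoC ((-1) ^ (k / 2)) * Ci * Rcpow a nu * Rcpow (INR q) (nu + RtoC (INR k))
        * Rcpow x (nu / RtoC 2)
        / (Rcpow 2 (RtoC 3 * nu + RtoC (INR k + 2))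
           * Rcpow PI (RtoC 2 * nu + RtoC (INR k + 1)))
        * CGamma (nu + RtoC (INR k + 1)) * gauss_sum q chi
        * CSeries (fun n : nat =>
            (sigmabar_char k (conj_char chi) (S n)
             / Rcpow (INR (S n) + a ^ 2 * INR q * x / (16 * PI ^ 2))
                     (nu + RtoC (INR k + 1)))%C)))%C.
Proof.
  intros [p Ek] H Hp Ho Ha Hx Hnu.
  pose proof (odd_char_gt_2 q chi H Ho) as Hq. pose proof PI_RGT_0 as HPI.
  assert (HqR : 0 < INR q) by (apply lt_0_INR; lia).
  assert (Hk0 := pos_INR k).
  set (b := a ^ 2 * x / 4).
  assert (Hb : 0 < b) by (unfold b; assert (0 < a ^ 2) by (apply pow_lt; lra); apply Rdiv_lt_0_compat; [nra|lra]).
  set (d := a ^ 2 * INR q * x / (16 * PI ^ 2)).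
  assert (HPI2 : 0 < PI ^ 2) by (apply pow_lt; lra).
  assert (Hd : 0 < d).
  { unfold d. apply Rdiv_lt_0_compat; [|lra]. assert (0 < a ^ 2) by (apply pow_lt; lra). repeat apply Rmult_lt_0_compat; lra. }
  set (c1 := 4 * PI ^ 2 / (INR q * b)).
  assert (Hc1 : 0 < c1) by (unfold c1; apply Rdiv_lt_0_compat; [lra|apply Rmult_lt_0_compat; lra]).
  set (s := (nu + RtoC (INR k + 1))%C).
  (* [CSeries] is defined by choice, so convergence has to be established before its value can be
     used; since [d > 0], the shift only enlarges the denominators. *)
  assert (HW : exists W, is_series (fun n => (sigmabar_char k (conj_char chi) (S n) / Rcpow (INR (S n) + d) s)%C) W).
  { destruct (sigmabar_series k q chi (Re nu) H Hnu) as [s2 Hs2].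
    apply (is_series_C_comparison _ (fun n => Cmod (sigmabar_char k (conj_char chi) (S n)) * Rpower (INR (S n)) (- (INR k + 1 + Re nu))));
      [|exists s2; exact Hs2].
    intros n. rewrite Cmod_div by apply Rcpow_neq_0. rewrite Cmod_Rcpow. unfold s. rewrite Re_plus_R.
    apply Rmult_le_compat_l; [apply Cmod_ge_0|]. rewrite Rpower_Ropp. apply Rinv_le_contravar; [apply exp_pos|].
    replace (Re nu + (INR k + 1)) with (INR k + 1 + Re nu) by ring.
    apply Rle_Rpower_l; [lra|]. pose proof (INR_S_pos n). lra. }
  destruct HW as [W HW]. rewrite (CSeries_eq _ _ HW).
  assert (Hex : forall n, exists l, is_CInt (mellin_kernel nu (b * INR (S n))) l).
  { intros n. apply ex_CInt_mellin_kernel; [exact Hnu|]. pose proof (INR_S_pos n). nra. }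
  set (I := fun n => proj1_sig (constructive_indefinite_description _ (Hex n))).
  assert (HI : forall n, is_CInt (mellin_kernel nu (b * INR (S n))) (I n)).
  { intros n. exact (proj2_sig (constructive_indefinite_description _ (Hex n))). }
  clearbody I.
  assert (HZ : Clim (csum (fun n => sigmabar_char k (conj_char chi) (S n) * Rcpow (1 + c1 * INR (S n)) (- s))%C) (Rcpow c1 (- s) * W)%C).
  { apply is_series_Clim in HW. eapply Clim_ext; [|apply (Clim_scal (Rcpow c1 (- s)) _ _ HW)].
    intros N. cbv beta. rewrite <- csum_scal. apply csum_ext. intros n _. pose proof (INR_S_pos n).
    (* Uses [c1 * d = 1]; the shift in the stated denominators is the reciprocal of [c1]. *)
    replace (1 + c1 * INR (S n)) with (c1 * (INR (S n) + d)) by (unfold c1, d, b; field; lra).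
    rewrite Rcpow_mult, (Rcpow_opp (INR (S n) + d)) by lra. unfold Cdiv. ring. }
  rewrite Ek in HZ. unfold s in HZ. rewrite Ek in HZ.
  pose proof (sigma_mellin_sum p q chi nu b I _ H Hp Ho Hb Hnu HI HZ) as HM.
  rewrite <- Ek in HM. fold s in HM.
  apply is_series_Clim.
  (* The part of the Bessel prefactor [(y / 2) ^ (- nu) / 2], with [y = a * sqrt (n x)], that does
     not depend on [n]; the rest, [n ^ (- nu / 2)], cancels the weight in the series. *)
  set (c0 := (RtoC (/ 2) * Rcpow (a / 2) (- nu) * Rcpow x (- nu / RtoC 2))%C).
  apply (Clim_scal c0) in HM.
  match goal with |- Clim _ ?T => match type of HM with Clim _ ?T' => replace T with T' end end.
  { eapply Clim_ext; [|exact HM]. intros N. cbv beta. rewrite <- csum_scal. apply csum_ext. intros n _.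
    pose proof (INR_S_pos n) as Hn. set (m := INR (S n)) in *.
    assert (Hmx : 0 < m * x) by (apply Rmult_lt_0_compat; lra).
    assert (Hy : 0 < a * sqrt (m * x)) by (apply Rmult_lt_0_compat; [lra|apply sqrt_lt_R0, Hmx]).
    assert (Ey : (a * sqrt (m * x)) ^ 2 / 4 = b * m).
    { rewrite Rpow_mult_distr, pow2_sqrt by lra. unfold b. field. }
    rewrite (BesselK_mellin nu (a * sqrt (m * x)) (I n) Hy) by (rewrite Ey; apply HI).
    replace (a * sqrt (m * x) / 2) with (a / 2 * sqrt (m * x)) by field.
    rewrite (Rcpow_mult (a / 2)), Rcpow_sqrt, (Rcpow_mult m x) by (try lra; apply sqrt_lt_R0, Hmx).
    unfold c0. pose proof (Rcpow_neq_0 m (nu / RtoC 2)).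
    replace (- nu / RtoC 2)%C with (- (nu / RtoC 2))%C by (field; apply RtoC_neq_0; lra).
    rewrite (Rcpow_opp m). field. assumption. }
  assert (Ek2 : (k / 2)%nat = p) by (rewrite Ek, Nat.mul_comm; apply Nat.div_mul; lia).
  rewrite Ek2, CGamma_fact. unfold c0, s.
  replace (- nu / RtoC 2 - RtoC 1)%C with (- (nu / RtoC 2) - RtoC 1)%C by (field; apply RtoC_neq_0; lra).
  replace (- nu / RtoC 2)%C with (- (nu / RtoC 2))%C by (field; apply RtoC_neq_0; lra).
  (* The multiples of [nu] are written as sums so that every complex power reduces to powers with
     exponent [nu] or [nu / 2] and integral powers. *)
  replace (RtoC 2 * nu)%C with (nu + nu)%C by (replace (RtoC 2) with (RtoC 1 + RtoC 1)%C by (rewrite <- RtoC_plus; f_equal; ring); ring).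
  replace (RtoC 3 * nu)%C with (nu + (nu + nu))%C by (replace (RtoC 3) with (RtoC 1 + (RtoC 1 + RtoC 1))%C by (rewrite <- !RtoC_plus; f_equal; ring); ring).
  replace (INR k + 2) with (INR (k + 2)) by (rewrite plus_INR; simpl; ring).
  replace (INR k + 1) with (INR (S k)) by (rewrite S_INR; ring).
  replace (RtoC 1) with (RtoC (INR 1)) by reflexivity.
  assert (E2 : RtoC 2 = RtoC (INR 2)) by (f_equal; simpl; ring).
  assert (Enu2 : Rcpow x nu = (Rcpow x (nu / RtoC 2) * Rcpow x (nu / RtoC 2))%C).
  { rewrite <- Rcpow_plus. f_equal. field. }
  assert (Hc1s : Rcpow c1 (- (nu + RtoC (INR (S k)))) =
    (Rcpow (INR q) nu * (Rcpow a nu * Rcpow a nu) * (Rcpow x (nu / RtoC 2) * Rcpow x (nu / RtoC 2))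
      / (Rcpow 2 nu * Rcpow 2 nu * (Rcpow 2 nu * Rcpow 2 nu) * (Rcpow PI nu * Rcpow PI nu)) / RtoC (c1 ^ S k))%C).
  { rewrite Rcpow_opp, Rcpow_plus, Rcpow_INR by exact Hc1. rewrite <- Enu2.
    replace (Rcpow c1 nu) with ((Rcpow 2 nu * Rcpow 2 nu * (Rcpow 2 nu * Rcpow 2 nu) * (Rcpow PI nu * Rcpow PI nu)) / (Rcpow (INR q) nu * (Rcpow a nu * Rcpow a nu) * Rcpow x nu))%C.
    - pose proof (Rcpow_neq_0 2 nu). pose proof (Rcpow_neq_0 PI nu). pose proof (Rcpow_neq_0 (INR q) nu). pose proof (Rcpow_neq_0 a nu). pose proof (Rcpow_neq_0 x nu).
      assert (RtoC (c1 ^ S k) <> RtoC 0) by (apply RtoC_neq_0, Rgt_not_eq, pow_lt, Hc1).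
      field. repeat split; assumption.
    - replace c1 with (2 * 2 * (2 * 2) * (PI * PI) * / (INR q * (a * a) * x)) by (unfold c1, b; field; lra).
      assert (0 < 2) by lra. assert (0 < 2 * 2 * (2 * 2)) by lra.
      assert (0 < PI * PI) by (apply Rmult_lt_0_compat; lra).
      assert (0 < a * a) by (apply Rmult_lt_0_compat; lra).
      assert (0 < INR q * (a * a)) by (apply Rmult_lt_0_compat; lra).
      assert (0 < INR q * (a * a) * x) by (apply Rmult_lt_0_compat; lra).
      assert (0 < / (INR q * (a * a) * x)) by (apply Rinv_0_lt_compat; lra).
      rewrite (Rcpow_mult (2 * 2 * (2 * 2) * (PI * PI))), Rcpow_inv by (try assumption; nra).
      rewrite (Rcpow_mult (2 * 2 * (2 * 2))), (Rcpow_mult (2 * 2)), (Rcpow_mult 2 2), (Rcpow_mult PI PI) by lra.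
      rewrite (Rcpow_mult (INR q * (a * a))), (Rcpow_mult (INR q)), (Rcpow_mult a a) by lra.
      reflexivity. }
  rewrite Hc1s. clear Hc1s.
  assert (Ea2 : Rcpow (a / 2) (- nu) = (Rcpow 2 nu / Rcpow a nu)%C).
  { rewrite Rcpow_opp. unfold Rdiv. rewrite Rcpow_mult, Rcpow_inv by (try apply Rinv_0_lt_compat; lra).
    pose proof (Rcpow_neq_0 2 nu). pose proof (Rcpow_neq_0 a nu). field. split; assumption. }
  rewrite Ea2. clear Ea2.
  assert (Ea : Rcpow a (RtoC 2) = RtoC (a ^ 2)) by (rewrite E2; apply Rcpow_INR, Ha). clear E2.
  rewrite !Rcpow_minus, !Rcpow_plus, Rcpow_opp, Ea, !Rcpow_INR by lra.
  rewrite !pow_1, Nat.add_1_r.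
  assert (Hak : 0 < a ^ 2) by (apply pow_lt; lra).
  assert (H2k : 0 < 2 ^ k) by (apply pow_lt; lra).
  assert (HPk : 0 < PI ^ S k) by (apply pow_lt; lra).
  assert (Hqk : 0 < INR q ^ k) by (apply pow_lt; lra).
  assert (Hck : 0 < c1 ^ S k) by (apply pow_lt; lra).
  assert (Eb : RtoC (/ b) = (RtoC 2 * RtoC 2 / (RtoC (a ^ 2) * RtoC x))%C).
  { rewrite <- !RtoC_mult, <- RtoC_div by nra. f_equal. unfold b. field. lra. }
  assert (EB : RtoC ((-1) ^ p * INR (fact k) * INR q ^ k / (2 * PI) ^ S k)
    = (RtoC ((-1) ^ p) * RtoC (INR (fact k)) * RtoC (INR q ^ k) * RtoC 2 / (RtoC (2 ^ (k + 2)) * RtoC (PI ^ S k)))%C).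
  { rewrite <- !RtoC_mult, <- RtoC_div by (apply Rgt_not_eq, Rmult_lt_0_compat; [apply pow_lt|]; lra). f_equal.
    rewrite Rpow_mult_distr, pow_add. simpl (2 ^ 2). rewrite <- (tech_pow_Rmult 2 k). field. lra. }
  assert (ED : RtoC ((-1) ^ p * (2 * PI) ^ S k / INR q * / b ^ S k)
    = (RtoC ((-1) ^ p) * RtoC (INR q ^ k) * RtoC 2 / (RtoC (2 ^ (k + 2)) * RtoC (PI ^ S k)) * RtoC (c1 ^ S k))%C).
  { rewrite <- !RtoC_mult, <- RtoC_div by (apply Rgt_not_eq, Rmult_lt_0_compat; [apply pow_lt|]; lra).
    rewrite <- RtoC_mult. f_equal.
    (* From [b * c1 * q = (2 * PI) ^ 2]; it trades the power of [b] for the power of [c1] that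
       cancels the one released by [Rcpow c1]. *)
    assert (Ebc : b ^ S k * c1 ^ S k * INR q ^ S k = (2 * PI) ^ S k * (2 * PI) ^ S k).
    { rewrite <- !Rpow_mult_distr. f_equal. unfold c1. field. lra. }
    assert (Hbk : 0 < b ^ S k) by (apply pow_lt; lra).
    rewrite pow_add. simpl (2 ^ 2).
    apply Rmult_eq_reg_r with (b ^ S k * INR q ^ S k); [|apply Rgt_not_eq, Rmult_lt_0_compat; [lra|apply pow_lt; lra]].
    transitivity ((-1) ^ p * (INR q ^ S k / INR q) * (2 * PI) ^ S k); [field; lra|].
    transitivity ((-1) ^ p * INR q ^ k * 2 / (2 ^ k * (2 * (2 * 1)) * PI ^ S k) * (b ^ S k * c1 ^ S k * INR q ^ S k)); [|ring].
    rewrite Ebc, Rpow_mult_distr, <- (tech_pow_Rmult 2 k), <- (tech_pow_Rmult (INR q) k). field. lra. }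
  rewrite Eb, EB, ED, (RtoC_inv 2) by lra.
  assert (N1 : RtoC 2 <> RtoC 0) by (apply RtoC_neq_0; lra).
  assert (N2 : RtoC (a ^ 2) <> RtoC 0) by (apply RtoC_neq_0; lra).
  assert (N3 : RtoC x <> RtoC 0) by (apply RtoC_neq_0; lra).
  assert (N4 : RtoC (2 ^ (k + 2)) <> RtoC 0) by (apply RtoC_neq_0, Rgt_not_eq, pow_lt; lra).
  assert (N5 : RtoC (PI ^ S k) <> RtoC 0) by (apply RtoC_neq_0; lra).
  assert (N6 : RtoC (c1 ^ S k) <> RtoC 0) by (apply RtoC_neq_0; lra).
  pose proof (Rcpow_neq_0 2 nu) as N7. pose proof (Rcpow_neq_0 PI nu) as N8.
  pose proof (Rcpow_neq_0 a nu) as N9. pose proof (Rcpow_neq_0 x (nu / RtoC 2)) as N10.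
  (* With the powers turned into independent nonzero indeterminates, the comparison of constants is
     an identity of rational functions. *)
  clear - N1 N2 N3 N4 N5 N6 N7 N8 N9 N10.
  generalize dependent (Rcpow 2 nu). generalize dependent (Rcpow PI nu). generalize dependent (Rcpow a nu).
  generalize dependent (Rcpow x (nu / RtoC 2)). generalize dependent (RtoC (c1 ^ S k)). generalize dependent (RtoC (PI ^ S k)).
  generalize dependent (RtoC (2 ^ (k + 2))). generalize dependent (RtoC x). generalize dependent (RtoC (a ^ 2)).
  intros. field. repeat split; assumption.
Qed.
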